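(* Assume that the set $\{|\mathfrak t|\}_{\mathfrak t\in\mathfrak L}\cup\{1\}$ is rationally independent. Then the BHZ concrete regularity structures $\mathscr T_{\mathrm{BHZ}}=((T^+_{\mathrm{BHZ}},\Delta^+),(T_{\mathrm{BHZ}},\Delta))$ satisfy assumptions (A), (B), (C) and (D); that is, there are linear bases $\mathcal B^+$ of $T^+_{\mathrm{BHZ}}$ and $\mathcal B$ of $T_{\mathrm{BHZ}}$ for which (A)–(D) hold.
   Context: $\mathbb N=\{0,1,2,\dots\}$. ''Rationally independent'' means that the only integers with $\sum_{\mathfrak t}k_{\mathfrak t}|\mathfrak t|+k_1=0$ are $k_{\mathfrak t}=k_1=0$. **Decorated trees.** $\mathfrak L$ is a finite set of types, each with a nonzero real $|\mathfrak t|$. A decorated tree $\tau$ is a finite rooted tree (up to isomorphism) with node set $N_\tau$, edge set $E_\tau$, root $\varrho_\tau$, type map $\mathfrak t:E_\tau\to\mathfrak L$ and decorations $\mathfrak n:N_\tau\to\mathbb N^d$, $\mathfrak o:N_\tau\to\mathbb Z^d\oplus\mathbb Z(\mathfrak L)$, $\mathfrak e:E_\tau\to\mathbb N^d$. Its homogeneity is $|\tau|=\sum_{N_\tau}|\mathfrak n|+\sum_{N_\tau}|\mathfrak o|-\sum_{E_\tau}|\mathfrak e|+\sum_{e\in E_\tau}|\mathfrak t(e)|$ with $|a+\sum_{\mathfrak t}a_{\mathfrak t}\mathfrak t|=\sum_ia_i+\sum_{\mathfrak t}a_{\mathfrak t}|\mathfrak t|$. $X^k=\bullet^k$ is the one-node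 tree with $\mathfrak n=k$, $\mathfrak o=0$; $\mathbf 1=\bullet^0$. The tree product $\tau\sigma$ identifies roots and adds the root decorations; $I^{\mathfrak t}_k(\tau)$ attaches $\tau$ to a new undecorated root by an edge of type $\mathfrak t$ with $\mathfrak e=k$; $R_\alpha$ adds $\alpha$ to $\mathfrak o(\varrho_\tau)$. **Rule.** A rule $R$ maps each $\mathfrak t\in\mathfrak L$ to a nonempty set of finite multisets of elements of $\mathfrak L\times\mathbb N^d$. Fix a rule that is normal (stable under passing to sub-multisets), subcritical (there is $\mathrm{reg}:\mathfrak L\to\mathbb R$ with $\mathrm{reg}(\mathfrak t)<|\mathfrak t|+\inf_{N\in R(\mathfrak t)}\sum_{(\mathfrak l,k)\in N}(\mathrm{reg}(\mathfrak l)-|k|)$), and complete (the contraction below of strongly conforming trees gives strongly conforming trees). For a node $x$ let $N(x)$ be the multiset of $(\mathfrak t(e),\mathfrak e(e))$ over edges $e$ leaving $x$ away from the root. A tree conforms to $R$ if $N(x)\in R(\mathfrak t(e_x))$ for every non-root $x$, $e_x$ being the edge from $x$ towards the root; it strongly conforms if moreover $N(\varrho_\tau)\in R(\mathfrak t)$ for some $\mathfrak t$. Contraction: given a tree with $\mathfrak o=0$ and disjoint subtrees $S$ with at least one edge, with $\mathfrak n_S\le\mathfrak n$ on the nodes of $S$ and $\mathfrak e_S\in\mathbb N^d$ on the edges leaving $S$ upwards, such that $\sum|\mathfrak n_S|+\sum|\mathfrak e_S|+\sum_{e\in E_S}(|\mathfrak t(e)|-|\mathfrak e(e)|)<0$,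 contract each $S$ to one node with $\mathfrak n$-decoration $\sum_S(\mathfrak n-\mathfrak n_S)$ and $\mathfrak o$-decoration $\sum\mathfrak n_S+\sum\mathfrak e_S+\sum_{e\in E_S}(\mathfrak t(e)-\mathfrak e(e))$, and add $\mathfrak e_S$ to $\mathfrak e$ on the edges leaving $S$. $\mathcal B_{\mathrm{BHZ}}$ is the set of strongly conforming trees with $\mathfrak o=0$ and their contractions; $\mathcal B^+_{\mathrm{BHZ}}$ is the set of conforming trees $X^k\prod_{i=1}^NI^{\mathfrak t_i}_{k_i}(\tau_i)$ with $\tau_i\in\mathcal B_{\mathrm{BHZ}}$, $|I^{\mathfrak t_i}_{k_i}(\tau_i)|>0$. $T_{\mathrm{BHZ}}=\mathrm{span}\,\mathcal B_{\mathrm{BHZ}}$, $T^+_{\mathrm{BHZ}}=\mathrm{span}\,\mathcal B^+_{\mathrm{BHZ}}$ (algebra for the tree product, unit $\mathbf 1_+=\mathbf 1$), graded by homogeneity. **Splitting maps.** $\Delta:T_{\mathrm{BHZ}}\to T_{\mathrm{BHZ}}\otimes T^+_{\mathrm{BHZ}}$: $\Delta\mathbf 1=\mathbf 1\otimes\mathbf 1$, $\Delta X_i=X_i\otimes\mathbf 1+\mathbf 1\otimes X_i$, $\Delta(\tau\sigma)=(\Delta\tau)(\Delta\sigma)$, $\Delta R_\alpha=(R_\alpha\otimes\mathrm{Id})\Delta$, $\Delta I^{\mathfrak t}_k(\tau)=(I^{\mathfrak t}_k\otimes\mathrm{Id})\Delta\tau+\sum_{|\ell|+|k|<|\tau|+|\mathfrak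 t|}\frac{X^\ell}{\ell!}\otimes I^{\mathfrak t}_{k+\ell}(\tau)$. $\Delta^+:T^+_{\mathrm{BHZ}}\to T^+_{\mathrm{BHZ}}\otimes T^+_{\mathrm{BHZ}}$ is multiplicative with $\Delta^+X_i=X_i\otimes\mathbf 1+\mathbf 1\otimes X_i$ and $\Delta^+I^{\mathfrak t}_k(\tau)=(I^{\mathfrak t}_k\otimes\mathrm{Id})\Delta\tau+\sum_\ell\frac{X^\ell}{\ell!}\otimes I^{\mathfrak t}_{k+\ell}(\tau)$, where planted trees of nonpositive homogeneity are set to $0$ in $T^+_{\mathrm{BHZ}}$. **Notation for bases.** Given bases $\mathcal B^+,\mathcal B$ of $T^+,T$ made of homogeneous elements, for $\tau\in\mathcal B$ write uniquely $\Delta\tau=\sum_{\sigma\in\mathcal B,\sigma\le\tau}\sigma\otimes(\tau/\sigma)$ with $\tau/\sigma\in T^+\setminus\{0\}$ (this defines $\sigma\le\tau$); for $\tau\in\mathcal B^+$, $\Delta^+\tau=\sum_{\sigma\in\mathcal B^+,\sigma\le^+\tau}\sigma\otimes(\tau/^+\sigma)$; $<,<^+$ mean in addition $\sigma\neq\tau$. **Assumption (A).** (1) $\mathcal B^+$ is a commutative monoid freely generated by a finite set $\mathcal B^+_\circ$ and $X_1,\dots,X_d$; elements of $\mathcal B_\circ^+$ have positive homogeneity, $|X_i|=1$, $|\tau\sigma|=|\tau|+|\sigma|$. (2) $\Delta^+X_i=X_i\otimes\mathbf 1_++\mathbf 1_+\otimes X_i$; $\mathcal B^+_X$ is the submonoid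 generated by $X_1,\dots,X_d$. (3) There is $\mathcal B_\bullet\subset\mathcal B$ such that $\mathcal B$ is in bijection with $\mathbb N^d\times\mathcal B_\bullet$; $(k,\sigma)$ is denoted $\underline X^k\sigma$ and $|\underline X^k\sigma|=|k|+|\sigma|$. (4) If $\mathcal B_\bullet$ contains an element $\mathbf 1$ of homogeneity $0$, it is unique and $\Delta\mathbf 1=\mathbf 1\otimes\mathbf 1_+$; $\underline X^k:=\underline X^k\mathbf 1$, $\mathcal B_{\underline X}:=\{\underline X^k\}_{k}\subset\mathcal B$; $\Delta\underline X_i=\underline X_i\otimes\mathbf 1_++\mathbf 1\otimes X_i$, $\Delta$ is multiplicative on $\mathcal B_{\underline X}$, and $\Delta(\underline X^k\sigma)=(\Delta\underline X^k)(\Delta\sigma)$. **Assumption (B).** (1) For $\sigma<\tau$ in $\mathcal B$, either $\tau/\sigma\in\mathrm{span}(\mathcal B^+_X)$ or $\tau/\sigma\in\mathrm{span}(\mathcal B^+\setminus\mathcal B^+_X)$. (2) For $\tau\in\mathcal B^+\setminus\mathcal B^+_X$, $\sigma\in\mathcal B^+_X$: $\tau/^+\sigma\in\mathrm{span}(\mathcal B^+\setminus\mathcal B^+_X)$. (3) For $\tau\in\mathcal B\setminus\mathcal B_{\underline X}$, $\sigma\in\mathcal B_{\underline X}$: $\tau/\sigma\in\mathrm{span}(\mathcal B^+\setminus\mathcal B^+_X)$. (Quotients are $0$ when $\sigma\not\le\tau$, resp. $\sigma\not\le^+\tau$.) Define $D^k\tau$ for $\tau\in\mathcal B^+$ by $\Delta^+\tau=\sum_{\sigma\in\mathcal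 B^+\setminus\mathcal B^+_X}\sigma\otimes(\tau/^+\sigma)+\sum_{k}\frac{X^k}{k!}\otimes D^k\tau$. **Assumption (C).** (1) There is a finite subset $\mathcal G^+_\circ$ of $\mathcal B^+_\circ$ such that $\mathcal B^+_\circ=\bigsqcup_{\tau\in\mathcal G^+_\circ}\{D^k\tau:k\in\mathbb N^d,|\tau|-|k|>0\}$. (2) There is a preorder $\trianglelefteq$ on $\mathcal B^+$ ($\sigma\triangleleft\tau$ means $\sigma\trianglelefteq\tau$ and not $\tau\trianglelefteq\sigma$) such that for each $\tau\in\mathcal G^+_\circ$, $\Delta^+\tau=\tau\otimes\mathbf 1_++\sum_{\sigma<^+\tau,\sigma\notin\mathcal B^+_X}\sigma\otimes(\tau/^+\sigma)+\sum_k\frac{X^k}{k!}\otimes D^k\tau$ with $\sigma\in\mathcal B^+(\tau^-)$ and $\tau/^+\sigma\in\mathrm{span}(\mathcal B^+(\tau^-))$ for each $\sigma$ in the first sum, $\mathcal B^+(\tau^-)$ being the submonoid of $\mathcal B^+$ generated by $\{X_1,\dots,X_d\}\cup\bigsqcup_{\sigma\in\mathcal G^+_\circ,\sigma\triangleleft\tau}\{D^k\sigma:k\in\mathbb N^d,|\sigma|-|k|>0\}$. (3) Every $\sigma\in\mathcal B^+\setminus\mathcal B^+_X$ with $\sigma\le^+\tau$ for some $\tau\in\mathcal G^+_\circ$ has non-integer homogeneity. **Assumption (D).** For any $\tau\in\mathcal B_\bullet$, there is no term of the form $\sigma\otimes X^k$ with $k\ne0$ in the expansion of $\Delta\tau$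.
   Formalization: ''Finite'' fails for d≥1 and nonempty types (the I^t_0(X^l) with positive homogeneity are infinitely many free generators of T^+): the finiteness of B^+_∘ in (A)(1) is dropped, and in (C)(1) G^+_∘ is only required to have finitely many elements below each homogeneity. *)

(* Defs.v *)
From HB Require Import structures.
From Stdlib Require List.
From mathcomp Require Import all_boot all_order all_algebra.
From mathcomp Require Import finmap multiset.
From mathcomp Require Import boolp classical_sets functions cardinality fsbigop.
From mathcomp Require Import reals constructive_ereal ereal.
From mathcomp Require Import -(notations) monalg.

Set Implicit Arguments.
Unset Strict Implicit.
Unset Printing Implicit Defensive.
Import Order.TTheory GRing.Theory Num.Theory.
Local Open Scope classical_set_scope.
Local Open Scope quotient_scope.
Local Open Scope ring_scope.

(* The notations of monalg are not imported, since they clash with those of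
   the extended reals. *)
Notation "{ 'malg' R [ K ] }" := (@malg K%type R)
  (at level 0, K, R at level 2, format "{ 'malg'  R [ K ] }") : type_scope.

Notation mindex d := {ffun 'I_d -> nat}.

Section MultiIndex.
Variable d : nat.
Definition mlen (k : mindex d) : nat := (\sum_i k i)%N.
Definition mfact (k : mindex d) : nat := (\prod_i (k i)`!)%N.
Definition munit (i : 'I_d) : mindex d := [ffun j => (j == i) : nat].
Definition mle (k l : mindex d) : bool := [forall i, (k i <= l i)%N].
Definition msub (k l : mindex d) : mindex d := [ffun i => (k i - l i)%N].
End MultiIndex.

Section FreeModule.
Variable R : realType.

Definition lext (A B : choiceType) (f : A -> {malg R[B]}) (u : {malg R[A]}) :
  {malg R[B]} := \sum_(a <- msupp u) mcoeff a u *: f a.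

(* The tensor product of the free modules on A and B is the free module on
   A * B. *)
Definition tens (A B : choiceType) (u : {malg R[A]}) (v : {malg R[B]}) :
  {malg R[A * B]} := lext (fun a => lext (fun b => mkmalgU (a, b) 1) v) u.

Variable K : choiceType.
Implicit Types (S B : set {malg R[K]}) (u : {malg R[K]}).

Definition lspan S : set {malg R[K]} :=
  [set u | exists (s : seq {malg R[K]}) (c : {malg R[K]} -> R),
     (forall v, v \in s -> S v) /\ u = \sum_(v <- s) c v *: v].

Definition lin_indep S : Prop :=
  forall (s : seq {malg R[K]}) (c : {malg R[K]} -> R),
    uniq s -> (forall v, v \in s -> S v) ->
    \sum_(v <- s) c v *: v = 0 -> forall v, v \in s -> c v = 0.

Definition is_basis B S : Prop := lin_indep B /\ lspan B = S.

Variable wt : K -> R.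

Definition homogeneous (c : R) u : Prop := forall x, x \in msupp u -> wt x = c.

(* The homogeneity of a nonzero homogeneous u. *)
Definition hmg u : R := xget 0 [set c | u != 0 /\ homogeneous c u].

Definition homogeneous_basis B S : Prop :=
  is_basis B S /\ forall b, B b -> exists c, homogeneous c b.

End FreeModule.

Section Assumptions.
Variables (R : realType) (d : nat).

(* T+ and T (spacep and space) are subspaces of the free modules on sets symbp
   and symb of graded symbols; Delta+ and Delta are given on the ambient
   modules. *)
Record crs := CRS {
  symbp : choiceType;
  symb : choiceType;
  wtp : symbp -> R;
  wt : symb -> R;
  spacep : set {malg R[symbp]};
  space : set {malg R[symb]};
  unitp : {malg R[symbp]};
  mulp : {malg R[symbp]} -> {malg R[symbp]} -> {malg R[symbp]};
  Xp : 'I_d -> {malg R[symbp]};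
  Deltap : {malg R[symbp]} -> {malg R[symbp * symbp]};
  Delta : {malg R[symb]} -> {malg R[symb * symbp]} }.

Variable S : crs.
Local Notation Vp := {malg R[symbp S]}.
Local Notation V := {malg R[symb S]}.
Local Notation hp := (hmg (@wtp S)).
Local Notation h := (hmg (@wt S)).
Local Notation "a *+* b" := (mulp a b) (at level 40, left associativity).

(* Candidate bases with the auxiliary choices made in the assumptions:
   genp is the generating set of basp, basdot the subset of bas indexing it
   together with the multi-indices, and Xact k s the element X^k s of bas;
   quo t s is t / s and quop t s is t /+ s. *)
Record frame := Frame {
  basp : set Vp;
  genp : set Vp;
  bas : set V;
  basdot : set V;
  Xact : mindex d -> V -> V;
  quop : Vp -> Vp -> Vp;
  quo : V -> V -> Vp }.

Variable F : frame.
Local Notation Bp := (basp F).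
Local Notation Bpo := (genp F).
Local Notation B := (bas F).
Local Notation Bdot := (basdot F).
Local Notation Xu := (Xact F).
Local Notation qp := (quop F).
Local Notation q := (quo F).

(* g is the family of coefficients of the expansion of z in A (x) T+ along the
   elements of A. *)
Definition expansion (L : choiceType) (A : set {malg R[L]})
    (z : {malg R[L * symbp S]}) (g : {malg R[L]} -> Vp) : Prop :=
  [/\ finite_set [set s | g s != 0],
      forall s, g s != 0 -> A s,
      forall s, spacep (g s)
    & z = \sum_(s \in A) tens s (g s)].

Definition bases : Prop :=
  [/\ homogeneous_basis (@wtp S) Bp (@spacep S),
      homogeneous_basis (@wt S) B (@space S),
      forall t, Bp t -> expansion Bp (Deltap t) (qp t)
    & forall t, B t -> expansion B (Delta t) (q t)].

Definition leBp (s t : Vp) : Prop := [/\ Bp s, Bp t & qp t s != 0].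
Definition ltBp (s t : Vp) : Prop := leBp s t /\ s <> t.
Definition leB (s t : V) : Prop := [/\ B s, B t & q t s != 0].
Definition ltB (s t : V) : Prop := leB s t /\ s <> t.

Definition prodp (s : seq Vp) : Vp := \big[@mulp S/@unitp S]_(a <- s) a.

Definition Xpow (k : mindex d) : Vp :=
  \big[@mulp S/@unitp S]_(i < d) iter (k i) (mulp (Xp S i)) (@unitp S).

Definition BpX : set Vp := [set Xpow k | k in setT].

Definition is_one (e : V) : Prop := Bdot e /\ h e = 0.

Definition BX : set V := [set u | exists k e, is_one e /\ u = Xu k e].

Definition submonoid (A : set Vp) : set Vp :=
  [set u | exists s : seq Vp, (forall a, a \in s -> A a) /\ u = prodp s].

Definition commutative_monoid_on (A : set Vp) : Prop :=
  [/\ A (@unitp S),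
      forall a b, A a -> A b -> A (a *+* b) /\ a *+* b = b *+* a,
      forall a b c, A a -> A b -> A c -> a *+* (b *+* c) = a *+* b *+* c
    & forall a, A a -> @unitp S *+* a = a].

Definition finite_graded (A : set Vp) : Prop :=
  forall c : R, finite_set [set a | A a /\ hp a <= c].

(* The product of sum_l X^l (x) a l and sum_s s (x) b s for
   X^l (X^m s) = X^(l + m) s. *)
Definition Xprod (a : mindex d -> Vp) (b : V -> Vp) :
    {malg R[symb S * symbp S]} :=
  \sum_(l \in [set: mindex d]) \sum_(m \in [set: mindex d])
    \sum_(s \in Bdot) tens (Xu (l + m) s) (a l *+* b (Xu m s)).

Definition assumptionA1 : Prop :=
  [/\ commutative_monoid_on Bp,
      set_bij
        [set p : mindex d * {mset Vp}%mset | forall a, a \in p.2 -> Bpo a]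
        Bp (fun p => Xpow p.1 *+* prodp p.2),
      forall b, Bpo b -> 0 < hp b,
      forall i, hp (Xp S i) = 1
    & forall a b, Bp a -> Bp b -> hp (a *+* b) = hp a + hp b].

Definition assumptionA2 : Prop :=
  forall i, Deltap (Xp S i)
            = tens (Xp S i) (@unitp S) + tens (@unitp S) (Xp S i).

Definition assumptionA3 : Prop :=
  [/\ Bdot `<=` B,
      set_bij [set p : mindex d * V | Bdot p.2] B (fun p => Xu p.1 p.2),
      forall s, Bdot s -> Xu 0 s = s
    & forall k s, Bdot s -> h (Xu k s) = (mlen k)%:R + h s].

Definition assumptionA4 : Prop :=
  forall e, is_one e ->
  [/\ forall e', is_one e' -> e' = e,
      Delta e = tens e (@unitp S),
      forall i, Delta (Xu (munit i) e)
                = tens (Xu (munit i) e) (@unitp S) + tens e (Xp S i),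
      forall k l, Delta (Xu (k + l) e)
                  = Xprod (fun m => q (Xu k e) (Xu m e)) (q (Xu l e))
    & forall k s, Bdot s ->
        Delta (Xu k s) = Xprod (fun m => q (Xu k e) (Xu m e)) (q s)].

Definition assumptionA : Prop :=
  [/\ assumptionA1, assumptionA2, assumptionA3 & assumptionA4].

Definition assumptionB : Prop :=
  [/\ forall s t, ltB s t ->
        lspan BpX (q t s) \/ lspan (Bp `\` BpX) (q t s),
      forall t s, (Bp `\` BpX) t -> BpX s -> lspan (Bp `\` BpX) (qp t s)
    & forall t s, (B `\` BX) t -> BX s -> lspan (Bp `\` BpX) (q t s)].

(* X^k / k! (x) D^k t is X^k (x) (t /+ X^k). *)
Definition Dk (k : mindex d) (t : Vp) : Vp := (mfact k)%:R *: qp t (Xpow k).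

Definition Dorbit (t : Vp) : set Vp :=
  [set Dk k t | k in [set k : mindex d | 0 < hp t - (mlen k)%:R]].

(* The submonoid B+(t^-), where tri is the preorder. *)
Definition Bminus (G : set Vp) (tri : Vp -> Vp -> Prop) (t : Vp) : set Vp :=
  submonoid (range (Xp S) `|`
    \bigcup_(s in [set s | [/\ G s, tri s t & ~ tri t s]]) Dorbit s).

(* For decorated trees genp and G cannot be finite outright: if d > 0 and there
   is at least one type t, the trees I^t_0(X^l) with |t| + |l| > 0 are
   algebraically independent and indecomposable in T+, which is therefore not
   finitely generated. Finiteness of G is required below every homogeneity;
   each of its elements contributes a finite orbit to genp. *)
Definition assumptionC : Prop :=
  exists G : set Vp,
  [/\ G `<=` Bpo,
      finite_graded G,
      Bpo = \bigcup_(t in G) Dorbit t /\ trivIset G Dorbit,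
      exists tri : Vp -> Vp -> Prop,
        [/\ forall a, Bp a -> tri a a,
            forall a b c, Bp a -> Bp b -> Bp c -> tri a b -> tri b c -> tri a c
          & forall t, G t ->
            Deltap t = tens t (@unitp S)
              + \sum_(s \in [set s | ltBp s t /\ ~ BpX s]) tens s (qp t s)
              + \sum_(k \in [set: mindex d])
                  tens ((mfact k)%:R^-1 *: Xpow k) (Dk k t)
            /\ (forall s, ltBp s t -> ~ BpX s ->
                  Bminus G tri t s /\ lspan (Bminus G tri t) (qp t s))]
    & forall s t, (Bp `\` BpX) s -> G t -> leBp s t -> hp s \isn't a Num.int].

(* No s (x) X^k with k != 0 occurs in Delta t, for t in Bdot. *)
Definition assumptionD : Prop :=
  forall t s, Bdot t -> B s ->
    lspan (Bp `\` [set Xpow k | k in [set k | k != 0]]) (q t s).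

End Assumptions.

Lemma all2_perm (T : eqType) (e : rel T) (s r s' : seq T) :
  all2 e s r -> perm_eq r s' ->
  exists2 s1, perm_eq s s1 & all2 e s1 s'.
Proof.
case: r => [|x0 r0].
  by case: s => // _; rewrite perm_sym => /perm_nilP ->; exists [::].
set r := x0 :: r0; rewrite all2E => /andP[/eqP sz /all_nthP es].
rewrite perm_sym => /(perm_iotaP x0)[I pI ->].
exists [seq nth x0 s i | i <- I].
  rewrite perm_sym; apply/(perm_iotaP x0); exists I => //.
  by rewrite sz.
have : all (fun i => (i < size r)%N) I.
  by apply/allP => i; rewrite (perm_mem pI) mem_iota add0n => /andP[].
elim: I {pI} => //= i I IH /andP[ir /IH ->]; rewrite andbT.
have := es (x0, x0) i; rewrite size_zip sz minnn nth_zip //=; exact.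
Qed.

Lemma mem_In (T : eqType) (x : T) (s : seq T) : x \in s -> List.In x s.
Proof.
elim: s => //= y s IH; rewrite inE => /orP[/eqP->|/IH xs]; [left|right] => //.
Qed.

Section Trees.
Variables (R : realType) (d : nat) (L : finType).

Notation odeco := ({ffun 'I_d -> int} * {ffun L -> int})%type.
Notation label := (L * mindex d)%type.

(* Plane representatives: Node n o s has root decorations n, o, and s lists the
   type and e-decoration of each edge leaving the root together with the tree
   above it. *)
Inductive rtree := Node of mindex d & odeco & seq (label * rtree).

Lemma rtree_ind' (P : rtree -> Prop) :
  (forall n o s, (forall x, List.In x s -> P x.2) -> P (Node n o s)) ->
  forall t, P t.
Proof.
move=> H; fix IH 1 => -[n o s]; apply: H.
elim: s => [|[l t] s IHs] x /=; first by case.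
by case=> [<-|xs]; [exact: (IH t) | exact: (IHs x xs)].
Qed.

Notation code := (GenTree.tree ((mindex d * odeco) + label)%type).

Fixpoint enc_rtree (t : rtree) : code :=
  let: Node n o s := t in
  GenTree.Node 0 (GenTree.Leaf (inl (n, o)) ::
    [seq GenTree.Node 0 [:: GenTree.Leaf (inr x.1); enc_rtree x.2] | x <- s]).

Fixpoint dec_rtree (c : code) : option rtree :=
  if c is GenTree.Node _ (GenTree.Leaf (inl p) :: s) then
    Some (Node p.1 p.2 (pmap (fun x =>
      if x is GenTree.Node _ [:: GenTree.Leaf (inr l); c'] then
        omap (pair l) (dec_rtree c') else None) s))
  else None.

Lemma encK : pcancel enc_rtree dec_rtree.
Proof.
elim/rtree_ind' => n o s IH /=; congr (Some (Node _ _ _)).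
elim: s IH => [|[l t] s IHs] IH //=.
rewrite (IH (l, t) (or_introl erefl)) /=; congr (_ :: _).
by apply: IHs => x xs; apply: IH; right.
Qed.

HB.instance Definition _ := Choice.copy rtree (pcan_type encK).

Definition ndeco (t : rtree) := let: Node n _ _ := t in n.
Definition odec (t : rtree) := let: Node _ o _ := t in o.
Definition branches (t : rtree) := let: Node _ _ s := t in s.

Fixpoint tiso (t u : rtree) {struct t} : bool :=
  let: Node n o s := t in let: Node n' o' s' := u in
  [&& n == n', o == o'
    & has (fun r => all2 (fun x y => (x.1 == y.1) && tiso x.2 y.2) s r)
          (permutations s')].


Lemma tiso_refl : reflexive tiso.
Proof.
elim/rtree_ind' => n o s IH /=; rewrite !eqxx /=; apply/hasP; exists s.
  by rewrite mem_permutations.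
elim: s IH => //= x s IHs IH; rewrite eqxx IH /=; last by left.
by apply: IHs => y ys; apply: IH; right.
Qed.

Lemma tiso_sym : symmetric tiso.
Proof.
suff H t u : tiso t u -> tiso u t by move=> t u; apply/idP/idP; exact: H.
elim/rtree_ind': t u => n o s IH [n' o' s'] /= /and3P[/eqP-> /eqP-> /hasP[r]].
rewrite mem_permutations => rs' sr; rewrite !eqxx /=.
have [s1 ss1 e1] := all2_perm sr rs'.
apply/hasP; exists s1; first by rewrite mem_permutations perm_sym.
have {}IH : forall x, x \in s1 -> forall u, tiso x.2 u -> tiso u x.2.
  by move=> x; rewrite -(perm_mem ss1) => /mem_In; exact: IH.
elim: s1 s' {sr rs' ss1} e1 IH => [|x s1 IHs] [|y s'] //=.
move=> /andP[/andP[/eqP exy txy] e1] IH.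
rewrite exy eqxx IH ?mem_head //=.
by apply: IHs => // z zs; apply: IH; rewrite inE zs orbT.
Qed.

Lemma tiso_trans : transitive tiso.
Proof.
move=> u t v.
elim/rtree_ind': t u v => n o s IH [n1 o1 s1] [n2 o2 s2] /=.
move=> /and3P[/eqP-> /eqP-> /hasP[r]]; rewrite mem_permutations => rs1 sr.
move=> /and3P[-> -> /hasP[r']]; rewrite mem_permutations => rs2 s1r' /=.
rewrite perm_sym in rs1.
have [r1 pr1 e1] : exists2 r1, perm_eq r' r1 & all2
    (fun x y => (x.1 == y.1) && tiso y.2 x.2) r1 r.
  apply: all2_perm rs1; move: s1r'; clear; elim: s1 r' => [|x s IHs] [|y r] //=.
  by move=> /andP[/andP[/eqP-> ->] /IHs->]; rewrite eqxx.
apply/hasP; exists r1.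
  by rewrite mem_permutations; apply: perm_trans rs2; rewrite perm_sym.
move: IH sr e1; clear; elim: s r r1 => [|x s IHs] [|y r] [|z r1] //= IH.
move=> /andP[/andP[/eqP-> txy] sr] /andP[/andP[/eqP-> tyz] e1].
apply/andP; split; first by apply/andP; split; [exact: eqxx|
  exact: (IH x (or_introl erefl) y.2 z.2 txy tyz)].
by apply: (IHs r) sr e1 => w ws; exact: (IH w (or_intror ws)).
Qed.

Definition tiso_equiv := EquivRel tiso tiso_refl tiso_sym tiso_trans.

Definition dtree := {eq_quot tiso_equiv}.
HB.instance Definition _ := Choice.on dtree.
HB.instance Definition _ := EqQuotient.on dtree.

Definition tcls (t : rtree) : dtree := \pi_dtree t.

Variable h : L -> R.

Definition ohom (o : odeco) : R :=
  (\sum_i o.1 i)%:~R + \sum_t (o.2 t)%:~R * h t.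

Fixpoint rhom (t : rtree) : R :=
  let: Node n o s := t in
  (mlen n)%:R + ohom o
    + foldr (fun x a => h x.1.1 - (mlen x.1.2)%:R + rhom x.2 + a) 0 s.

Definition thom (t : dtree) : R := rhom (repr t).

Definition rmul (t u : rtree) : rtree :=
  let: Node n o s := t in let: Node n' o' s' := u in
  Node (n + n') (o + o') (s ++ s').

Definition rRadd (a : odeco) (t : rtree) : rtree :=
  let: Node n o s := t in Node n (o + a) s.

Definition tmul (t u : dtree) : dtree := tcls (rmul (repr t) (repr u)).
Definition plant (l : L) (k : mindex d) (t : dtree) : dtree :=
  tcls (Node 0 0 [:: (l, k, repr t)]).
Definition Radd (a : odeco) (t : dtree) : dtree := tcls (rRadd a (repr t)).
Definition tX (k : mindex d) : dtree := tcls (Node k 0 [::]).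

Variable rule : L -> set {mset label}%mset.

Definition rule_normal : Prop := forall t (M N : {mset label}%mset),
  rule t N -> msubset M N -> rule t M.

Definition rule_subcritical : Prop := exists reg : L -> R, forall t,
  ((reg t)%:E < (h t)%:E +
     ereal_inf [set (\sum_(p <- (N : seq label)) (reg p.1 - (mlen p.2)%:R))%:E
               | N in rule t])%E.

Definition rootset (t : rtree) : {mset label}%mset :=
  seq_mset [seq x.1 | x <- branches t].

Fixpoint conforming (t : rtree) : Prop :=
  let: Node _ _ s := t in
  foldr (fun x P =>
    [/\ rule x.1.1 (rootset x.2), conforming x.2 & P]) True s.

Definition strongly_conforming (t : rtree) : Prop :=
  conforming t /\ exists l, rule l (rootset t).

(* A tree with o = 0 together with pairwise disjoint subtrees S having at least
   one edge. In MNode n nS s, nS is the decoration n_S at this node (0 if the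
   node is in no S); the mark of an edge in s is None if the edge belongs to
   some S and Some eS otherwise, eS being its decoration e_S (0 if the lower
   end of the edge is in no S). The S are thus the connected components with
   at least one edge of the forest of edges marked None. *)
Inductive mtree :=
  MNode of mindex d & mindex d & seq (label * option (mindex d) * mtree).

Fixpoint underlying (m : mtree) : rtree :=
  let: MNode n _ s := m in
  Node n 0 [seq (x.1.1, underlying x.2) | x <- s].

Definition oX (k : mindex d) : odeco := ([ffun i => (k i)%:Z], 0).
Definition oedge (x : label) : odeco :=
  ([ffun i => - (x.2 i)%:Z], [ffun t => (t == x.1)%:Z]).

Fixpoint contraction (m : mtree) : rtree :=
  let: MNode n nS s := m in
  foldr (fun x t =>
    let u := contraction x.2 in
    match x.1.2 with
    | None => rmul (rRadd (oedge x.1.1) u) t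
    | Some eS => rmul (Node 0 (oX eS) [:: (x.1.1.1, x.1.1.2 + eS, u)]) t
    end) (Node (msub n nS) (oX nS) [::]) s.

(* Imposed at the nodes that are not the upper end of an edge marked None. The
   quantity required to be negative for an S is the homogeneity of the
   o-decoration of the node to which S is contracted. *)
Definition component_ok (m : mtree) : bool :=
  let: MNode _ nS s := m in
  if has (fun x => x.1.2 == None) s
  then ohom (odec (contraction m)) < 0
  else (nS == 0) && all (fun x => x.1.2 == Some 0) s.

Fixpoint admissible_at (top : bool) (m : mtree) : bool :=
  let: MNode n nS s := m in
  [&& mle nS n, top ==> component_ok m
    & all (fun x => admissible_at (x.1.2 != None) x.2) s].

Definition admissible (m : mtree) : bool := admissible_at true m.

Definition rule_complete : Prop := forall m, admissible m ->
  strongly_conforming (underlying m) -> strongly_conforming (contraction m).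

(* Uncontracted trees are the contractions along the empty family. *)
Definition B_BHZ : set dtree :=
  [set t | exists m, [/\ admissible m, strongly_conforming (underlying m)
                       & t = tcls (contraction m)]].

Definition Bp_BHZ : set dtree :=
  [set t | conforming (repr t) /\
    exists (k : mindex d) (s : seq (label * dtree)),
      (forall x, x \in s -> B_BHZ x.2 /\ 0 < thom (plant x.1.1 x.1.2 x.2)) /\
      t = foldr (fun x u => tmul (plant x.1.1 x.1.2 x.2) u) (tX k) s].

Definition mulT (u v : {malg R[dtree]}) : {malg R[dtree]} :=
  lext (fun a => lext (fun b => mkmalgU (tmul a b) 1) v) u.

Local Notation TT := {malg R[dtree * dtree]}.

Definition mul2 (z w : TT) : TT :=
  lext (fun a => lext (fun b =>
    mkmalgU (tmul a.1 b.1, tmul a.2 b.2) 1) w) z.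

Definition one2 : TT := mkmalgU (tX 0, tX 0) 1.

Definition DeltaX (n : mindex d) : TT :=
  \big[mul2/one2]_(i < d)
    iter (n i) (mul2 (mkmalgU (tX (munit i), tX 0) 1
                      + mkmalgU (tX 0, tX (munit i)) 1)) one2.

Definition Taylor (l : L) (k : mindex d) (t : dtree) : TT :=
  \sum_(j \in [set j : mindex d | (mlen j + mlen k)%N%:R < thom t + h l])
    ((mfact j)%:R^-1 : R) *: mkmalgU (tX j, plant l (k + j) t) 1.

(* The tree with root decorations n, o and branches I^l_k(t) is
   R_o (X^n prod I^l_k(t)). *)
Fixpoint rDelta (t : rtree) : TT :=
  let: Node n o s := t in
  lext (fun p => mkmalgU (Radd o p.1, p.2) 1)
    (foldr (fun x z => mul2
       (lext (fun p => mkmalgU (plant x.1.1 x.1.2 p.1, p.2) 1) (rDelta x.2)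
        + Taylor x.1.1 x.1.2 (tcls x.2)) z) (DeltaX n) s).

Definition Delta_BHZ : {malg R[dtree]} -> TT :=
  lext (fun t : dtree => rDelta (repr t)).

(* The elements of Bp_BHZ have no o-decoration at the root. *)
Definition rDeltap (t : rtree) : TT :=
  let: Node n _ s := t in
  foldr (fun x z => mul2
    (lext (fun p => let u := plant x.1.1 x.1.2 p.1 in
                    if 0 < thom u then mkmalgU (u, p.2) 1 else 0) (rDelta x.2)
     + Taylor x.1.1 x.1.2 (tcls x.2)) z) (DeltaX n) s.

Definition Deltap_BHZ : {malg R[dtree]} -> TT :=
  lext (fun t : dtree => rDeltap (repr t)).

Definition BHZ : crs R d := {|
  symbp := dtree; symb := dtree;
  wtp := thom; wt := thom;
  spacep := lspan [set mkmalgU t 1 | t in Bp_BHZ];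
  space := lspan [set mkmalgU t 1 | t in B_BHZ];
  unitp := mkmalgU (tX 0) 1;
  mulp := mulT;
  Xp := fun i => mkmalgU (tX (munit i)) 1;
  Deltap := Deltap_BHZ;
  Delta := Delta_BHZ |}.

Definition rationally_independent : Prop := forall (k : L -> int) (k1 : int),
  \sum_t (k t)%:~R * h t + k1%:~R = 0 -> (forall t, k t = 0) /\ k1 = 0.

End Trees.

(* Main.v *)
(* The basis of T made of the trees violates (D). Let Theta a be the part of Delta a whose right
   factors are polynomials. It is a comodule structure over the polynomials, i.e. an action
   of the translations, so that recenter a = sum (-X)^j a_j, for Theta a = sum a_j (x) X^j, is
   translation invariant: no a' (x) X^k with k <> 0 is left in its coproduct. Moreover recenter a
   is a plus terms X^j c, j <> 0, with as many n-decorations in total, hence with fewer of them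
   off the root. Thus the X^k (recenter a), for a without n-decoration at the root, form a basis
   of T that is unitriangular in the trees; T+ keeps its basis of trees. Rational independence
   makes X^k the only tree of integer homogeneity |k|, which with the additivity of the
   homogeneity gives (B). For (C) the generators are the trees I^l_0(a), for which
   D^k I^l_0(a) = I^l_k(a), preordered lexicographically by the number of edges and the
   homogeneity; finiteness below each homogeneity follows from subcriticality. *)

(* That trees violate (D) is visible on [plant l 0 (tX (munit i))]: the coproduct of the inner X_i
   is carried through the edge and leaves I(1) (x) X_i. Recentering costs the closed formula for the
   quotients: they come from a choice, and what (B) and (D) claim about them is drawn from linear
   independence, by which support conditions and linear relations on the coproduct pass to its
   coefficients. Membership in T is known only through marked trees, so its stability under Delta is
   shown by cutting the marked tree; this works because Delta never changes the o-decoration of the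
   root, which carries the sign condition on a contracted subtree. Invariance is tested at first
   order: once the derivations [pd], the linear part of Theta, vanish on u, so do all higher
   coefficients of Theta u. In the finiteness argument subcriticality alone bounds edges and
   n-decorations; e-decorations lower the homogeneity and are bounded because the homogeneity is
   bounded below, and those on the edges leaving a contracted subtree because its homogeneity is
   negative. *)
From HB Require Import structures.
Require Import Defs.
From mathcomp Require Import all_boot all_order all_algebra.
From mathcomp Require Import finmap multiset.
From mathcomp Require Import boolp classical_sets functions cardinality fsbigop.
From mathcomp Require Import reals constructive_ereal ereal.
From mathcomp Require Import -(notations) monalg.
From mathcomp Require Import zify ring lra ssrAC.

Set Implicit Arguments.
Unset Strict Implicit.
Unset Printing Implicit Defensive.
Import Order.TTheory GRing.Theory Num.Theory.
Local Open Scope classical_set_scope.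
Local Open Scope quotient_scope.
Local Open Scope ring_scope.

(* This and other constants are locked because conversion would otherwise compute with the
   codes of trees. *)
HB.lock Definition bvec (R : realType) (K : choiceType) (a : K) : {malg R[K]} := mkmalgU a 1.
Local Notation "<[ a ]>" := (@bvec _ _ a) (format "<[ a ]>").

(** * Free modules and tensor products *)

Section FreeModuleTheory.
Variable R : realType.
Implicit Types A B C K : choiceType.

Lemma mcoeffU1 K (a b : K) : mcoeff b (<[a]> : {malg R[K]}) = (a == b)%:R.
Proof. by rewrite bvec.unlock mcoeffU; case: eqP. Qed.

Lemma mcoeffU11 K (a : K) : mcoeff a (<[a]> : {malg R[K]}) = 1.
Proof. by rewrite mcoeffU1 eqxx. Qed.

Lemma malgEU K (u : {malg R[K]}) : u = \sum_(a <- msupp u) mcoeff a u *: <[a]>.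
Proof.
rewrite {1}[u]monalgE; apply: eq_bigr => a _.
by apply/malgP => b; rewrite mcoeffZ mcoeffU1 mcoeffU; case: eqP; rewrite ?mulr1 ?mulr0.
Qed.

(** The freedom to enlarge the list lets [lext_linear] sum u, v and c *: u + v over a common one. *)
Lemma lextEw A B (f : A -> {malg R[B]}) (s : seq A) u : uniq s ->
  {subset msupp u <= s} -> lext f u = \sum_(a <- s) mcoeff a u *: f a.
Proof.
move=> us su; rewrite /lext [RHS](bigID (mem (msupp u))) /= [X in _ + X]big1 ?addr0.
  rewrite -[RHS]big_filter; apply: perm_big; apply: uniq_perm => //.
  - by rewrite filter_uniq.
  - by move=> x; rewrite mem_filter; case: (boolP (x \in _)) => //= /su ->.
by move=> a; rewrite -mcoeff_eq0 => /eqP->; rewrite scale0r.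
Qed.

Lemma lext_linear A B (f : A -> {malg R[B]}) : linear (lext f).
Proof.
move=> c u v; pose s := undup (msupp u ++ msupp v ++ msupp (c *: u + v)).
have us : uniq s by apply: undup_uniq.
rewrite !(lextEw f us); try by move=> x; rewrite mem_undup !mem_cat => ->; rewrite ?orbT.
rewrite scaler_sumr -big_split /=; apply: eq_bigr => a _.
by rewrite mcoeffD mcoeffZ scalerDl scalerA.
Qed.

HB.instance Definition _ A B (f : A -> {malg R[B]}) :=
  GRing.isLinear.Build R {malg R[A]} {malg R[B]} *:%R (lext f) (lext_linear f).

Lemma lextU A B (f : A -> {malg R[B]}) a : lext f <[a]> = f a.
Proof.
rewrite (@lextEw _ _ f [:: a]) //=; first by rewrite big_seq1 mcoeffU1 eqxx scale1r.
by move=> x; rewrite -mcoeff_neq0 mcoeffU1 inE [x == a]eq_sym; case: (a == x); rewrite ?eqxx.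
Qed.

Lemma lext0 A B (f : A -> {malg R[B]}) : lext f 0 = 0.
Proof. exact: linear0. Qed.

Lemma eq_linear_supp A (V : lmodType R) (f g : {linear {malg R[A]} -> V}) u :
  (forall a, a \in msupp u -> f <[a]> = g <[a]>) -> f u = g u.
Proof.
move=> fg; rewrite [u]malgEU !linear_sum /=; apply: eq_big_seq => a /fg h.
by rewrite !linearZ /= h.
Qed.

Lemma eq_linear A (V : lmodType R) (f g : {linear {malg R[A]} -> V}) :
  (forall a, f <[a]> = g <[a]>) -> f =1 g.
Proof. by move=> fg u; apply: eq_linear_supp => a _. Qed.

Lemma eq_lext A B (f g : A -> {malg R[B]}) u :
  (forall a, a \in msupp u -> f a = g a) -> lext f u = lext g u.
Proof.
by move=> fg; apply: eq_linear_supp => a ua /=; rewrite !lextU; exact: fg.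
Qed.

Lemma lext_id A (u : {malg R[A]}) : lext (fun a => <[a]>) u = u.
Proof. by apply: (@eq_linear _ _ _ idfun) => a /=; rewrite lextU. Qed.

Lemma lext_lext A B C (f : B -> {malg R[C]}) (g : A -> {malg R[B]}) u :
  lext f (lext g u) = lext (fun a => lext f (g a)) u.
Proof.
pose h : {linear {malg R[A]} -> {malg R[C]}} := lext f \o lext g.
by apply: (@eq_linear _ _ h) => a /=; rewrite !lextU.
Qed.

Lemma lextDf A B (f g : A -> {malg R[B]}) u :
  lext (fun a => f a + g a) u = lext f u + lext g u.
Proof. by rewrite /lext -big_split; apply: eq_bigr => a _; rewrite scalerDr. Qed.

Lemma lextZf A B c (f : A -> {malg R[B]}) u :
  lext (fun a => c *: f a) u = c *: lext f u.
Proof.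
rewrite /lext scaler_sumr; apply: eq_bigr => a _.
by rewrite !scalerA mulrC.
Qed.

Lemma mcoeff_lext A B (f : A -> {malg R[B]}) u b :
  mcoeff b (lext f u) = \sum_(a <- msupp u) mcoeff a u * mcoeff b (f a).
Proof.
by rewrite /lext raddf_sum; apply: eq_bigr => a _; rewrite /= mcoeffZ.
Qed.

(** Invariants of the coproducts are stated as conditions on supports, which linear extensions and
    products propagate without computing coefficients. Spans of basis vectors have this form by
    [lspan_basis_vecs]. *)
Definition supp_in K (P : K -> Prop) (u : {malg R[K]}) := forall a, a \in msupp u -> P a.

Lemma supp_in0 K (P : K -> Prop) : supp_in P 0.
Proof. by move=> a; rewrite -mcoeff_neq0 mcoeff0 eqxx. Qed.

Lemma supp_inU K (P : K -> Prop) a : P a -> supp_in P <[a]>.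
Proof.
move=> Pa b; rewrite -mcoeff_neq0 mcoeffU1.
by have [<-//|_] := eqVneq a b; rewrite eqxx.
Qed.

Lemma supp_inP K (P : K -> Prop) u :
  supp_in P u <-> (forall a, mcoeff a u != 0 -> P a).
Proof. by split=> H a; move: (H a); rewrite mcoeff_neq0. Qed.

Lemma supp_inD K (P : K -> Prop) u v : supp_in P u -> supp_in P v -> supp_in P (u + v).
Proof.
move=> /supp_inP Pu /supp_inP Pv; apply/supp_inP => a; rewrite mcoeffD.
have [ua|] := eqVneq (mcoeff a u) 0; last by move=> /Pu.
by rewrite ua add0r => /Pv.
Qed.

Lemma supp_inZ K (P : K -> Prop) c u : supp_in P u -> supp_in P (c *: u).
Proof.
move=> /supp_inP Pu; apply/supp_inP => a; rewrite mcoeffZ mulf_eq0 negb_or.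
by move=> /andP[_ /Pu].
Qed.

Lemma supp_in_sum K (P : K -> Prop) (I : Type) (r : seq I) (Q : pred I)
    (F : I -> {malg R[K]}) :
  (forall i, Q i -> supp_in P (F i)) -> supp_in P (\sum_(i <- r | Q i) F i).
Proof. by apply: big_ind; [exact: supp_in0|exact: supp_inD]. Qed.

Lemma supp_in_sum_seq K (P : K -> Prop) (I : eqType) (r : seq I)
    (F : I -> {malg R[K]}) :
  (forall i, i \in r -> supp_in P (F i)) -> supp_in P (\sum_(i <- r) F i).
Proof. by move=> h; rewrite big_seq; apply: supp_in_sum. Qed.

Lemma supp_in_sub K (P Q : K -> Prop) u :
  supp_in P u -> (forall a, P a -> Q a) -> supp_in Q u.
Proof. by move=> Pu PQ a /Pu/PQ. Qed.

Lemma supp_in_lext A B (P : A -> Prop) (Q : B -> Prop) (f : A -> {malg R[B]}) u :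
  supp_in P u -> (forall a, P a -> supp_in Q (f a)) -> supp_in Q (lext f u).
Proof.
by move=> Pu PQ; apply: supp_in_sum_seq => a /Pu/PQ; exact: supp_inZ.
Qed.

Lemma supp_in_eq0 K (P : K -> Prop) u : supp_in P u -> (forall a, ~ P a) -> u = 0.
Proof.
move=> /supp_inP Pu nP; apply/malgP => a; rewrite mcoeff0; apply/eqP.
by apply/contraT => /Pu/nP.
Qed.

End FreeModuleTheory.

(* [(id (x) f) z] for a linear form [f] given on the basis. *)
HB.lock Definition contract (R : realType) (A B : choiceType) (f : B -> R)
  (z : {malg R[A * B]}) : {malg R[A]} := lext (fun p => f p.2 *: <[p.1]>) z.

Section Bilinear.
Variable R : realType.
Implicit Types A B C D K : choiceType.

Definition lext2 A B C (F : A -> B -> {malg R[C]}) (u : {malg R[A]}) (v : {malg R[B]}) :=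
  lext (fun a => lext (F a) v) u.

Lemma lext2_swap A B C (F : A -> B -> {malg R[C]}) u v :
  lext2 F u v = lext2 (fun b a => F a b) v u.
Proof.
rewrite /lext2 /lext.
under eq_bigr do rewrite scaler_sumr.
rewrite exchange_big /=; apply: eq_bigr => b _; rewrite scaler_sumr.
by apply: eq_bigr => a _; rewrite !scalerA mulrC.
Qed.

Lemma lext2Ul A B C (F : A -> B -> {malg R[C]}) a v : lext2 F <[a]> v = lext (F a) v.
Proof. exact: lextU. Qed.

Lemma lext2Ur A B C (F : A -> B -> {malg R[C]}) u b :
  lext2 F u <[b]> = lext (fun a => F a b) u.
Proof. by rewrite lext2_swap lext2Ul. Qed.

Lemma lext2U A B C (F : A -> B -> {malg R[C]}) a b : lext2 F <[a]> <[b]> = F a b.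
Proof. by rewrite lext2Ul lextU. Qed.

Lemma lext2_linearr A B C (F : A -> B -> {malg R[C]}) u : linear (lext2 F u).
Proof. by move=> c v w; rewrite !(lext2_swap F u); exact: lext_linear. Qed.

HB.instance Definition _ A B C (F : A -> B -> {malg R[C]}) u :=
  GRing.isLinear.Build R {malg R[B]} {malg R[C]} *:%R (lext2 F u) (lext2_linearr F u).

Lemma eq_lext2 A B C (F G : A -> B -> {malg R[C]}) u v :
  (forall a b, a \in msupp u -> b \in msupp v -> F a b = G a b) ->
  lext2 F u v = lext2 G u v.
Proof. by move=> FG; apply: eq_lext => a ua; apply: eq_lext => b vb; apply: FG. Qed.

Lemma lext_lext2 A B C D (f : C -> {malg R[D]}) (F : A -> B -> {malg R[C]}) u v :
  lext f (lext2 F u v) = lext2 (fun a b => lext f (F a b)) u v.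
Proof. by rewrite /lext2 lext_lext; apply: eq_lext => a _; rewrite lext_lext. Qed.

Lemma lext2_lextl A A' B C (F : A -> B -> {malg R[C]}) (f : A' -> {malg R[A]}) u v :
  lext2 F (lext f u) v = lext2 (fun a b => lext (F^~ b) (f a)) u v.
Proof.
rewrite /lext2 lext_lext; apply: eq_lext => a _.
exact: lext2_swap.
Qed.

Lemma lext2_lextr A B B' C (F : A -> B -> {malg R[C]}) (g : B' -> {malg R[B]}) u v :
  lext2 F u (lext g v) = lext2 (fun a b => lext (F a) (g b)) u v.
Proof. by apply: eq_lext => a _; rewrite lext_lext. Qed.

Lemma lext2_lext A A' B B' C (F : A -> B -> {malg R[C]}) (f : A' -> {malg R[A]})
    (g : B' -> {malg R[B]}) u v :
  lext2 F (lext f u) (lext g v) = lext2 (fun a b => lext2 F (f a) (g b)) u v.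
Proof.
rewrite lext2_lextl lext2_lextr; apply: eq_lext2 => a b _ _.
by rewrite [RHS]lext2_swap.
Qed.

Lemma lext2Df A B C (F G : A -> B -> {malg R[C]}) u v :
  lext2 (fun a b => F a b + G a b) u v = lext2 F u v + lext2 G u v.
Proof. by rewrite -lextDf; apply: eq_lext => a _; rewrite lextDf. Qed.

Lemma supp_in_lext2 A B C (P : A -> Prop) (Q : B -> Prop) (S : C -> Prop)
    (F : A -> B -> {malg R[C]}) u v :
  supp_in P u -> supp_in Q v -> (forall a b, P a -> Q b -> supp_in S (F a b)) ->
  supp_in S (lext2 F u v).
Proof.
move=> Pu Qv PQ; apply: supp_in_lext Pu _ => a Pa.
by apply: supp_in_lext Qv _ => b; apply: PQ.
Qed.

(** Both the tree product on T and its componentwise version on pairs are instances, so that their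
    laws are proved once. *)
Definition convol K (op : K -> K -> K) : {malg R[K]} -> {malg R[K]} -> {malg R[K]} :=
  lext2 (fun a b => <[op a b]>).

Section Conv.
Variables (K : choiceType) (op : K -> K -> K).
Local Notation "u ** v" := (convol op u v) (at level 40, left associativity).

Lemma convolU a b : <[a]> ** <[b]> = <[op a b]>.
Proof. exact: lext2U. Qed.

Lemma convolDl u v w : (u + v) ** w = u ** w + v ** w.
Proof. by rewrite /convol ![lext2 _ _ w]lext2_swap linearD. Qed.
Lemma convolDr u v w : w ** (u + v) = w ** u + w ** v.
Proof. exact: linearD. Qed.
Lemma convolZl c v w : (c *: v) ** w = c *: (v ** w).
Proof. by rewrite /convol ![lext2 _ _ w]lext2_swap linearZ. Qed.
Lemma convolZr c v w : w ** (c *: v) = c *: (w ** v).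
Proof. exact: linearZ. Qed.
Lemma convolZU c a c' b : (c *: <[a]>) ** (c' *: <[b]>) = (c * c') *: <[op a b]>.
Proof. by rewrite convolZl convolZr convolU scalerA. Qed.
Lemma convol0l w : 0 ** w = 0.
Proof. by rewrite /convol lext2_swap linear0. Qed.
Lemma convol0r w : w ** 0 = 0.
Proof. exact: linear0. Qed.

Lemma convolA : associative op -> associative (convol op).
Proof.
move=> opA u v w.
rewrite /convol [RHS]lext_lext2 [X in lext2 _ u X = _]/lext2 lext2_lextr.
apply: eq_lext2 => a b _ _; rewrite lextU lext_lext.
by apply: eq_lext => c _; rewrite lextU opA.
Qed.

Lemma convolC : commutative op -> commutative (convol op).
Proof. by move=> opC u v; rewrite /convol lext2_swap; apply: eq_lext2 => a b; rewrite opC. Qed.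

Lemma convol1l e : left_id e op -> left_id <[e]> (convol op).
Proof. by move=> op1 u; rewrite /convol lext2Ul -[RHS]lext_id; apply: eq_lext => a _; rewrite op1. Qed.

Lemma lext_convol B (op' : B -> B -> B) (f : K -> {malg R[B]}) u v :
  (forall a b, a \in msupp u -> b \in msupp v -> f (op a b) = convol op' (f a) (f b)) ->
  lext f (u ** v) = convol op' (lext f u) (lext f v).
Proof.
move=> fM; rewrite /convol lext_lext2 lext2_lext; apply: eq_lext2 => a b ua vb.
by rewrite lextU fM.
Qed.

(** In the case of use, [g] reads the constant coefficient of a right factor and [f] its coefficient
    of X_i. *)
Lemma lext_convol_deriv B (op' : B -> B -> B) (f g : K -> {malg R[B]}) u v :
  (forall a b, f (op a b) = convol op' (f a) (g b) + convol op' (g a) (f b)) ->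
  lext f (u ** v) = convol op' (lext f u) (lext g v) + convol op' (lext g u) (lext f v).
Proof.
move=> fM; rewrite /convol lext_lext2 !lext2_lext -lext2Df; apply: eq_lext2 => a b ua vb.
by rewrite lextU fM.
Qed.

Lemma supp_in_convol (P Q S : K -> Prop) u v :
  supp_in P u -> supp_in Q v -> (forall a b, P a -> Q b -> S (op a b)) ->
  supp_in S (u ** v).
Proof. by move=> Pu Qv PQ; apply: (supp_in_lext2 Pu Qv) => a b Pa Qb; apply: supp_inU; apply: PQ. Qed.

End Conv.

Section Tensor.
Variables A B : choiceType.
Implicit Types (u : {malg R[A]}) (v : {malg R[B]}) (f : B -> R).

Lemma tensE u v : tens u v = lext2 (fun a b => <[(a, b)]>) u v.
Proof. by rewrite bvec.unlock. Qed.
Lemma tensU a b : tens <[a]> <[b]> = <[(a, b)]> :> {malg R[A * B]}.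
Proof. by rewrite tensE lext2U. Qed.
Lemma tens_swap u v : tens u v = lext2 (fun b a => <[(a, b)]>) v u.
Proof. by rewrite tensE lext2_swap. Qed.
Lemma tensDl u u' v : tens (u + u') v = tens u v + tens u' v.
Proof. by rewrite !tens_swap linearD. Qed.
Lemma tensDr u v v' : tens u (v + v') = tens u v + tens u v'.
Proof. by rewrite !tensE linearD. Qed.
Lemma tensZl c u v : tens (c *: u) v = c *: tens u v.
Proof. by rewrite !tens_swap linearZ. Qed.
Lemma tensZr c u v : tens u (c *: v) = c *: tens u v.
Proof. by rewrite !tensE linearZ. Qed.
Lemma tens0l v : tens (0 : {malg R[A]}) v = 0.
Proof. by rewrite !tens_swap linear0. Qed.
Lemma tens0r u : tens u (0 : {malg R[B]}) = 0.
Proof. by rewrite !tensE linear0. Qed.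
Lemma tens_sumr (I : Type) (r : seq I) (P : pred I) (F : I -> {malg R[B]}) u :
  tens u (\sum_(i <- r | P i) F i) = \sum_(i <- r | P i) tens u (F i).
Proof. by rewrite tensE linear_sum; apply: eq_bigr => i _; rewrite /= tensE. Qed.
Lemma tens_suml (I : Type) (r : seq I) (P : pred I) (F : I -> {malg R[A]}) v :
  tens (\sum_(i <- r | P i) F i) v = \sum_(i <- r | P i) tens (F i) v.
Proof.
by rewrite tens_swap linear_sum; apply: eq_bigr => i _; rewrite /= tens_swap.
Qed.

Lemma mcoeff_tens u v a b : mcoeff (a, b) (tens u v) = mcoeff a u * mcoeff b v.
Proof.
rewrite {1}[u]malgEU {1}[v]malgEU tens_suml raddf_sum /=.
under eq_bigr => x _.
  rewrite tens_sumr raddf_sum /=.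
  under eq_bigr => y _ do rewrite tensZl tensZr tensU !mcoeffZ mcoeffU1 xpair_eqE.
  over.
rewrite [in RHS](malgEU u) [in RHS](malgEU v) !raddf_sum /= big_distrl /=.
apply: eq_bigr => x _; rewrite big_distrr /=; apply: eq_bigr => y _.
by rewrite !mcoeffZ !mcoeffU1 -mulnb natrM !mulrA; congr (_ * _); rewrite -!mulrA; congr (_ * _); rewrite mulrC.
Qed.

Lemma contractE f (z : {malg R[A * B]}) : contract f z = lext (fun p => f p.2 *: <[p.1]>) z.
Proof. by rewrite contract.unlock. Qed.

Lemma contract_linear f : linear (contract f : {malg R[A * B]} -> {malg R[A]}).
Proof. by move=> c z w; rewrite !contractE; exact: lext_linear. Qed.
HB.instance Definition _ f :=
  GRing.isLinear.Build R {malg R[A * B]} {malg R[A]} *:%R (contract f : {malg R[A * B]} -> {malg R[A]}) (contract_linear f).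

Lemma contractU f (a : A) (b : B) :
  contract f (<[(a, b)]> : {malg R[A * B]}) = f b *: <[a]>.
Proof. by rewrite contractE lextU. Qed.

Lemma mcoeff_contract1 (z : {malg R[A * B]}) a b :
  mcoeff a (contract (fun x => (x == b)%:R) z) = mcoeff (a, b) z.
Proof.
rewrite [in RHS](malgEU z) raddf_sum contractE mcoeff_lext; apply: eq_bigr => -[x y] _ /=.
rewrite !mcoeffZ !mcoeffU1 xpair_eqE /= -mulnb natrM; congr (_ * _).
by rewrite mulrC.
Qed.

Lemma contract_tens f u v :
  contract f (tens u v) = (\sum_(b <- msupp v) mcoeff b v * f b) *: u.
Proof.
rewrite {1}[u]malgEU {1}[v]malgEU tens_suml linear_sum /=.
rewrite [in RHS](malgEU u) scaler_sumr; apply: eq_bigr => x _.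
rewrite tens_sumr linear_sum /= scaler_suml; apply: eq_bigr => y _.
rewrite tensZl tensZr tensU !linearZ /= contractU !scalerA -mulrA; congr (_ *: _).
Qed.

Lemma contract1_tens u v b :
  contract (fun x => (x == b)%:R) (tens u v) = mcoeff b v *: u.
Proof.
rewrite contract_tens [in RHS](malgEU v) raddf_sum /=; congr (_ *: _).
by apply: eq_bigr => x _; rewrite mcoeffZ mcoeffU1.
Qed.

End Tensor.
End Bilinear.

(** * Bases and expansions *)

Section Spans.
Variable R : realType.
Implicit Types A B C K : choiceType.

Lemma fsum_seqE (T : choiceType) (V : nmodType) (A : set T) (r : seq T) (f : T -> V) :
  uniq r -> (forall i, i \in r -> A i) -> (forall i, A i -> i \notin r -> f i = 0) ->
  \sum_(i \in A) f i = \sum_(i <- r) f i.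
Proof.
move=> ur rA fr; rewrite (fsbigE r) //.
by rewrite big_mkcond /=; apply: eq_big_seq => i /rA Ai; rewrite mem_set.
Qed.

Section OneSpace.
Variable K : choiceType.
Implicit Types (S W : set {malg R[K]}) (u v : {malg R[K]}).

Definition subspace_closed W :=
  [/\ W 0, forall u v, W u -> W v -> W (u + v) & forall c u, W u -> W (c *: u)].

Lemma subspace_sum W (I : eqType) (r : seq I) (F : I -> {malg R[K]}) :
  subspace_closed W -> (forall i, i \in r -> W (F i)) -> W (\sum_(i <- r) F i).
Proof.
by move=> [W0 WD _] WF; rewrite big_seq; apply: big_ind.
Qed.

Lemma subspace_supp_in (P : K -> Prop) : subspace_closed (supp_in P : set {malg R[K]}).
Proof.
by split; [exact: supp_in0|move=> *; exact: supp_inD|move=> *; exact: supp_inZ].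
Qed.

Lemma lspan_min S W u : subspace_closed W -> S `<=` W -> lspan S u -> W u.
Proof.
move=> Wc SW [s [c [sS ->]]]; apply: subspace_sum => // v vs.
by case: Wc => _ _; apply; apply: SW; apply: sS.
Qed.

Lemma lspan_mem S u : S u -> lspan S u.
Proof.
move=> Su; exists [:: u], (fun=> 1); split; last by rewrite big_seq1 scale1r.
by move=> v; rewrite inE => /eqP->.
Qed.

Lemma lspan_uniq S u : lspan S u -> exists s c,
  [/\ uniq s, forall v, v \in s -> S v & u = \sum_(v <- s) c v *: v].
Proof.
move=> [s [c [sS ->]]].
(* [lspan] allows repetitions in s, always with the same coefficient; merging them multiplies it by
   the multiplicity. *)
exists (undup s), (fun v => c v *+ count_mem v s); split; first exact: undup_uniq.
  by move=> v; rewrite mem_undup; exact: sS.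
rewrite -big_undup_iterop_count; apply: eq_bigr => v _.
by rewrite Monoid.iteropE iter_addr_0 scalerMnl.
Qed.

Lemma lspan_subspace S : subspace_closed (lspan S).
Proof.
split; first by exists [::], (fun=> 0); rewrite big_nil.
  move=> u v /lspan_uniq[s [c [us sS ->]]] /lspan_uniq[t [e [ut tS ->]]].
  pose r := undup (s ++ t).
  have ext (w : seq {malg R[K]}) (a : {malg R[K]} -> R) : uniq w -> {subset w <= r} ->
      \sum_(x <- w) a x *: x = \sum_(x <- r) (if x \in w then a x else 0) *: x.
    move=> uw wr; rewrite [RHS](bigID (mem w)) /= [X in _ + X]big1 ?addr0; last first.
      by move=> x /negbTE ->; rewrite scale0r.
    rewrite -[RHS]big_filter [RHS](eq_big_seq (fun x => a x *: x)); last first.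
      by move=> x; rewrite mem_filter => /andP[/= ->].
    apply: perm_big; apply: uniq_perm => //; first by rewrite filter_uniq ?undup_uniq.
    by move=> x; rewrite mem_filter /=; case: (boolP (x \in w)) => //= /wr ->.
  exists r, (fun x => (if x \in s then c x else 0) + (if x \in t then e x else 0)).
  split; first by move=> x; rewrite mem_undup mem_cat => /orP[/sS|/tS].
  rewrite (ext s) ?(ext t) //; try by move=> x; rewrite mem_undup mem_cat => ->; rewrite ?orbT.
  by rewrite -big_split; apply: eq_bigr => x _; rewrite scalerDl.
move=> a u [s [c [sS ->]]]; exists s, (fun v => a * c v); split => //.
by rewrite scaler_sumr; apply: eq_bigr => v _; rewrite scalerA.
Qed.

Definition basis_vecs (P : set K) : set {malg R[K]} := [set <[a]> | a in P].

Lemma lspan_basis_vecs (P : set K) : lspan (basis_vecs P) = (supp_in P : set {malg R[K]}).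
Proof.
apply/seteqP; split => u.
  apply: lspan_min; first exact: subspace_supp_in.
  by move=> _ [a Pa <-]; exact: supp_inU.
move=> Pu; rewrite [u]malgEU; apply: (subspace_sum (lspan_subspace _)) => a /Pu Pa.
by case: (lspan_subspace (basis_vecs P)) => _ _; apply; apply: lspan_mem; exists a.
Qed.

Lemma mkmalgU1_inj : injective (fun a : K => <[a]> : {malg R[K]}).
Proof.
move=> a b /(congr1 (mcoeff b)); rewrite !mcoeffU1 eqxx; case: (eqVneq a b) => //= _ /eqP.
by rewrite eq_sym oner_eq0.
Qed.

Section Triangular.
Variables (P : set K) (rk : K -> nat) (f : K -> {malg R[K]}).
Hypothesis f_tri : forall a, P a ->
  supp_in (fun b => P b /\ (rk b < rk a)%N) (f a - <[a]>).

Lemma mcoeff_tri a b : P a -> mcoeff b (f a) != 0 -> b = a \/ P b /\ (rk b < rk a)%N.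
Proof.
move=> Pa; rewrite -[f a](subrK <[a]>) mcoeffD mcoeffU1.
have [->|ab] := eqVneq a b; first by left.
rewrite addr0 mcoeff_neq0 => ?; right; exact: f_tri.
Qed.

Lemma mcoeff_tri_diag a : P a -> mcoeff a (f a) = 1.
Proof.
move=> Pa; rewrite -[f a](subrK <[a]>) mcoeffD mcoeffU1 eqxx.
suff -> : mcoeff a (f a - <[a]>) = 0 by rewrite add0r.
apply/eqP; rewrite mcoeff_eq0; apply/negP => /(f_tri Pa)[_].
by rewrite ltnn.
Qed.

(** Descending induction on the rank: in the coefficient of a symbol a, the other contributions come
    from [f b] with b of larger rank, whose coefficients are already known to vanish. *)
Lemma tri_combination (s : seq K) (c : K -> R) : uniq s -> (forall a, a \in s -> P a) ->
  \sum_(a <- s) c a *: f a = 0 -> forall a, a \in s -> c a = 0.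
Proof.
move=> us sP s0.
pose N := (\max_(a <- s) rk a)%N.
(* After n steps the ranks above N - n are done; the second disjunct reaches rank 0, at which the
   truncated subtraction stops. *)
suff H n : forall a, a \in s -> (N - n < rk a)%N || (N < n)%N -> c a = 0.
  by move=> a /(H N.+1); apply; rewrite ltnSn orbT.
elim: n => [|n IH] a as_.
  by rewrite subn0 ltn0 orbF ltnNge; move/negP; case; apply: leq_bigmax_seq.
have [ra _|ra] := ltnP (N - n) (rk a); first by apply: IH as_ _; rewrite ra.
move=> h; have := congr1 (mcoeff a) s0; rewrite mcoeff0 raddf_sum /= => {}s0.
have na : forall b, b \in s -> b != a -> mcoeff a (c b *: f b) = 0.
  move=> b bs ba; rewrite mcoeffZ.
  have [->|] := eqVneq (mcoeff a (f b)) 0; first by rewrite mulr0.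
  move=> /(mcoeff_tri (sP _ bs))[ab|[_ rab]]; first by rewrite ab eqxx in ba.
  by rewrite (IH b bs) ?mul0r //; lia.
move: s0; rewrite (bigD1_seq a) //= big_seq_cond big1 ?addr0; last first.
  by move=> b /andP[bs ba]; exact: na.
by rewrite mcoeffZ mcoeff_tri_diag ?mulr1 //; exact: sP.
Qed.

Lemma tri_inj a b : P a -> P b -> f a = f b -> a = b.
Proof.
move=> Pa Pb fab; have := mcoeff_tri_diag Pa; rewrite fab => ab.
have := mcoeff_tri_diag Pb; rewrite -fab => ba.
have /(mcoeff_tri Pb)[//|[_ r1]] : mcoeff a (f b) != 0 by rewrite ab oner_neq0.
have /(mcoeff_tri Pa)[//|[_ r2]] : mcoeff b (f a) != 0 by rewrite ba oner_neq0.
by move: (ltn_trans r1 r2); rewrite ltnn.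
Qed.

Lemma tri_lin_indep : lin_indep [set f a | a in P].
Proof.
move=> s c us sP s0.
have [t [ut tP st]] : exists t, [/\ uniq t, forall a, a \in t -> P a & s = map f t].
  elim: s us sP {s0} => [|v s IH] /=; first by exists [::].
  move=> /andP[vs us] sP; have [|a Pa fa] := sP v; first exact: mem_head.
  have [|t [ut tP st]] := IH us; first by move=> w ws; apply: sP; rewrite inE ws orbT.
  exists (a :: t); split => /=.
  - by rewrite ut andbT; apply: contra vs => /(map_f f); rewrite -st fa.
  - by move=> b; rewrite inE => /orP[/eqP->|/tP].
  - by rewrite fa st.
move: s0; rewrite st big_map => /(tri_combination ut tP) h v /mapP[a at_ ->].
exact: h.
Qed.

(** Ascending induction on the rank, a being [f a] minus terms of lower rank. *)
Lemma tri_mem_lspan a : P a -> lspan [set f a | a in P] <[a]>.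
Proof.
have [n] := ubnP (rk a); elim: n a => // n IH a ran Pa.
have [_ WD WZ] := lspan_subspace [set f a | a in P].
rewrite -[<[a]>](subKr (f a)) -scaleN1r.
apply: WD; first by apply: lspan_mem; exists a.
apply: (WZ); rewrite [_ - _]malgEU; apply: (subspace_sum (lspan_subspace _)) => b bs.
have [Pb rb] := f_tri Pa bs.
by apply: WZ; apply: IH => //; apply: leq_trans rb _.
Qed.

Lemma tri_lspan : lspan [set f a | a in P] = lspan (basis_vecs P).
Proof.
apply/seteqP; split => u.
  apply: lspan_min; first exact: lspan_subspace.
  move=> _ [a Pa <-]; rewrite lspan_basis_vecs -[f a](subrK <[a]>).
  apply: supp_inD; last exact: supp_inU.
  by apply: supp_in_sub (f_tri Pa) _ => b [].
apply: lspan_min; first exact: lspan_subspace.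
by move=> _ [a Pa <-]; exact: tri_mem_lspan.
Qed.

Lemma tri_basis : is_basis [set f a | a in P] (lspan (basis_vecs P)).
Proof. by split; [exact: tri_lin_indep|exact: tri_lspan]. Qed.

End Triangular.

Lemma basis_vecs_basis (P : set K) : is_basis (basis_vecs P) (lspan (basis_vecs P)).
Proof.
apply: (@tri_basis P (fun=> 0)); move=> a _; rewrite subrr; exact: supp_in0.
Qed.

End OneSpace.
End Spans.

Section Expansions.
Variables (R : realType) (d : nat) (S : crs R d) (L : choiceType).
Local Notation Tp := (symbp S).
Implicit Types (A : set {malg R[L]}) (z : {malg R[L * Tp]}) (g : {malg R[L]} -> {malg R[Tp]}).

Lemma expansion_support A z g : expansion A z g -> exists r,
  [/\ uniq r, forall s, s \in r -> A s, forall s, (s \in r) = (g s != 0)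
    & z = \sum_(s <- r) tens s (g s)].
Proof.
move=> [/finite_fsetP[X EX] gA gS zE]; exists X.
have XE s : (s \in X) = (g s != 0).
  apply/idP/idP => h; first by have : [set` X] s := h; rewrite -EX.
  have : [set s | g s != 0] s := h; by rewrite EX.
split; [exact: fset_uniq|by move=> s; rewrite XE => /gA|exact: XE|].
rewrite zE; apply: fsum_seqE => //; first by move=> s; rewrite XE => /gA.
by move=> s _; rewrite XE negbK => /eqP->; rewrite tens0r.
Qed.

Lemma expansion_seq A z g : expansion A z g -> exists r,
  [/\ uniq r, forall s, s \in r -> A s, forall s, s \notin r -> g s = 0
    & z = \sum_(s <- r) tens s (g s)].
Proof.
move=> /expansion_support[r [ur rA rE zE]]; exists r; split=> // s.
by rewrite rE negbK => /eqP.
Qed.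

Lemma seq_expansion A g r : uniq r -> (forall s, s \in r -> A s) ->
  (forall s, s \notin r -> g s = 0) -> (forall s, spacep (g s)) ->
  expansion A (\sum_(s <- r) tens s (g s)) g.
Proof.
move=> ur rA gr gS.
have rg s : g s != 0 -> s \in r by apply: contraNT => /gr->.
split => //.
- by apply: sub_finite_set (finite_seq r) => s /rg.
- by move=> s /rg/rA.
by rewrite (@fsum_seqE _ _ A r) // => s _ /gr->; rewrite tens0r.
Qed.

Lemma expansion_widen r A g : uniq r -> (forall s, s \in r -> A s) ->
  (forall s, s \notin r -> g s = 0) ->
  \sum_(s \in A) tens s (g s) = \sum_(s <- r) tens s (g s).
Proof. by move=> ur rA gr; apply: fsum_seqE => // s _ /gr->; rewrite tens0r. Qed.

(** Having an expansion is a linear condition on z, so [expansion_exists] is reduced to pure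
    tensors. *)
Lemma expansion_subspace A : subspace_closed (@spacep R d S) ->
  subspace_closed [set z | exists g, expansion A z g].
Proof.
move=> [S0 SD SZ]; split.
- exists (fun=> 0); have /= := @seq_expansion A (fun=> 0) [::] isT.
  by rewrite big_nil; apply.
- move=> z z' [g e] [g' e'].
  have [r [ur rA gr zE]] := expansion_seq e.
  have [r' [ur' rA' gr' zE']] := expansion_seq e'.
  pose q := undup (r ++ r').
  have uq : uniq q by apply: undup_uniq.
  have qA s : s \in q -> A s by rewrite mem_undup mem_cat => /orP[/rA|/rA'].
  have gq s : s \notin q -> g s = 0.
    by rewrite mem_undup mem_cat negb_or => /andP[/gr].
  have gq' s : s \notin q -> g' s = 0.
    by rewrite mem_undup mem_cat negb_or => /andP[_ /gr'].
  exists (fun s => g s + g' s).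
  have zq : z = \sum_(s <- q) tens s (g s).
    by case: e => _ _ _ zA; exact: (etrans zA (expansion_widen uq qA gq)).
  have zq' : z' = \sum_(s <- q) tens s (g' s).
    by case: e' => _ _ _ zA; exact: (etrans zA (expansion_widen uq qA gq')).
  have -> : z + z' = \sum_(s <- q) tens s (g s + g' s).
    by rewrite zq zq' -big_split; apply: eq_bigr => s _; rewrite tensDr.
  have gS : forall s, spacep (g s) by case: e.
  have gS' : forall s, spacep (g' s) by case: e'.
  apply: (seq_expansion (g := fun s => g s + g' s)) => //; last by move=> s; exact: SD.
  by move=> s sq; rewrite gq // gq' // addr0.
- move=> c z [g e]; have [r [ur rA gr zE]] := expansion_seq e.
  exists (fun s => c *: g s).
  have -> : c *: z = \sum_(s <- r) tens s (c *: g s).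
    by rewrite zE scaler_sumr; apply: eq_bigr => s _; rewrite tensZr.
  apply: (seq_expansion (g := fun s => c *: g s)) => //.
    by move=> s /gr->; rewrite scaler0.
  by case: e => _ _ gS _ s; apply: SZ.
Qed.

Lemma expansion_exists A z : subspace_closed (@spacep R d S) ->
  supp_in (fun p => lspan A <[p.1]> /\ @spacep R d S <[p.2]>) z ->
  exists g, expansion A z g.
Proof.
move=> Sc zA; have Wc := expansion_subspace A Sc; case: (Wc) => W0 WD WZ.
have [S0 SD SZ] := Sc.
suff H u v : lspan A u -> spacep v -> exists g, expansion A (tens u v) g.
  rewrite [z]malgEU; apply: (subspace_sum Wc) => -[a b] /zA /= [Aa Sb].
  by apply: WZ; rewrite -tensU; apply: H.
move=> [s [c [sA ->]]] Sv; rewrite tens_suml; apply: (subspace_sum Wc) => t ts.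
rewrite tensZl; apply: WZ.
pose g x := if x == t then v else 0.
exists g; have -> : tens t v = \sum_(s <- [:: t]) tens s (g s) by rewrite big_seq1 /g eqxx.
apply: seq_expansion => //.
- by move=> x; rewrite inE => /eqP->; exact: sA.
- by move=> x; rewrite inE /g; case: eqP.
- by move=> x; rewrite /g; case: eqP.
Qed.

(** Fix a right symbol b and contract z against it. The result and the terms with [Q s b] lie in
    [D b], hence so does the sum of the other terms; it also avoids [D b], so it is 0, and linear
    independence of A kills its coefficients. This stands in for a formula for the coefficients when
    A is not the basis of symbols. *)
Lemma expansion_supp (Q : {malg R[L]} -> Tp -> Prop) (D : Tp -> L -> Prop) A z g :
  lin_indep A -> expansion A z g ->
  (forall s b, A s -> Q s b -> supp_in (D b) s) ->
  (forall s b, A s -> ~ Q s b -> supp_in (fun a => ~ D b a) s) ->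
  supp_in (fun p => D p.2 p.1) z ->
  forall s, supp_in (Q s) (g s).
Proof.
move=> Ai e QD nQD zD s; have [r [ur rA gr zE]] := expansion_seq e.
have [sr|/gr->] := boolP (s \in r); last exact: supp_in0.
move=> b gsb; have [//|nQ] := pselect (Q s b); exfalso.
have zb : supp_in (D b) (contract (fun x => (x == b)%:R) z).
  rewrite contractE; apply: supp_in_lext zD _ => -[a x] /= Da.
  have [xb|_] := eqVneq x b; last by rewrite scale0r; exact: supp_in0.
  by apply: supp_inZ; apply: supp_inU; rewrite -xb.
move: zb; rewrite zE linear_sum /= (bigID (fun s => `[< Q s b >])) /= => zb.
set good := \sum_(i <- r | `[< _ >]) _ in zb.
set bad := \sum_(i <- r | ~~ _) _ in zb.
have goodD : supp_in (D b) good.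
  rewrite /good big_seq_cond; apply: supp_in_sum => x /andP[xr /asboolP Qx].
  by rewrite contract1_tens; apply: supp_inZ; apply: QD => //; exact: rA.
have badD : supp_in (D b) bad.
  rewrite -(addKr good bad) -scaleN1r; apply: supp_inD => //; exact: supp_inZ.
have badnD : supp_in (fun a => ~ D b a) bad.
  rewrite /bad big_seq_cond; apply: supp_in_sum => x /andP[xr /asboolP Qx].
  by rewrite contract1_tens; apply: supp_inZ; apply: nQD => //; exact: rA.
have bad0 : bad = 0.
  by apply: (@supp_in_eq0 _ _ (fun a => D b a /\ ~ D b a)) => [a ?|a []//]; split; auto.
move: bad0; rewrite /bad -big_filter.
under eq_bigr do rewrite contract1_tens.
move=> /(Ai [seq i <- r | ~~ `[< Q i b >]] (fun s => mcoeff b (g s))).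
have sf : s \in [seq i <- r | ~~ `[< Q i b >]].
  by rewrite mem_filter sr andbT; apply/asboolPn.
move/(_ _ _ s sf) => h; move: gsb; rewrite -mcoeff_neq0 h ?eqxx //.
  by rewrite filter_uniq.
by move=> v; rewrite mem_filter => /andP[_ /rA].
Qed.

(** Contracting the expansion with f gives a linear relation in A whose coefficients are the sums of
    the conclusion. *)
Lemma expansion_contract0 (f : Tp -> R) A z g : lin_indep A -> expansion A z g ->
  contract f z = 0 -> forall s, \sum_(b <- msupp (g s)) mcoeff b (g s) * f b = 0.
Proof.
move=> Ai e z0 s; have [r [ur rA gr zE]] := expansion_seq e.
have [sr|/gr->] := boolP (s \in r); last first.
  by rewrite big1 // => b _; rewrite mcoeff0 mul0r.
apply: (Ai r (fun s => \sum_(b <- msupp (g s)) mcoeff b (g s) * f b) ur rA _ _ sr).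
move: z0; rewrite zE linear_sum /= => z0; rewrite -[RHS]z0; apply: eq_bigr => x _.
by rewrite contract_tens.
Qed.

Lemma expansion_mcoeff (P : set L) z g a b : expansion (basis_vecs P) z g -> P a ->
  mcoeff b (g <[a]>) = mcoeff (a, b) z.
Proof.
move=> e Pa; have [r [ur rA gr ->]] := expansion_seq e.
rewrite raddf_sum /=.
have [ar|ar] := boolP (<[a]> \in r).
  rewrite (bigD1_seq _ ar ur) /= [X in _ = X + _]mcoeff_tens mcoeffU11 mul1r.
  rewrite big_seq_cond big1 ?addr0 // => s /andP[/rA[x _ <-] xa].
  by rewrite mcoeff_tens mcoeffU1 (inj_eq (@mkmalgU1_inj _ _)) in xa *; rewrite (negbTE xa) mul0r.
rewrite gr // mcoeff0 big_seq big1 // => s sr.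
have [x _ xs] := rA _ sr; rewrite -xs mcoeff_tens mcoeffU1.
have [xa|_] := eqVneq x a; last by rewrite mul0r.
by rewrite -xs xa (negbTE ar) in sr.
Qed.

End Expansions.

(** * Decorated trees and coproducts *)

Section TreeIso.
Variables (d : nat) (L : finType).
Local Notation label := (L * mindex d)%type.
Local Notation odeco := ({ffun 'I_d -> int} * {ffun L -> int})%type.
Local Notation rtree := (rtree d L).
Local Notation dtree := (dtree d L).
Implicit Types (n k : mindex d) (o : odeco) (t u : rtree) (a b c : dtree).

Lemma tclsP t u : reflect (tcls t = tcls u) (tiso t u).
Proof. exact: eqmodP. Qed.

Lemma tclsK a : tcls (repr a) = a.
Proof. exact: reprK. Qed.

Lemma tiso_repr t : tiso t (repr (tcls t)).
Proof. by apply/tclsP; rewrite tclsK. Qed.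

Definition bcls (x : label * rtree) : label * dtree := (x.1, tcls x.2).

(** A description of isomorphism at the root alone: branches are compared as classes, which hides
    the recursion and the enumeration of permutations in [tiso]. *)
Lemma tiso_perm n o s n' o' s' : tiso (Node n o s) (Node n' o' s') <->
  [/\ n = n', o = o' & perm_eq (map bcls s) (map bcls s')].
Proof.
split=> [/= /and3P[/eqP-> /eqP-> /hasP[r]]|[-> ->]].
  rewrite mem_permutations => rs' sr; split=> //.
  suff -> : map bcls s = map bcls r by apply: perm_map.
  elim: s r {rs'} sr => [|x s IH] [|y r] //= /andP[/andP[/eqP xy /tclsP xy2]] /IH ->.
  by rewrite /bcls xy xy2.
move=> ps; rewrite /= !eqxx /=.
have [s1 s1s e1] : exists2 s1, perm_eq s1 s' & map bcls s = map bcls s1.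
  case: s' ps => [|y0 r0] ps.
    by move/perm_nilP: ps => ->; exists [::].
  set r := y0 :: r0 in ps *.
  case/(perm_iotaP (bcls y0)): ps => I; rewrite size_map => pI sI.
  exists [seq nth y0 r i | i <- I]; first by apply/(perm_iotaP y0); exists I.
  rewrite sI -map_comp; apply/eq_in_map => i; rewrite (perm_mem pI) mem_iota add0n /=.
  by move=> ir; rewrite -(nth_map y0 (bcls y0)).
apply/hasP; exists s1; first by rewrite mem_permutations.
elim: s s1 {s1s ps} e1 => [|x s IH] [|y s1] //= [xy1 /tclsP xy2 e1].
by rewrite xy1 eqxx xy2 IH.
Qed.

Lemma tcls_perm n o s s' : perm_eq (map bcls s) (map bcls s') ->
  tcls (Node n o s) = tcls (Node n o s').
Proof. by move=> ps; apply/tclsP/tiso_perm. Qed.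

(** How recursive functions on plane representatives descend to trees: one step has to be symmetric
    in the branches, each known through its label, its value and its class. The class is included
    because the Taylor part of Delta depends on the branch itself. *)
Lemma tiso_invariant (V : eqType)
    (Phi : mindex d -> odeco -> seq (label * V * dtree) -> V) (phi : rtree -> V) :
  (forall n o r r', perm_eq r r' -> Phi n o r = Phi n o r') ->
  (forall n o s, phi (Node n o s) = Phi n o [seq (x.1, phi x.2, tcls x.2) | x <- s]) ->
  forall t u, tiso t u -> phi t = phi u.
Proof.
move=> PhiP phiE; elim/rtree_ind' => n o s IH [n' o' s'] /= /and3P[/eqP<- /eqP<- /hasP[r]].
rewrite mem_permutations !phiE => rs' sr.
rewrite -(PhiP _ _ _ _ (perm_map (fun x : label * rtree => (x.1, phi x.2, tcls x.2)) rs')).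
congr Phi; elim: s r {rs'} sr IH => [|x s IHs] [|y r] //= /andP[/andP[/eqP xy txy]] sr IH.
rewrite (IHs r) // => [|z zs]; last by apply: IH; right.
by rewrite xy (IH x _ y.2) //; [move/tclsP: txy => ->|left].
Qed.

Lemma tmul_tcls t u : tmul (tcls t) (tcls u) = tcls (rmul t u).
Proof.
apply/esym/tclsP; case: t (tiso_repr t) => n o s; case: (repr _) => n1 o1 s1.
move=> /tiso_perm[<- <- p1].
case: u (tiso_repr u) => n' o' s'; case: (repr _) => n2 o2 s2.
move=> /tiso_perm[<- <- p2]; apply/tiso_perm; split => //.
by rewrite !map_cat; apply: perm_cat.
Qed.

Lemma plant_tcls l k t : plant l k (tcls t) = tcls (Node 0 0 [:: (l, k, t)]).
Proof.
apply/esym/tclsP/tiso_perm; split=> //=; rewrite /bcls /= tclsK; exact: perm_refl.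
Qed.

(** The root o-decoration as a factor: R_o becomes the product with [tO o], and trees are generated
    by powers of X, the [tO o], products and planting, as used in [dtree_ind]. *)
Definition tO o : dtree := tcls (Node 0 o [::]).

Lemma Radd_tO o a : Radd o a = tmul (tO o) a.
Proof.
rewrite -[in RHS](tclsK a) tmul_tcls /Radd; case: (repr a) => n o' s /=.
by rewrite add0r addrC.
Qed.

Lemma Radd_tcls o t : Radd o (tcls t) = tcls (rRadd o t).
Proof. by rewrite Radd_tO tmul_tcls; case: t => n o' s /=; rewrite add0r addrC. Qed.

Lemma tmulC : commutative (@tmul d L).
Proof.
move=> a b; rewrite -(tclsK a) -(tclsK b) !tmul_tcls.
case: (repr a) => n o s; case: (repr b) => n' o' s' /=.
by rewrite addrC [o + _]addrC; apply: tcls_perm; rewrite !map_cat perm_catC.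
Qed.

Lemma tmulA : associative (@tmul d L).
Proof.
move=> a b c; rewrite -(tclsK a) -(tclsK b) -(tclsK c) !tmul_tcls.
case: (repr a) => n o s; case: (repr b) => n' o' s'; case: (repr c) => n2 o2 s2 /=.
by rewrite !addrA catA.
Qed.

Lemma tmul1 : left_id (tX L (0 : mindex d)) (@tmul d L).
Proof.
move=> a; rewrite -[in RHS](tclsK a) -{1}(tclsK a) tmul_tcls.
by case: (repr a) => n o s /=; rewrite !add0r.
Qed.

HB.instance Definition _ := Monoid.isComLaw.Build dtree (tX L (0 : mindex d))
  (@tmul d L) tmulA tmulC tmul1.

Definition bplant (x : label * dtree) := plant x.1.1 x.1.2 x.2.

Lemma tcls_Node n o s : tcls (Node n o s) =
  tmul (tO o) (tmul (tX L n) (\big[@tmul d L/tX L 0]_(x <- s) bplant (bcls x))).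
Proof.
suff -> : \big[@tmul d L/tX L 0]_(x <- s) bplant (bcls x) = tcls (Node 0 0 s).
  by rewrite [tmul (tX L n) _]tmul_tcls tmul_tcls /= !addr0 add0r.
elim: s => [|x s IH]; first by rewrite big_nil.
rewrite big_cons IH /bplant /bcls plant_tcls tmul_tcls /= !addr0.
by case: x => [[l k] u].
Qed.

Lemma tX_add n k : tX L (n + k) = tmul (tX L n) (tX L k).
Proof. by rewrite tmul_tcls /= addr0. Qed.

Lemma tO_add o o' : tO (o + o') = tmul (tO o) (tO o').
Proof. by rewrite tmul_tcls /= addr0. Qed.

Lemma dtree_ind (P : dtree -> Prop) :
  (forall n, P (tX L n)) -> (forall o, P (tO o)) ->
  (forall a b, P a -> P b -> P (tmul a b)) ->
  (forall l k a, P a -> P (plant l k a)) ->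
  forall a, P a.
Proof.
move=> PX PO PM PI a; rewrite -(tclsK a); elim/rtree_ind': (repr a) => n o s IH.
rewrite tcls_Node; apply: (PM) => //; apply: (PM) => //.
elim: s IH => [|x s IHs] IH; first by rewrite big_nil.
rewrite big_cons; apply: PM; first by apply: PI; apply: IH; left.
by apply: IHs => y ys; apply: IH; right.
Qed.

(* [rootb a] depends on the representative of [a], and is meaningful only up to [perm_eq]. *)
Definition rootn a := ndeco (repr a).
Definition rooto a := odec (repr a).
Definition rootb a := map bcls (branches (repr a)).

Lemma rootn_tcls t : rootn (tcls t) = ndeco t.
Proof.
by move: (tiso_repr t); rewrite /rootn; case: t => n o s; case: (repr _) => n' o' s' /tiso_perm[].
Qed.

Lemma rooto_tcls t : rooto (tcls t) = odec t.
Proof.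
by move: (tiso_repr t); rewrite /rooto; case: t => n o s; case: (repr _) => n' o' s' /tiso_perm[].
Qed.

Lemma rootb_tcls t : perm_eq (rootb (tcls t)) (map bcls (branches t)).
Proof.
move: (tiso_repr t); rewrite /rootb; case: t => n o s; case: (repr _) => n' o' s' /tiso_perm[_ _].
by rewrite perm_sym.
Qed.

Lemma rootE a b : rootn a = rootn b -> rooto a = rooto b -> perm_eq (rootb a) (rootb b) -> a = b.
Proof.
rewrite /rootn /rooto /rootb -{4}(tclsK a) -{4}(tclsK b).
case: (repr a) => n o s; case: (repr b) => n' o' s' /= -> ->; exact: tcls_perm.
Qed.

Lemma rootn_tmul a b : rootn (tmul a b) = rootn a + rootn b.
Proof. by rewrite rootn_tcls /rootn; case: (repr a); case: (repr b). Qed.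
Lemma rooto_tmul a b : rooto (tmul a b) = rooto a + rooto b.
Proof. by rewrite rooto_tcls /rooto; case: (repr a); case: (repr b). Qed.
Lemma rootb_tmul a b : perm_eq (rootb (tmul a b)) (rootb a ++ rootb b).
Proof.
apply: perm_trans (rootb_tcls _) _; rewrite /rootb.
by case: (repr a) => ? ? ?; case: (repr b) => ? ? ? /=; rewrite map_cat.
Qed.
Lemma rootn_plant l k a : rootn (plant l k a) = 0. Proof. exact: rootn_tcls. Qed.
Lemma rooto_plant l k a : rooto (plant l k a) = 0. Proof. exact: rooto_tcls. Qed.
Lemma rootb_plant l k a : rootb (plant l k a) = [:: (l, k, a)].
Proof.
have := rootb_tcls (Node 0 0 [:: (l, k, repr a)]); rewrite -/(plant l k a) /= /bcls /= tclsK.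
by move=> p; apply: perm_small_eq.
Qed.
Lemma rootn_tX n : rootn (tX L n) = n. Proof. exact: rootn_tcls. Qed.
Lemma rooto_tX n : rooto (tX L n) = 0. Proof. exact: rooto_tcls. Qed.
Lemma rootb_tX n : rootb (tX L n) = [::].
Proof. by apply: perm_small_eq => //; exact: rootb_tcls. Qed.
Lemma rootn_tO o : rootn (tO o) = 0. Proof. exact: rootn_tcls. Qed.
Lemma rooto_tO o : rooto (tO o) = o. Proof. exact: rooto_tcls. Qed.
Lemma root_decomp a :
  a = tmul (tO (rooto a)) (tmul (tX L (rootn a)) (\big[@tmul d L/tX L 0]_(x <- rootb a) bplant x)).
Proof.
rewrite -{1}(tclsK a) /rooto /rootn /rootb; case: (repr a) => n o s.
by rewrite tcls_Node big_map.
Qed.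

Lemma plant_inj l k a l' k' a' : plant l k a = plant l' k' a' -> [/\ l = l', k = k' & a = a'].
Proof. by move=> /(congr1 rootb); rewrite !rootb_plant => -[]. Qed.

Lemma tX_inj : injective (tX L (d := d)).
Proof. by move=> n n' /(congr1 rootn); rewrite !rootn_tX. Qed.

Lemma tX_neq_plant n l k a : tX L n <> plant l k a.
Proof. by move=> /(congr1 rootb); rewrite rootb_tX rootb_plant. Qed.

Lemma rootn_prod (s : seq (label * dtree)) :
  rootn (\big[@tmul d L/tX L 0]_(x <- s) bplant x) = 0.
Proof.
elim: s => [|x s IH]; first by rewrite big_nil rootn_tX.
by rewrite big_cons rootn_tmul IH rootn_plant addr0.
Qed.
Lemma rooto_prod (s : seq (label * dtree)) :
  rooto (\big[@tmul d L/tX L 0]_(x <- s) bplant x) = 0.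
Proof.
elim: s => [|x s IH]; first by rewrite big_nil rooto_tX.
by rewrite big_cons rooto_tmul IH rooto_plant addr0.
Qed.
Lemma rootb_prod (s : seq (label * dtree)) :
  perm_eq (rootb (\big[@tmul d L/tX L 0]_(x <- s) bplant x)) s.
Proof.
elim: s => [|x s IH]; first by rewrite big_nil rootb_tX.
rewrite big_cons; apply: perm_trans (rootb_tmul _ _) _.
rewrite rootb_plant /= -[X in perm_eq (X :: _)]/(x.1.1, x.1.2, x.2).
by case: x => [[l k] u] /=; rewrite perm_cons.
Qed.

End TreeIso.

HB.lock Definition prodT (R : realType) (d : nat) (L : finType)
  (u v : {malg R[dtree d L]}) := mulT u v.

HB.lock Definition prod2 (R : realType) (d : nat) (L : finType)
  (z w : {malg R[dtree d L * dtree d L]}) := mul2 z w.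

HB.lock Definition plantL (R : realType) (d : nat) (L : finType) (l : L) (k : mindex d)
    (z : {malg R[dtree d L * dtree d L]}) : {malg R[dtree d L * dtree d L]} :=
  lext (fun p => <[(plant l k p.1, p.2)]>) z.

HB.lock Definition Dl (R : realType) (d : nat) (L : finType) (h : L -> R) (a : dtree d L) :
  {malg R[dtree d L * dtree d L]} := rDelta h (repr a).

Section Coproduct.
Variables (R : realType) (d : nat) (L : finType) (h : L -> R).
Local Notation label := (L * mindex d)%type.
Local Notation odeco := ({ffun 'I_d -> int} * {ffun L -> int})%type.
Local Notation rtree := (rtree d L).
Local Notation dtree := (dtree d L).
Local Notation T := {malg R[dtree]}.
Local Notation TT := {malg R[dtree * dtree]}.
Local Notation "a ** b" := (tmul a b) (at level 40, left associativity).
Local Notation tX := (tX L).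
Local Notation one2 := (<[(tX 0, tX 0)]> : TT).
Implicit Types (n k : mindex d) (o : odeco) (a b c : dtree) (u v : T) (z w : TT).

Definition tmul2 (p q : dtree * dtree) : dtree * dtree := (p.1 ** q.1, p.2 ** q.2).

Lemma mulTE u v : prodT u v = convol (@tmul d L) u v. Proof. by rewrite prodT.unlock /convol bvec.unlock. Qed.
Lemma mul2E z w : prod2 z w = convol tmul2 z w. Proof. by rewrite prod2.unlock /convol bvec.unlock. Qed.

Lemma tmul2A : associative tmul2.
Proof. by move=> [? ?] [? ?] [? ?]; rewrite /tmul2 /= !tmulA. Qed.
Lemma tmul2C : commutative tmul2.
Proof. by move=> [a b] [a' b']; rewrite /tmul2 /= (tmulC a) (tmulC b). Qed.
Lemma tmul21 : left_id (tX 0, tX 0) tmul2.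
Proof. by move=> [a b]; rewrite /tmul2 /= !tmul1. Qed.

Lemma mulTA : associative (@prodT R d L). Proof. by move=> u v w; rewrite !mulTE; exact/convolA/tmulA. Qed.
Lemma mulTC : commutative (@prodT R d L). Proof. by move=> u v; rewrite !mulTE; exact/convolC/tmulC. Qed.
Lemma mulT1 : left_id <[tX 0]> (@prodT R d L). Proof. by move=> u; rewrite mulTE; exact/convol1l/tmul1. Qed.
Lemma mul2A : associative (@prod2 R d L). Proof. by move=> u v w; rewrite !mul2E; exact/convolA/tmul2A. Qed.
Lemma mul2C : commutative (@prod2 R d L). Proof. by move=> u v; rewrite !mul2E; exact/convolC/tmul2C. Qed.
Lemma mul21 : left_id one2 (@prod2 R d L). Proof. by move=> u; rewrite mul2E; exact/convol1l/tmul21. Qed.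

HB.instance Definition _ := Monoid.isComLaw.Build T <[tX 0]> (@prodT R d L) mulTA mulTC mulT1.
HB.instance Definition _ := Monoid.isComLaw.Build TT one2 (@prod2 R d L) mul2A mul2C mul21.

Lemma mulTU a b : prodT <[a]> <[b]> = <[a ** b]> :> T.
Proof. by rewrite mulTE convolU. Qed.
Lemma mul2U p q : prod2 <[p]> <[q]> = <[tmul2 p q]> :> TT.
Proof. by rewrite mul2E convolU. Qed.

Lemma supp_in_mul2 (P Q S : dtree * dtree -> Prop) z w :
  supp_in P z -> supp_in Q w -> (forall p q, P p -> Q q -> S (tmul2 p q)) ->
  supp_in S (prod2 z w).
Proof. by rewrite mul2E; exact: supp_in_convol. Qed.

Lemma mul2Ul p z : prod2 <[p]> z = lext (fun q => <[tmul2 p q]>) z.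
Proof. by rewrite mul2E /convol lext2Ul. Qed.
Lemma mulTUl a u : prodT <[a]> u = lext (fun b => <[a ** b]>) u.
Proof. by rewrite mulTE /convol lext2Ul. Qed.
Lemma lext_mulT (f : dtree -> TT) u v :
  (forall a b, f (a ** b) = prod2 (f a) (f b)) -> lext f (prodT u v) = prod2 (lext f u) (lext f v).
Proof.
move=> fM; rewrite mulTE mul2E; apply: lext_convol => a b _ _.
by rewrite fM mul2E.
Qed.

Lemma foldr_big (M : Type) (e : M) (op : Monoid.com_law e) (I : Type) (F : I -> M) (e' : M) (s : seq I) :
  foldr (fun x y => op (F x) y) e' s = op (\big[op/e]_(x <- s) F x) e'.
Proof.
elim: s => [|x s IH] /=; first by rewrite big_nil Monoid.mul1m.
by rewrite IH big_cons Monoid.mulmA.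
Qed.

Lemma mul2_one z : prod2 z one2 = z. Proof. by rewrite mul2C mul21. Qed.

Lemma mul2ACA : interchange (@prod2 R d L) (@prod2 R d L).
Proof. exact: Monoid.mulmACA. Qed.

Lemma mul2_shuffle z1 z2 z3 w1 w2 w3 :
  prod2 (prod2 z1 w1) (prod2 (prod2 z2 w2) (prod2 z3 w3))
  = prod2 (prod2 z1 (prod2 z2 z3)) (prod2 w1 (prod2 w2 w3)).
Proof. by rewrite [RHS]mul2ACA [prod2 (prod2 z2 z3) _]mul2ACA. Qed.

Definition branchD (x : label) (z : TT) (a : dtree) : TT :=
  plantL x.1 x.2 z + Taylor h x.1 x.2 a.

Lemma rDelta_Node n o s : rDelta h (Node n o s) =
  lext (fun p => <[(Radd o p.1, p.2)]>)
   (prod2 (\big[@prod2 R d L/one2]_(x <- s) branchD x.1 (rDelta h x.2) (tcls x.2)) (DeltaX R L n)).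
Proof. by rewrite -foldr_big /= /branchD plantL.unlock prod2.unlock bvec.unlock. Qed.

Lemma rDelta_tiso (t u : rtree) : tiso t u -> rDelta h t = rDelta h u.
Proof.
apply: (@tiso_invariant _ _ _ (fun n o (r : seq (label * TT * dtree)) =>
  lext (fun p => <[(Radd o p.1, p.2)]>) (prod2 (\big[@prod2 R d L/one2]_(x <- r) branchD x.1.1 x.1.2 x.2) (DeltaX R L n)))).
  by move=> n o r r' rr'; rewrite (perm_big _ rr').
by move=> n o s; rewrite big_map rDelta_Node.
Qed.

Local Notation Dl := (Dl h).

Lemma rDelta_tcls (t : rtree) : rDelta h t = Dl (tcls t).
Proof. by rewrite Dl.unlock; exact/rDelta_tiso/tiso_repr. Qed.

Lemma DeltaXE n : DeltaX R L n = \big[@prod2 R d L/one2]_(i < d)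
  iter (n i) (prod2 (<[(tX (munit i), tX 0)]> + <[(tX 0, tX (munit i))]>)) one2.
Proof. by rewrite prod2.unlock bvec.unlock. Qed.

Lemma DeltaXD n k : DeltaX R L (n + k) = prod2 (DeltaX R L n) (DeltaX R L k).
Proof.
rewrite !DeltaXE -big_split /=; apply: eq_bigr => i _.
rewrite ffunE /= iterD; elim: (n i) => [|m IH] /=; first by rewrite mul21.
rewrite IH; exact: mul2A.
Qed.

Lemma DeltaX0 : DeltaX R L (0 : mindex d) = one2.
Proof. by rewrite DeltaXE big1 // => i _; rewrite ffunE. Qed.

Lemma DeltaX1 (i : 'I_d) : DeltaX R L (munit i) = <[(tX (munit i), tX 0)]> + <[(tX 0, tX (munit i))]>.
Proof.
rewrite DeltaXE (bigD1 i) //= big1 => [|j ji]; last by rewrite ffunE (negbTE ji).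
by rewrite mul2_one ffunE eqxx /= mul2_one.
Qed.

Lemma lext_Radd o z : lext (fun p => <[(Radd o p.1, p.2)]>) z = prod2 <[(tO o, tX 0)]> z.
Proof.
rewrite mul2Ul; apply: eq_lext => -[a b] _.
by rewrite /tmul2 /= tmul1 Radd_tO.
Qed.

Lemma DlX n : Dl (tX n) = DeltaX R L n.
Proof.
rewrite -rDelta_tcls rDelta_Node big_nil mul21 lext_Radd.
exact: mul21.
Qed.

Lemma DlO o : Dl (tO o) = <[(tO o, tX 0)]>.
Proof. by rewrite -rDelta_tcls rDelta_Node big_nil mul21 lext_Radd DeltaX0 mul2_one. Qed.

Lemma DlP l k a : Dl (plant l k a) = plantL l k (Dl a) + Taylor h l k a.
Proof.
rewrite -rDelta_tcls rDelta_Node big_seq1 DeltaX0 mul2_one lext_Radd.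
by rewrite [LHS]mul21 /branchD /= tclsK rDelta_tcls tclsK.
Qed.

Lemma Dl_Node n o s : Dl (tcls (Node n o s)) =
  prod2 <[(tO o, tX 0)]> (prod2 (\big[@prod2 R d L/one2]_(x <- s) Dl (bplant (bcls x))) (DeltaX R L n)).
Proof.
rewrite -rDelta_tcls rDelta_Node lext_Radd; congr (prod2 _ (prod2 _ _)).
by apply: eq_bigr => x _; rewrite /bplant DlP -rDelta_tcls.
Qed.

(** The recursive formula is already a product over the root decorations and the branches, so its
    factors only have to be regrouped. *)
Lemma DlM a b : Dl (a ** b) = prod2 (Dl a) (Dl b).
Proof.
rewrite -(tclsK a) -(tclsK b) tmul_tcls; case: (repr a) => n o s; case: (repr b) => n' o' s' /=.
rewrite !Dl_Node big_cat /= DeltaXD.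
have -> : <[(tO (o + o'), tX 0)]> = prod2 <[(tO o, tX 0)]> <[(tO o', tX 0)]> :> TT.
  by rewrite mul2U /tmul2 /= tO_add tmul1.
exact: mul2_shuffle.
Qed.

Lemma Delta_BHZE u : Delta_BHZ h u = lext Dl u. Proof. by rewrite Dl.unlock. Qed.

Lemma leq_mlen n i : (n i <= mlen n)%N.
Proof. by rewrite /mlen (bigD1 i) //= leq_addr. Qed.

Lemma mlenD n k : mlen (n + k) = (mlen n + mlen k)%N.
Proof. by rewrite /mlen -big_split; apply: eq_bigr => i _; rewrite ffunE. Qed.

Lemma mlen0 : mlen (0 : mindex d) = 0%N.
Proof. by rewrite /mlen big1 // => i _; rewrite ffunE. Qed.

Lemma mlen_eq0 n : (mlen n == 0%N) = (n == 0).
Proof.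
apply/eqP/eqP => [n0|->]; last exact: mlen0.
by apply/ffunP => i; rewrite ffunE; apply/eqP; rewrite -leqn0 -n0 leq_mlen.
Qed.

Lemma mlen_munit (i : 'I_d) : mlen (munit i) = 1%N.
Proof.
rewrite /mlen (bigD1 i) //= ffunE eqxx big1 => [|j ji]; first by rewrite addn0.
by rewrite ffunE (negbTE ji).
Qed.

Lemma finite_mlen_lt (c : R) : finite_set [set j : mindex d | (mlen j)%:R < c].
Proof.
have [m cm] : exists m : nat, c <= m%:R.
  exists (Num.bound `|c|); apply: le_trans (ler_norm _) _.
  by apply: ltW; apply: archi_boundP.
pose f (g : {ffun 'I_d -> 'I_m.+1}) : mindex d := [ffun i => g i : nat].
apply: sub_finite_set (finite_image f (@finite_finset _ [set: {ffun 'I_d -> 'I_m.+1}])) => j /= jc.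
have jm i : (j i < m.+1)%N.
  rewrite ltnS; apply: leq_trans (_ : mlen j <= m)%N; first exact: leq_mlen.
  by rewrite -(ler_nat R) ltW // (lt_le_trans jc).
by exists [ffun i => Ordinal (jm i)] => //; apply/ffunP => i; rewrite !ffunE.
Qed.

(** The sum is finite because its condition bounds |j|. *)
Lemma TaylorE l k a : exists s : seq (mindex d),
  [/\ uniq s, forall j, (j \in s) = ((mlen j + mlen k)%N%:R < thom h a + h l)
    & Taylor h l k a = \sum_(j <- s) ((mfact j)%:R^-1 : R) *: <[(tX j, plant l (k + j) a)]>].
Proof.
have /finite_fsetP[X EX] : finite_set [set j : mindex d | (mlen j + mlen k)%N%:R < thom h a + h l].
  apply: sub_finite_set (finite_mlen_lt (thom h a + h l - (mlen k)%:R)) => j /=.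
  by rewrite natrD ltrBrDr.
have XE j : (j \in X) = ((mlen j + mlen k)%N%:R < thom h a + h l).
  apply/idP/idP => hj; first by have : [set` X] j := hj; rewrite -EX.
  by have : [set j : mindex d | (mlen j + mlen k)%N%:R < thom h a + h l] j := hj; rewrite EX.
exists X; split; [exact: fset_uniq|exact: XE|].
rewrite /Taylor bvec.unlock; apply: fsum_seqE; first exact: fset_uniq.
  by move=> j; rewrite XE.
by move=> j /= hj; rewrite XE hj.
Qed.

Lemma supp_in_Taylor (P : dtree * dtree -> Prop) l k a :
  (forall j, (mlen j + mlen k)%N%:R < thom h a + h l -> P (tX j, plant l (k + j) a)) ->
  supp_in P (Taylor h l k a).
Proof.
move=> Pj; have [s [_ sE ->]] := TaylorE l k a.
by apply: supp_in_sum_seq => j; rewrite sE => /Pj ?; apply: supp_inZ; apply: supp_inU.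
Qed.

Lemma supp_in_plantL (P Q : dtree * dtree -> Prop) l k z :
  supp_in P z -> (forall a b, P (a, b) -> Q (plant l k a, b)) -> supp_in Q (plantL l k z).
Proof.
by move=> Pz PQ; rewrite plantL.unlock; apply: supp_in_lext Pz _ => -[a b] Pab; apply: supp_inU; apply: PQ.
Qed.

(** Induction on |n|, splitting off one X_i. Only which pairs occur is recorded, the later uses
    being support statements. *)
Lemma supp_in_DeltaX n :
  supp_in (fun p => exists i j, p = (tX i, tX j) /\ i + j = n) (DeltaX R L n).
Proof.
have [N] := ubnP (mlen n); elim: N n => // N IH n nN.
have [n0|/existsP[i ni]] := boolP [forall i, n i == 0%N].
  have -> : n = 0 by apply/ffunP => i; rewrite ffunE; apply/eqP; move/forallP: n0.
  by rewrite DeltaX0; apply: supp_inU; exists 0, 0; rewrite addr0.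
have nE : n = munit i + msub n (munit i).
  apply/ffunP => j; rewrite !ffunE.
  by case: (eqVneq j i) => [->|_] /=; [move: ni; lia|lia].
rewrite nE DeltaXD DeltaX1; apply: (@supp_in_mul2 (fun p => p = (tX (munit i), tX 0) \/ p = (tX 0, tX (munit i)))).
- by apply: supp_inD; apply: supp_inU; [left|right].
- by apply: IH; move: nN; rewrite [in X in (X < _)%N]nE mlenD mlen_munit add1n ltnS.
move=> p q hp [i1 [j1 [-> e]]]; case: hp => ->; rewrite /tmul2 /= -!tX_add.
  by exists (munit i + i1), (0 + j1); rewrite add0r -addrA e.
by exists (0 + i1), (munit i + j1); rewrite add0r addrCA e.
Qed.

End Coproduct.

(** * Additive statistics of trees *)

Section Weights.
Variables (R : realType) (d : nat) (L : finType) (h : L -> R).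
Local Notation label := (L * mindex d)%type.
Local Notation odeco := ({ffun 'I_d -> int} * {ffun L -> int})%type.
Local Notation rtree := (rtree d L).
Local Notation dtree := (dtree d L).
Local Notation TT := {malg R[dtree * dtree]}.
Local Notation "a ** b" := (tmul a b) (at level 40, left associativity).
Local Notation tX := (tX L).

Section OneWeight.
Variables (V : zmodType) (al : V) (g : odeco -> V) (ed : label -> V).

(** The common form of the homogeneity, its integer part [iwt], the edge counts [cnt] and the number
    [ntot] of n-decorations; [al] is the weight of one unit of n-decoration. *)
Fixpoint rweight (t : rtree) : V :=
  let: Node n o s := t in
  al *+ mlen n + g o
    + foldr (fun x a => ed x.1 + rweight x.2 + a) 0 s.

Definition weight (a : dtree) := rweight (repr a).

Hypothesis gD : forall o o', g (o + o') = g o + g o'.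

Let g0 : g 0 = 0.
Proof. by apply: (addIr (g 0)); rewrite -gD !add0r. Qed.

Lemma rweight_Node n o s : rweight (Node n o s) =
  al *+ mlen n + g o + \sum_(x <- s) (ed x.1 + rweight x.2).
Proof. by congr (_ + _); elim: s => [|x s IH] /=; rewrite ?big_nil ?big_cons ?IH. Qed.

Lemma weight_tcls t : weight (tcls t) = rweight t.
Proof.
apply/esym; move: (tiso_repr t); apply: (@tiso_invariant _ _ V (fun n o r =>
  al *+ mlen n + g o + \sum_(x <- r) (ed x.1.1 + x.1.2))).
  by move=> n o r r' rr'; rewrite (perm_big _ rr').
by move=> n o s; rewrite rweight_Node big_map.
Qed.

Lemma weight_tmul a b : weight (a ** b) = weight a + weight b.
Proof.
rewrite weight_tcls /weight; case: (repr a) => n o s; case: (repr b) => n' o' s'.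
rewrite [rmul _ _]/= !rweight_Node big_cat /= mlenD mulrnDr gD.
by rewrite (addrACA (al *+ mlen n)) [RHS]addrACA.
Qed.

Lemma weight_tX n : weight (tX n) = al *+ mlen n.
Proof. by rewrite weight_tcls /= g0 !addr0. Qed.

Lemma weight_tO o : weight (tO o) = g o.
Proof. by rewrite weight_tcls /= mlen0 mulr0n add0r addr0. Qed.

Lemma weight_plant l k a : weight (plant l k a) = ed (l, k) + weight a.
Proof. by rewrite weight_tcls /= mlen0 mulr0n g0 !addr0 !add0r. Qed.

Hypothesis edD : forall l k j, ed (l, k + j) = ed (l, k) - al *+ mlen j.

(** Hypothesis [edD] balances the Taylor terms: what X^j adds on the left is subtracted on the
    right, where the edge decoration grows by j. *)
Lemma Dl_weight a : supp_in (fun p => weight p.1 + weight p.2 = weight a) (Dl h a : TT).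
Proof.
elim/dtree_ind: a => [n|o|a b IHa IHb|l k a IH].
- rewrite DlX; apply: supp_in_sub (@supp_in_DeltaX _ _ _ n) _ => _ [i [j [-> <-]]] /=.
  by rewrite !weight_tX mlenD mulrnDr.
- by rewrite DlO; apply: supp_inU; rewrite /= (weight_tX 0) mlen0 mulr0n addr0.
- rewrite DlM; apply: (supp_in_mul2 IHa IHb) => p q /= pa qb.
  by rewrite !weight_tmul -pa -qb addrACA.
rewrite DlP; apply: supp_inD.
  apply: supp_in_plantL IH _ => a1 b1 /= e.
  by rewrite !weight_plant -addrA e.
apply: supp_in_Taylor => j _ /=; rewrite !weight_plant weight_tX edD.
by rewrite -(addrA (ed (l, k))) addrCA addNKr.
Qed.


End OneWeight.
End Weights.

(** * Conforming trees and contractions *)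

Section Conformity.
Variables (R : realType) (d : nat) (L : finType) (h : L -> R).
Local Notation label := (L * mindex d)%type.
Local Notation odeco := ({ffun 'I_d -> int} * {ffun L -> int})%type.
Local Notation rtree := (rtree d L).
Local Notation dtree := (dtree d L).
Local Notation mtree := (mtree d L).
Local Notation TT := {malg R[dtree * dtree]}.
Local Notation "a ** b" := (tmul a b) (at level 40, left associativity).
Local Notation tX := (tX L).
Variable rule : L -> set {mset label}%mset.
Hypothesis rule_norm : rule_normal rule.
Implicit Types (a b c : dtree) (t u : rtree) (n k : mindex d) (o : odeco).

Lemma conforming_Node n o s : conforming rule (Node n o s) <->
  (forall x, List.In x s -> rule x.1.1 (rootset x.2) /\ conforming rule x.2).
Proof.
rewrite /=; elim: s => [|x s IH] /=; first by split=> // _ x [].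
split=> [[rx cx /IH cs] y [<-//|/cs//]|cs].
split; [by have [] := cs x (or_introl erefl)|by have [] := cs x (or_introl erefl)|].
by apply/IH => y ys; apply: cs; right.
Qed.

Definition rset a : {mset label}%mset := seq_mset (map fst (rootb a)).

Lemma rootset_tcls t : rootset t = rset (tcls t).
Proof.
apply/eq_seq_msetP; apply: perm_trans (perm_map fst _); last first.
  by rewrite perm_sym; exact: rootb_tcls.
by rewrite -map_comp; apply: perm_refl.
Qed.

Lemma count_rset_tmul a b x : (rset (a ** b) x = rset a x + rset b x)%N.
Proof.
rewrite !mset_seqE -count_cat -map_cat; apply/permP.
exact/perm_map/rootb_tmul.
Qed.

Lemma rset_plant l k a : rset (plant l k a) = seq_mset [:: (l, k)].
Proof. by rewrite /rset rootb_plant. Qed.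
Lemma rset_tX n : rset (tX n) = mset0.
Proof. by rewrite /rset rootb_tX; apply/msetP => x; rewrite mset_seqE mset0E. Qed.
Definition conf a := conforming rule (repr a).

Lemma conf_tcls t : conf (tcls t) <-> conforming rule t.
Proof.
suff H t' u' : tiso t' u' -> `[< conforming rule t' >] = `[< conforming rule u' >].
  by have e := H _ _ (tiso_repr t); split=> /asboolP c; apply/asboolP; rewrite /conf ?e // -e.
apply: (@tiso_invariant _ _ _ (fun n o (r : seq (label * bool * dtree)) =>
   all (fun x => `[< rule x.1.1.1 (rset x.2) >] && x.1.2) r)
   (fun t => `[< conforming rule t >])).
  by move=> n o r r' rr'; rewrite (perm_all _ rr').
move=> n o s; apply/asboolP/idP => [/conforming_Node cs|].
  rewrite all_map; elim: s cs => //= x s IH cs; rewrite IH; last by move=> y ys; apply: cs; right.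
  have [rx cx] := cs x (or_introl erefl); rewrite andbT; apply/andP; split; apply/asboolP => //=.
  by rewrite -rootset_tcls.
rewrite all_map => cs; apply/conforming_Node; elim: s cs => //= x s IH /andP[/andP[/asboolP rx /asboolP cx] /IH cs].
by move=> y [<-|/cs//]; rewrite rootset_tcls.
Qed.

Lemma conf_tmul a b : conf (a ** b) <-> conf a /\ conf b.
Proof.
rewrite -(tclsK a) -(tclsK b) tmul_tcls !conf_tcls.
case: (repr a) => n o s; case: (repr b) => n' o' s'; rewrite [rmul _ _]/= !conforming_Node.
split=> [cs|[cs cs'] x /List.in_app_iff[/cs|/cs']//].
by split=> x xs; apply: cs; apply/List.in_app_iff; [left|right].
Qed.

Lemma conf_tX n : conf (tX n). Proof. by apply/conf_tcls. Qed.
Lemma conf_tO o : conf (tO o). Proof. by apply/conf_tcls. Qed.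
Lemma conf_plant l k a : conf (plant l k a) <-> rule l (rset a) /\ conf a.
Proof.
rewrite conf_tcls conforming_Node /=; split=> [H|[ra ca] x [<-|[]]]; last by rewrite /= rootset_tcls tclsK.
by have [] := H _ (or_introl erefl); rewrite /= rootset_tcls tclsK.
Qed.

Lemma conf_prod (s : seq (label * dtree)) :
  conf (\big[@tmul d L/tX 0]_(x <- s) bplant x) <->
  forall x, x \in s -> rule x.1.1 (rset x.2) /\ conf x.2.
Proof.
elim: s => [|x s IH]; first by rewrite big_nil; split=> // _; exact: conf_tX.
rewrite big_cons conf_tmul IH conf_plant; split=> [[cx cs] y|H].
  by rewrite inE => /orP[/eqP->|/cs].
by split=> [|y ys]; apply: H; rewrite inE ?eqxx ?ys ?orbT.
Qed.

(** Cutting branches leaves at each node a sub-multiset of its outgoing edges, which a normal rule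
    accepts. *)
Lemma Dl_conf a : conf a ->
  supp_in (fun p => conf p.1 /\ msubset (rset p.1) (rset a)) (Dl h a : TT).
Proof.
elim/dtree_ind: a => [n|o|a b IHa IHb|l k a IH].
- move=> _; rewrite DlX; apply: supp_in_sub (@supp_in_DeltaX _ _ _ n) _ => _ [i [j [-> _]]] /=.
  by split; [exact: conf_tX|rewrite !rset_tX msub0set].
- by move=> _; rewrite DlO; apply: supp_inU; split; [exact: conf_tO|exact: msubset_refl].
- move=> /conf_tmul[/IHa{}IHa /IHb{}IHb]; rewrite DlM.
  apply: (supp_in_mul2 IHa IHb) => p q /= [cp ap] [cq bq]; split; first by apply/conf_tmul.
  apply/msubsetP => x; rewrite !count_rset_tmul leq_add //; exact/msubsetP.
move=> /conf_plant[ra /IH{}IH]; rewrite DlP; apply: supp_inD.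
  apply: supp_in_plantL IH _ => a1 b1 /= [ca sa]; rewrite conf_plant !rset_plant.
  by split; [split=> //; exact: rule_norm ra sa|exact: msubset_refl].
by apply: supp_in_Taylor => j _ /=; split; [exact: conf_tX|rewrite rset_tX msub0set].
Qed.

(** By this invariance the sign condition on a contracted subtree at the root survives in the left
    factors of Delta. *)
Lemma Dl_rooto a : supp_in (fun p => rooto p.1 = rooto a /\ rooto p.2 = 0) (Dl h a : TT).
Proof.
elim/dtree_ind: a => [n|o|a b IHa IHb|l k a IH].
- rewrite DlX; apply: supp_in_sub (@supp_in_DeltaX _ _ _ n) _ => _ [i [j [-> _]]] /=.
  by rewrite !rooto_tX.
- by rewrite DlO; apply: supp_inU; rewrite /= rooto_tO rooto_tX.
- rewrite DlM; apply: (supp_in_mul2 IHa IHb) => p q /= [pa pb] [qa qb].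
  by rewrite !rooto_tmul pa pb qa qb addr0.
rewrite DlP; apply: supp_inD.
  by apply: supp_in_plantL IH _ => a1 b1 /= [_ ->]; rewrite !rooto_plant.
by apply: supp_in_Taylor => j _ /=; rewrite rooto_tX !rooto_plant.
Qed.

Lemma mtree_ind' (P : mtree -> Prop) :
  (forall n nS s, List.Forall (fun x => P x.2) s -> P (MNode n nS s)) -> forall m, P m.
Proof.
move=> H; fix IH 1 => -[n nS s]; apply: H.
by elim: s => [|[x m] s IHs]; constructor.
Qed.

Local Notation mbranch := (label * option (mindex d) * mtree)%type.

Definition cls_contr (m : mtree) : dtree := tcls (contraction m).

(** The factor by which a branch enters the contraction at the root. An edge of some S leaves only
    its o-decoration, its upper end merging with the root; any other edge stays planted, with eS
    recorded both on it and in the root o-decoration. *)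
Definition contr_branch (x : mbranch) : dtree :=
  match x.1.2 with
  | None => tO (oedge x.1.1) ** cls_contr x.2
  | Some eS => tO (oX L eS) ** plant x.1.1.1 (x.1.1.2 + eS) (cls_contr x.2)
  end.

Lemma cls_contr_MNode n nS s : cls_contr (MNode n nS s) =
  (\big[@tmul d L/tX 0]_(x <- s) contr_branch x) ** (tO (oX L nS) ** tX (msub n nS)).
Proof.
rewrite /cls_contr /=; elim: s => [|[[[l k] [eS|]] m] s IH] /=.
- by rewrite big_nil tmul1 [tO _ ** _]tmul_tcls /= addr0 add0r.
- rewrite big_cons -tmulA -IH /contr_branch /= plant_tcls.
  by rewrite [tO _ ** _]tmul_tcls [RHS]tmul_tcls /= !add0r addr0.
- rewrite big_cons -tmulA -IH /contr_branch /= -[tO _ ** _]Radd_tO Radd_tcls.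
  by rewrite [RHS]tmul_tcls.
Qed.

End Conformity.

(** * Stability of the trees of T and T+ under cutting *)

Section Membership.
Variables (R : realType) (d : nat) (L : finType) (h : L -> R).
Local Notation label := (L * mindex d)%type.
Local Notation odeco := ({ffun 'I_d -> int} * {ffun L -> int})%type.
Local Notation rtree := (rtree d L).
Local Notation dtree := (dtree d L).
Local Notation mtree := (mtree d L).
Local Notation mbranch := (label * option (mindex d) * mtree)%type.
Local Notation TT := {malg R[dtree * dtree]}.
Local Notation "a ** b" := (tmul a b) (at level 40, left associativity).
Local Notation tX := (tX L).
Variable rule : L -> set {mset label}%mset.
Hypothesis rule_norm : rule_normal rule.
Hypothesis rule_compl : rule_complete h rule.
Implicit Types (a b c : dtree) (t u : rtree) (n k : mindex d) (o : odeco) (m : mtree).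
Local Notation BB := (B_BHZ h rule).
Local Notation BP := (Bp_BHZ h rule).
Local Notation conf := (conf rule).
Local Notation tprod s := (\big[@tmul d L/tX 0]_(x <- s) bplant x).
Local Notation cprod s := (\big[@tmul d L/tX 0]_(x <- s) contr_branch x).

Lemma thom_weight a : thom h a = weight 1 (@ohom R d L h) (fun x => h x.1 - (mlen x.2)%:R) a.
Proof. by []. Qed.

Lemma ohomD o o' : ohom h (o + o') = ohom h o + ohom h o'.
Proof.
rewrite /ohom /= addrACA; congr (_ + _).
  by rewrite -intrD -big_split; congr (_%:~R); apply: eq_bigr => i _; rewrite ffunE.
by rewrite -big_split; apply: eq_bigr => i _; rewrite ffunE intrD mulrDl.
Qed.

Lemma thom_tmul a b : thom h (a ** b) = thom h a + thom h b.
Proof. by rewrite !thom_weight weight_tmul //; exact: ohomD. Qed.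
Lemma thom_tX n : thom h (tX n) = (mlen n)%:R.
Proof. by rewrite thom_weight weight_tX //; exact: ohomD. Qed.
Lemma thom_tO o : thom h (tO o) = ohom h o.
Proof. by rewrite thom_weight weight_tO. Qed.
Lemma thom_plant l k a : thom h (plant l k a) = h l - (mlen k)%:R + thom h a.
Proof. by rewrite !thom_weight weight_plant //; exact: ohomD. Qed.
Lemma Dl_thom a : supp_in (fun p => thom h p.1 + thom h p.2 = thom h a) (Dl h a : TT).
Proof.
apply: (@Dl_weight R d L h R 1 (ohom h) (fun x => h x.1 - (mlen x.2)%:R) ohomD) => l k j /=.
by rewrite mlenD natrD opprD addrA.
Qed.

Lemma thom_plant_gt0 l k a :
  (0 < thom h (plant l k a)) = ((mlen k)%:R < thom h a + h l).
Proof. by rewrite thom_plant addrAC [h l + _]addrC subr_gt0. Qed.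

Lemma BB_conf a : BB a -> conf a.
Proof. by move=> [m [am sm ->]]; apply/conf_tcls; have [] := rule_compl am sm. Qed.

Lemma BP_E a : BP a <-> exists k s,
  (forall x, x \in s -> [/\ BB x.2, 0 < thom h (bplant x) & rule x.1.1 (rset x.2)]) /\
  a = tprod s ** tX k.
Proof.
have fE k (s : seq (label * dtree)) : foldr (fun x v => tmul (plant x.1.1 x.1.2 x.2) v) (tX k) s = tprod s ** tX k.
  exact: (@foldr_big _ _ (@tmul d L) _ (@bplant d L)).
split=> [[ca [k [s [sB aE]]]]|[k [s [sB ->]]]].
  move: ca; rewrite aE fE => ca; exists k, s; split=> // x xs.
  have [Bx px] := sB x xs; split=> //.
  by move/conf_tmul: ca => [/conf_prod/(_ x xs)[]].
split; last first.
  by exists k, s; split=> [x xs|]; [have [] := sB x xs|rewrite fE].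
apply/conf_tmul; split; last exact: conf_tX.
by apply/conf_prod => x xs; have [/BB_conf] := sB x xs.
Qed.

Lemma BP_tX n : BP (tX n).
Proof. by apply/BP_E; exists n, [::]; rewrite big_nil tmul1. Qed.

Lemma BP_tmul a b : BP a -> BP b -> BP (a ** b).
Proof.
move=> /BP_E[k [s [sB ->]]] /BP_E[k' [s' [sB' ->]]]; apply/BP_E; exists (k + k'), (s ++ s').
split=> [x|]; first by rewrite mem_cat => /orP[/sB|/sB'].
by rewrite big_cat tX_add Monoid.mulmACA.
Qed.

Lemma BP_plant l k a : BB a -> 0 < thom h (plant l k a) -> rule l (rset a) -> BP (plant l k a).
Proof.
move=> Ba pa ra; apply/BP_E; exists 0, [:: (l, k, a)]; split=> [x|].
  by rewrite inE => /eqP->.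
by rewrite big_seq1 Monoid.mulm1.
Qed.

Lemma BP_plantE l k a : BP (plant l k a) -> [/\ BB a, 0 < thom h (plant l k a) & rule l (rset a)].
Proof.
move=> /BP_E[k' [s [sB aE]]].
have : perm_eq [:: (l, k, a)] s.
  rewrite -(rootb_plant l k a) aE; apply: perm_trans (rootb_tmul _ _) _.
  by rewrite rootb_tX cats0 rootb_prod.
by move=> /perm_mem/(_ (l, k, a)); rewrite mem_head => /esym/sB.
Qed.

Lemma BP_rooto a : BP a -> rooto a = 0.
Proof. by move=> /BP_E[k [s [_ ->]]]; rewrite rooto_tmul rooto_prod rooto_tX addr0. Qed.

(* The branches kept in a cut of [s]; [c] and [j] are the decorations left by the
   branches that are cut off. *)
Definition cut_branches (s : seq mbranch) (a : dtree) := exists (c j : mindex d) (s' : seq mbranch),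
  [/\ all (fun x : mbranch => admissible_at h (x.1.2 != None) x.2) s',
      List.Forall (fun x : mbranch =>
        rule x.1.1.1 (rootset (underlying x.2)) /\ conforming rule (underlying x.2)) s',
      subseq (map fst s') (map fst s),
      has (fun x : mbranch => x.1.2 == None) s' = has (fun x : mbranch => x.1.2 == None) s
    & (all (fun x : mbranch => x.1.2 == Some 0) s -> c = 0) /\
      a = cprod s' ** (tO (oX L c) ** tX j)].

Lemma msub_addl n k : msub (n + k) n = k.
Proof. by apply/ffunP => x; rewrite !ffunE; exact: addKn. Qed.

Lemma mle_addr n k : mle n (n + k).
Proof. by apply/forallP => x; rewrite ffunE; exact: leq_addr. Qed.

Lemma msub_addA n k l : mle l k -> msub (n + k) l = n + msub k l.
Proof.
move=> /forallP lk; apply/ffunP => x; rewrite !ffunE; exact/esym/addnBA/lk.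
Qed.

Lemma oXD n k : oX L (n + k) = oX L n + oX L k.
Proof.
rewrite /oX; congr pair; last by rewrite addr0.
by apply/ffunP => i; rewrite !ffunE PoszD.
Qed.

Lemma rooto_cls_contr m : rooto (cls_contr m) = odec (contraction m).
Proof. exact: rooto_tcls. Qed.

Lemma conforming_underlying n nS s : conforming rule (underlying (MNode n nS s)) <->
  List.Forall (fun x : mbranch =>
        rule x.1.1.1 (rootset (underlying x.2)) /\ conforming rule (underlying x.2)) s.
Proof.
rewrite /=; elim: s => [|x s IH] /=; first by split=> // _; constructor.
split=> [[? ? /IH ?]|H]; first by constructor.
by inversion H as [|? ? [? ?] ?]; subst; split=> //; apply/IH.
Qed.

Lemma rootset_underlying n nS s :
  rootset (underlying (MNode n nS s)) = seq_mset [seq x.1.1 | x : mbranch <- s].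
Proof. by rewrite /rootset /= -map_comp. Qed.

Lemma supp_in_mul2_tmul (P Q S : dtree -> Prop) (z w : TT) :
  supp_in (fun p => P p.1 /\ BP p.2) z -> supp_in (fun p => Q p.1 /\ BP p.2) w ->
  (forall a b, P a -> Q b -> S (a ** b)) ->
  supp_in (fun p => S p.1 /\ BP p.2) (prod2 z w).
Proof.
move=> Pz Qw PQ; apply: (supp_in_mul2 Pz Qw) => -[p1 p2] [q1 q2] [/= ? ?] [? ?].
by split; [exact: PQ|exact: BP_tmul].
Qed.

(** The left factors are contractions of cut marked trees. Conformity of the contraction is assumed
    because the right factors are made of planted contracted branches, which have to conform in
    order to lie in T+. *)
Definition Dl_contr_spec m := forall top, admissible_at h top m ->
  conforming rule (underlying m) -> conf (cls_contr m) ->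
  supp_in (fun p => (exists m', [/\ admissible_at h top m', conforming rule (underlying m'),
      msubset (rootset (underlying m')) (rootset (underlying m)) & p.1 = cls_contr m'])
    /\ BP p.2) (Dl h (cls_contr m) : TT).

Lemma Dl_cprod (s : seq mbranch) : List.Forall (fun x => Dl_contr_spec x.2) s ->
  all (fun x : mbranch => admissible_at h (x.1.2 != None) x.2) s ->
  List.Forall (fun x : mbranch =>
        rule x.1.1.1 (rootset (underlying x.2)) /\ conforming rule (underlying x.2)) s ->
  conf (cprod s) ->
  supp_in (fun p => cut_branches s p.1 /\ BP p.2) (Dl h (cprod s) : TT).
Proof.
elim: s => [|x s IH].
  move=> _ _ _ _; rewrite big_nil DlX DeltaX0; apply: supp_inU; split; last exact: BP_tX.
  exists 0, 0, [::]; split=> //; split=> //.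
  by rewrite big_nil tmul1 tmulC tmul1; congr tcls; congr Node; rewrite /oX; congr pair; apply/ffunP => i; rewrite !ffunE.
move=> H; inversion H as [|? ? Hx Hs]; subst; clear H.
move=> /= /andP[ax as_] H; inversion H as [|? ? [rx cx] cs]; subst; clear H.
rewrite big_cons => /conf_tmul[cfx cfs]; rewrite DlM.
pose P a := (exists m', [/\ admissible_at h (x.1.2 != None) m', conforming rule (underlying m'),
   msubset (rootset (underlying m')) (rootset (underlying x.2)) & a = contr_branch (x.1, m')])
   \/ (exists eS j, x.1.2 = Some eS /\ a = tO (oX L eS) ** tX j).
apply: (@supp_in_mul2_tmul P _ _ _ _ _ (IH Hs as_ cs cfs)); last first.
  move=> a b Pa [c [j [s' [as' cs' ss' hs' [c0 ->]]]]].
  case: Pa => [[m' [am' cm' rm' ->]]|[eS [j' [xS ->]]]].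
    exists c, j, ((x.1, m') :: s'); split => //=.
    - by rewrite am' as'.
    - by constructor => //; split=> //; exact: rule_norm rx rm'.
    - by rewrite eqxx.
    - by rewrite hs'.
    - by split; [move=> /andP[_ /c0]|rewrite big_cons tmulA].
  (* The branch is cut off: its eS and the exponent of its Taylor monomial join the accumulated c
     and j. *)
  have sx : subseq (map fst s') (map fst (x :: s)).
    by apply: subseq_trans ss' _; rewrite [map fst (x :: s)]/=; exact: subseq_cons.
  exists (eS + c), (j' + j), s'.
  split; [exact: as'|exact: cs'|exact: sx|by rewrite /= hs' xS|].
  split; first by rewrite /= xS => /andP[/eqP[->] /c0 ->]; rewrite addr0.
  by rewrite oXD tO_add tX_add ((@tmul d L).[AC (2*(1*2)) (3*((1*4)*(2*5)))]).
have Px m' : admissible_at h (x.1.2 != None) m' -> conforming rule (underlying m') ->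
    msubset (rootset (underlying m')) (rootset (underlying x.2)) -> P (contr_branch (x.1, m')).
  by move=> ? ? ?; left; exists m'.
rewrite /contr_branch in cfx *; case xS: x.1.2 ax cfx Px => [eS|] ax /conf_tmul[_ cfx] Px.
  have /conf_plant[rcx ccx] := cfx.
  rewrite DlM DlO DlP.
  apply: (@supp_in_mul2_tmul (fun a => a = tO (oX L eS)) (fun a =>
      (exists m', [/\ admissible_at h true m', conforming rule (underlying m'),
        msubset (rootset (underlying m')) (rootset (underlying x.2))
        & a = plant x.1.1.1 (x.1.1.2 + eS) (cls_contr m')]) \/ exists j, a = tX j)).
  - by apply: supp_inU; split=> //; exact: BP_tX.
  - apply: supp_inD.
      apply: supp_in_plantL (Hx _ ax cx ccx) _ => a b /= [[m' [am' cm' rm' ->]] Bb].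
      by split=> //; left; exists m'.
    apply: supp_in_Taylor => j hj /=; split; first by right; exists j.
    apply: BP_plant => //; first by exists x.2; split=> //; split=> //; exists x.1.1.1.
    by rewrite thom_plant_gt0 mlenD natrD; move: hj; rewrite !natrD mlenD natrD; lra.
  move=> _ b -> [[m' [am' cm' rm' ->]]|[j ->]]; last by right; exists eS, j.
  by have := Px m'; rewrite /contr_branch /= xS; apply.
rewrite DlM DlO.
apply: (@supp_in_mul2_tmul (fun a => a = tO (oedge x.1.1)) (fun a =>
      (exists m', [/\ admissible_at h false m', conforming rule (underlying m'),
        msubset (rootset (underlying m')) (rootset (underlying x.2))
        & a = cls_contr m']))).
- by apply: supp_inU; split=> //; exact: BP_tX.
- by apply: supp_in_sub (Hx _ ax cx cfx) _ => -[a b].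
move=> _ b -> [m' [am' cm' rm' ->]].
by have := Px m'; rewrite /contr_branch /= xS; apply.
Qed.

Lemma admissible_MNode top n nS s : admissible_at h top (MNode n nS s) =
  [&& mle nS n, top ==> component_ok h (MNode n nS s)
    & all (fun x : mbranch => admissible_at h (x.1.2 != None) x.2) s].
Proof. by []. Qed.

Lemma component_okE n nS s : component_ok h (MNode n nS s) =
  if has (fun x : mbranch => x.1.2 == None) s
  then ohom h (rooto (cls_contr (MNode n nS s))) < 0
  else (nS == 0) && all (fun x : mbranch => x.1.2 == Some 0) s.
Proof. by rewrite rooto_cls_contr. Qed.

(** If the root lies in some S, the sign condition carries over because [Dl_rooto] keeps the root
    o-decoration and no edge of S is cut. If it lies in none, all eS at the root are 0, so c = 0 and
    n_S stays 0. *)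
Lemma Dl_contr m : Dl_contr_spec m.
Proof.
elim/mtree_ind': m => n nS s IH top adm /conforming_underlying cu cf.
have := adm; rewrite admissible_MNode => /and3P[nn cok adm_s].
have := cf; rewrite {1}cls_contr_MNode => /conf_tmul[cfs _].
have D1 := Dl_cprod IH adm_s cu cfs.
have D2 : supp_in (fun p => (exists i, p.1 = tO (oX L nS) ** tX i) /\ BP p.2)
    (Dl h (tO (oX L nS) ** tX (msub n nS)) : TT).
  rewrite DlM DlO DlX.
  apply: (@supp_in_mul2_tmul (fun a => a = tO (oX L nS)) (fun a => exists i, a = tX i)
    (fun a => exists i, a = tO (oX L nS) ** tX i)).
  - by apply: supp_inU; split=> //; exact: BP_tX.
  - apply: supp_in_sub (@supp_in_DeltaX _ _ _ (msub n nS)) _ => _ [i [j [-> ij]]] /=.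
    by split; [exists i|exact: BP_tX].
  by move=> _ b -> [i ->]; exists i.
have D : supp_in (fun p => (exists i b, cut_branches s b /\ p.1 = b ** (tO (oX L nS) ** tX i)) /\ BP p.2)
    (Dl h (cls_contr (MNode n nS s)) : TT).
  rewrite cls_contr_MNode DlM.
  apply: (supp_in_mul2_tmul (P := cut_branches s)
    (Q := fun a => exists i, a = tO (oX L nS) ** tX i) (S := fun a => exists i b, cut_branches s b /\ a = b ** (tO (oX L nS) ** tX i)) D1 D2) => a b ca [i ->].
  by exists i, a.
move=> p pD; have [[i [b [[c [j [s' [as' cs' ss' hs' [c0 bE]]]]] p1]]] Bp2] := D p pD.
split=> //; have [roo _] := Dl_rooto pD.
(* The eS of the cut edges are added to n_S, which keeps the root o-decoration; n exceeds n_S by j +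
   i, the powers of X left by the cut branches and by the root polynomial. *)
pose m' := MNode (nS + c + (j + i)) (nS + c) s'.
have Em' : p.1 = cls_contr m'.
  rewrite p1 bE cls_contr_MNode.
  by rewrite msub_addl oXD tO_add tX_add ((@tmul d L).[AC ((1*2)*2) (1*((4*2)*(3*5)))]).
exists m'; split=> //.
- rewrite admissible_MNode as' andbT; apply/andP; split.
    exact: mle_addr.
  apply/implyP => /(implyP cok); rewrite !component_okE -/m' -Em' roo hs'.
  case: ifP => // _ /andP[/eqP-> alls]; rewrite c0 // addr0 eqxx /=.
  have allE (r : seq mbranch) : all (fun x : mbranch => x.1.2 == Some 0) r =
      all (fun y : label * option (mindex d) => y.2 == Some 0) (map fst r) by rewrite all_map.
  rewrite allE; apply/allP => y /(mem_subseq ss'); rewrite allE in alls.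
  by move/allP: alls; apply.
- exact/conforming_underlying.
- rewrite !rootset_underlying; apply/msubsetP => x; rewrite !mset_seqE.
  apply: leq_count_subseq.
  by rewrite !(map_comp fst fst) map_subseq.
Qed.

Lemma BB_Dl a : BB a -> supp_in (fun p => BB p.1 /\ BP p.2) (Dl h a : TT).
Proof.
move=> Ba; have ca := BB_conf Ba; move: Ba ca => [m [am [cm [l rl]] ->]] ca.
apply: supp_in_sub (Dl_contr am cm ca) _ => p [[m' [am' cm' rm' ->]] Bp]; split=> //.
exists m'; split=> //; split=> //; exists l; exact: rule_norm rl rm'.
Qed.

(** Raising n at the root of a marked tree multiplies its contraction by X^n and changes neither n_S
    nor the root o-decoration. *)
Lemma BB_tX_mul n a : BB a -> BB (tX n ** a).
Proof.
move=> [[k kS s] [am sm ->]].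
have kk : mle kS k by move: am; rewrite /admissible admissible_MNode => /and3P[].
have E : cls_contr (MNode (n + k) kS s) = tX n ** cls_contr (MNode k kS s).
  rewrite !cls_contr_MNode.
  by rewrite msub_addA // tX_add ((@tmul d L).[AC (1*(1*2)) (3*(1*(2*4)))]).
exists (MNode (n + k) kS s); split=> //.
move: am; rewrite /admissible !admissible_MNode !component_okE E.
rewrite rooto_tmul rooto_tX add0r => /and3P[_ -> ->]; rewrite !andbT.
by apply/forallP => i; rewrite ffunE; apply: leq_trans (forallP kk i) (leq_addl _ _).
Qed.

(* Clears the n-decoration of the root of the contraction, i.e. lowers [n] to [nS] on the
   part of the root component. *)
Fixpoint clear_root m : mtree :=
  let: MNode n nS s := m in
  MNode nS nS [seq (x.1, if x.1.2 is None then clear_root x.2 else x.2) | x <- s].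

Definition clear_branch (x : mbranch) : mbranch :=
  (x.1, if x.1.2 is None then clear_root x.2 else x.2).

Lemma clear_root_MNode n nS s :
  clear_root (MNode n nS s) = MNode nS nS (map clear_branch s).
Proof. by []. Qed.

Lemma msubnn n : msub n n = 0.
Proof. by apply/ffunP => x; rewrite !ffunE subnn. Qed.

Lemma clear_root_contr m : exists n, cls_contr m = tX n ** cls_contr (clear_root m).
Proof.
elim/mtree_ind': m => n nS s IH.
have [k sE] : exists k, cprod s = tX k ** cprod (map clear_branch s).
  elim: s IH => [|x s IHs] H; first by exists 0; rewrite !big_nil tmul1.
  inversion H as [|? ? [k xE] Hs]; subst; clear H.
  have {IHs Hs} [k' sE] := IHs Hs.
  rewrite /= !big_cons sE /contr_branch /clear_branch /=; case: x.1.2 => [eS|] /=.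
    by exists k'; rewrite ((@tmul d L).[AC (2*2) (3*((1*2)*4))]).
  by exists (k + k'); rewrite xE tX_add ((@tmul d L).[AC ((1*2)*2) ((2*4)*((1*3)*5))]).
exists (k + msub n nS); rewrite clear_root_MNode !cls_contr_MNode sE msubnn.
by rewrite tX_add [tO _ ** tX 0]tmulC tmul1 ((@tmul d L).[AC (2*2) ((1*4)*(2*3))]).
Qed.

Lemma rootn_clear_root m : rootn (cls_contr (clear_root m)) = 0.
Proof.
elim/mtree_ind': m => n nS s IH; rewrite clear_root_MNode cls_contr_MNode msubnn.
rewrite !rootn_tmul rootn_tO rootn_tX !addr0.
elim: s IH => [|x s IHs] H /=; first by rewrite big_nil rootn_tX.
inversion H as [|? ? xE Hs]; subst; clear H.
rewrite big_cons rootn_tmul IHs // addr0 /contr_branch /clear_branch /=.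
by case: x.1.2 => [eS|] /=; rewrite rootn_tmul rootn_tO ?rootn_plant ?xE addr0.
Qed.

Lemma clear_root_conforming m : rootset (underlying (clear_root m)) = rootset (underlying m) /\
  (conforming rule (underlying m) -> conforming rule (underlying (clear_root m))).
Proof.
elim/mtree_ind': m => n nS s IH; rewrite clear_root_MNode; split.
  by rewrite !rootset_underlying -map_comp.
rewrite !conforming_underlying.
elim: s IH => [|x s IHs] H /= Hc; first by constructor.
inversion H as [|? ? [xr xc] Hs]; subst; clear H.
inversion Hc as [|? ? [rx cx] cs]; subst; clear Hc.
constructor; last exact: IHs.
by rewrite /clear_branch; case: (x.1.2) => //=; rewrite xr; split; auto.
Qed.

(** The two contractions differ by a power of X, so the root o-decoration, and with it the sign
    condition, is the same. *)
Lemma clear_root_admissible m top : admissible_at h top m -> admissible_at h top (clear_root m).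
Proof.
elim/mtree_ind': m top => n nS s IH top.
have ro : rooto (cls_contr (MNode nS nS (map clear_branch s))) = rooto (cls_contr (MNode n nS s)).
  rewrite -(clear_root_MNode n); have [k ->] := clear_root_contr (MNode n nS s).
  by rewrite rooto_tmul rooto_tX add0r.
rewrite clear_root_MNode !admissible_MNode !component_okE ro has_map all_map.
move=> /and3P[_ tc adm]; apply/and3P; split; last first.
- rewrite all_map; elim: s IH {ro tc} adm => //= x s IHs H /andP[ax as_].
  inversion H as [|? ? xE Hs]; subst; clear H.
  rewrite IHs // andbT /clear_branch /=.
  by case: (x.1.2) ax => //= ax; exact: xE.
- by [].
by apply/forallP => i.
Qed.

(** Used to take the power of X at the root out of a tree of T without leaving T. Clearing a marked
    tree over X^n a gives one over a, as comparison of the root data shows. *)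
Lemma BB_clear n a : rootn a = 0 -> BB (tX n ** a) -> BB a.
Proof.
move=> a0 [m [am [cm [l rl]] aE]].
have [k mE] := clear_root_contr m.
have mr := rootn_clear_root m.
have ea : a = cls_contr (clear_root m).
  have := aE; rewrite -/(cls_contr m) mE => e.
  have nk : n = k.
    by have := congr1 (@rootn d L) e; rewrite !rootn_tmul !rootn_tX a0 mr !addr0.
  apply: rootE; first by rewrite a0 mr.
    by have := congr1 (@rooto d L) e; rewrite !rooto_tmul !rooto_tX !add0r.
  have := rootb_tmul (tX n) a; rewrite rootb_tX e perm_sym => /perm_trans h1.
  have := h1 _ (rootb_tmul _ _); by rewrite rootb_tX.
have [rs cc] := clear_root_conforming m.
exists (clear_root m); split=> //; first exact: clear_root_admissible.
by split; [exact: cc|exists l; rewrite rs].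
Qed.

End Membership.

(** * Translation invariant elements *)

(* [lowX i n] is the derivative of [X^n] along the i-th coordinate. *)
HB.lock Definition lowX (R : realType) (d : nat) (L : finType) (i : 'I_d) (n : mindex d) :
  {malg R[dtree d L]} := (n i)%:R *: <[tX L (msub n (munit i))]>.

(* The part of [Delta a] whose right factors are polynomials. *)
HB.lock Definition Theta (R : realType) (d : nat) (L : finType) (h : L -> R) (a : dtree d L) :
  {malg R[dtree d L * dtree d L]} :=
  lext (fun p => if rootb p.2 == [::] then <[p]> else 0) (Dl h a).

(* The infinitesimal translation along the i-th coordinate. *)
HB.lock Definition pd (R : realType) (d : nat) (L : finType) (h : L -> R) (i : 'I_d) (a : dtree d L) :
    {malg R[dtree d L]} :=
  contract (fun b => ((rootn b == munit i) && (rootb b == [::]))%:R) (Theta h a).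

(** [lftd] and [rgtd] are the two sides of [lftd_Theta]: translating the left factor, or
    differentiating the polynomial on the right. *)
HB.lock Definition lftd (R : realType) (d : nat) (L : finType) (h : L -> R) (i : 'I_d)
    (z : {malg R[dtree d L * dtree d L]}) : {malg R[dtree d L * dtree d L]} :=
  lext (fun p => tens (pd h i p.1) <[p.2]>) z.

HB.lock Definition rgtd (R : realType) (d : nat) (L : finType) (i : 'I_d)
    (z : {malg R[dtree d L * dtree d L]}) : {malg R[dtree d L * dtree d L]} :=
  lext (fun p => tens <[p.1]> (lowX R L i (rootn p.2))) z.

(* Multiplies by [(-X)^n] at the root for each factor [X^n] on the right. *)
HB.lock Definition recS (R : realType) (d : nat) (L : finType)
    (z : {malg R[dtree d L * dtree d L]}) : {malg R[dtree d L]} :=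
  lext (fun p => (-1) ^+ mlen (rootn p.2) *: <[tmul (tX L (rootn p.2)) p.1]>) z.

Section TranslationInvariance.
Variables (R : realType) (d : nat) (L : finType) (h : L -> R).
Local Notation odeco := ({ffun 'I_d -> int} * {ffun L -> int})%type.
Local Notation dtree := (dtree d L).
Local Notation T := {malg R[dtree]}.
Local Notation TT := {malg R[dtree * dtree]}.
Local Notation "a ** b" := (tmul a b) (at level 40, left associativity).
Local Notation tX := (tX L).
Local Notation Dl := (Dl h).
Local Notation Theta := (Theta h).
Implicit Types (i : 'I_d) (n k : mindex d) (o : odeco) (a b : dtree) (u v : T) (z w : TT).

Lemma mindex_ind (P : mindex d -> Prop) : P 0 -> (forall i, P (munit i)) ->
  (forall n k, P n -> P k -> P (n + k)) -> forall n, P n.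
Proof.
move=> P0 P1 PD n; have [N] := ubnP (mlen n); elim: N n => // N IH n nN.
have [n0|/existsP[i ni]] := boolP [forall i, n i == 0%N].
  suff -> : n = 0 by [].
  by apply/ffunP => i; rewrite ffunE; apply/eqP; move/forallP: n0.
have nE : n = munit i + msub n (munit i).
  apply/ffunP => j; rewrite !ffunE.
  by case: (eqVneq j i) => [->|_] /=; [move: ni; lia|lia].
rewrite nE; apply: PD => //; apply: IH.
by move: nN; rewrite [in X in (X < _)%N]nE mlenD mlen_munit add1n ltnS.
Qed.

(* On the right factors of [Delta], which have no o-decoration at the root, [chi k] is the
   coefficient of [X^k]. *)
Definition chi k b : R := ((rootn b == k) && (rootb b == [::]))%:R.

Lemma rootb_tmul_nil a b : (rootb (a ** b) == [::]) = (rootb a == [::]) && (rootb b == [::]).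
Proof.
rewrite -!size_eq0 (perm_size (rootb_tmul a b)) size_cat addn_eq0.
by rewrite !size_eq0.
Qed.

Lemma addm_eq0 n k : (n + k == 0) = (n == 0) && (k == 0).
Proof. by rewrite -!mlen_eq0 mlenD addn_eq0 !mlen_eq0. Qed.

Lemma chi0M a b : chi 0 (a ** b) = chi 0 a * chi 0 b.
Proof.
rewrite /chi rootn_tmul rootb_tmul_nil addm_eq0 -natrM mulnb.
by congr (_%:R); congr nat_of_bool; rewrite andbACA.
Qed.

Lemma addm_munit n k i : ((n + k == munit i) : nat) =
  addn ((n == munit i) && (k == 0)) ((n == 0) && (k == munit i)).
Proof.
have [n0|n0] := eqVneq n 0.
  rewrite n0 add0r; have [k0|] := eqVneq k 0; last by rewrite andbF.
  have -> : (k == munit i) = false.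
    by apply/negbTE; rewrite k0 eq_sym -mlen_eq0 mlen_munit.
  by rewrite eq_sym -mlen_eq0 mlen_munit.
have [k0|k0] := eqVneq k 0; first by rewrite k0 addr0 andbT addn0.
rewrite andbF; case: eqP => // e.
have := congr1 (@mlen d) e; rewrite mlenD mlen_munit.
by move: n0 k0; rewrite -!mlen_eq0 -!lt0n; lia.
Qed.

(** If n + k is a unit index, one of n and k is 0. Thus [chi (munit i)] is a derivation over the
    character [chi 0], which makes [pd i] a derivation for the tree product. *)
Lemma chi1M i a b : chi (munit i) (a ** b) = chi (munit i) a * chi 0 b + chi 0 a * chi (munit i) b.
Proof.
rewrite /chi rootn_tmul rootb_tmul_nil -!natrM -natrD; congr (_%:R).
rewrite -mulnb addm_munit; case: (rootb a == _); case: (rootb b == _) => /=;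
by rewrite ?andbT ?andbF ?muln0 ?mul0n ?muln1 ?mulnb.
Qed.

Lemma chi_tX k n : chi k (tX n) = (n == k)%:R.
Proof. by rewrite /chi rootn_tX rootb_tX eqxx andbT. Qed.

Lemma chiXX k : chi k (tX k) = 1.
Proof. by rewrite chi_tX eqxx. Qed.

Lemma chiX_neq k n : n != k -> chi k (tX n) = 0.
Proof. by rewrite chi_tX => /negbTE ->. Qed.

Lemma munit_neq0 i : (munit i : mindex d) != 0.
Proof. by rewrite -mlen_eq0 mlen_munit. Qed.

Lemma chi0_munit i : chi 0 (tX (munit i)) = 0.
Proof. exact/chiX_neq/munit_neq0. Qed.

Lemma chi_munit0 i : chi (munit i) (tX 0) = 0.
Proof. by apply: chiX_neq; rewrite eq_sym munit_neq0. Qed.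

Lemma contract_prod2 (f : dtree -> R) z w : (forall a b, f (a ** b) = f a * f b) ->
  contract f (prod2 z w) = prodT (contract f z) (contract f w).
Proof.
move=> fM; rewrite mul2E mulTE !contractE; apply: lext_convol => -[a1 a2] [b1 b2] _ _ /=.
by rewrite convolZl convolZr convolU fM scalerA.
Qed.

Lemma contract_prod2_deriv (f g : dtree -> R) z w :
  (forall a b, f (a ** b) = f a * g b + g a * f b) ->
  contract f (prod2 z w) =
  prodT (contract f z) (contract g w) + prodT (contract g z) (contract f w).
Proof.
move=> fM; rewrite mul2E !mulTE !contractE.
apply: (@lext_convol_deriv R _ (@tmul2 d L) _ (@tmul d L) (fun p => f p.2 *: <[p.1]>)
  (fun p => g p.2 *: <[p.1]>)) => -[a1 a2] [b1 b2] /=.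
rewrite fM scalerDl; apply: f_equal2; exact/esym/convolZU.
Qed.

Lemma contract_DeltaX1 (f : dtree -> R) i : contract f (DeltaX R L (munit i)) =
  f (tX 0) *: <[tX (munit i)]> + f (tX (munit i)) *: <[tX 0]>.
Proof.
rewrite DeltaX1; move: (tX (munit i)) (tX 0) => a b.
by rewrite linearD /= !contractU.
Qed.

Lemma contract_plantL (f : dtree -> R) l k z :
  contract f (plantL l k z) = lext (fun a => <[plant l k a]>) (contract f z).
Proof.
rewrite plantL.unlock !contractE !lext_lext; apply: eq_lext => -[a b] _ /=.
by rewrite lextU linearZ /= lextU.
Qed.

Lemma contract_Taylor (f : dtree -> R) l k a : (forall l k b, f (plant l k b) = 0) ->
  contract f (Taylor h l k a) = 0.
Proof.
move=> f0; have [s [_ _ ->]] := TaylorE h l k a.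
rewrite linear_sum big1 // => j _; rewrite linearZ /= contractU f0.
by rewrite scale0r scaler0.
Qed.

Lemma chi_plant n l k b : chi n (plant l k b) = 0.
Proof. by rewrite /chi rootb_plant andbF. Qed.

(** The counit property: [chi 0] does not see the Taylor terms, whose right factors are planted. *)
Lemma contract_chi0_Dl a : contract (chi 0) (Dl a) = <[a]>.
Proof.
elim/dtree_ind: a => [n|o|a b IHa IHb|l k a IH].
- rewrite DlX; elim/mindex_ind: n => [|i|n k IHn IHk].
  + by rewrite DeltaX0 contractU chiXX scale1r.
  + by rewrite contract_DeltaX1 chiXX chi0_munit scale1r scale0r addr0.
  + by rewrite DeltaXD contract_prod2 ?IHn ?IHk ?mulTU ?tX_add //; exact: chi0M.
- by rewrite DlO contractU chiXX scale1r.
- by rewrite DlM contract_prod2 ?IHa ?IHb ?mulTU //; exact: chi0M.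
by rewrite DlP linearD /= contract_Taylor ?addr0 ?contract_plantL ?IH ?lextU //; exact: chi_plant.
Qed.

Lemma lext_prod2 (f : dtree * dtree -> TT) z w :
  (forall p q, f (tmul2 p q) = prod2 (f p) (f q)) ->
  lext f (prod2 z w) = prod2 (lext f z) (lext f w).
Proof.
move=> fM; rewrite !mul2E; apply: lext_convol => p q _ _.
by rewrite fM mul2E.
Qed.

Lemma ThetaM a b : Theta (a ** b) = prod2 (Theta a) (Theta b).
Proof.
rewrite Theta.unlock DlM; apply: lext_prod2 => -[p1 p2] [q1 q2] /=.
rewrite rootb_tmul_nil; case: (rootb p2 == _); case: (rootb q2 == _) => /=.
- by rewrite mul2U.
- by rewrite mul2E convol0r.
- by rewrite mul2E convol0l.
- by rewrite mul2E convol0l.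
Qed.

Lemma ThetaX n : Theta (tX n) = DeltaX R L n.
Proof.
rewrite Theta.unlock DlX -[RHS]lext_id; apply: eq_lext => p.
move=> /(@supp_in_DeltaX R d L n)[i [j [-> _]]] /=.
by rewrite rootb_tX.
Qed.

Lemma ThetaO o : Theta (tO o) = <[(tO o, tX 0)]>.
Proof. by rewrite Theta.unlock DlO lextU /= rootb_tX. Qed.

(** The right factors of the Taylor terms are planted, so Theta drops them and commutes with
    planting. *)
Lemma ThetaP l k a : Theta (plant l k a) = plantL l k (Theta a).
Proof.
rewrite Theta.unlock DlP linearD /= plantL.unlock !lext_lext.
rewrite [X in _ + X](_ : _ = 0) ?addr0; last first.
  have [s [_ _ ->]] := TaylorE h l k a; rewrite linear_sum big1 // => j _.
  by rewrite linearZ /= lextU /= rootb_plant scaler0.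
apply: eq_lext => -[b c] _ /=; rewrite lextU /=.
by case: ifP => _; rewrite ?lextU ?lext0.
Qed.

Lemma Theta_supp a : supp_in (fun p => (exists j, p.2 = tX j) /\ p \in msupp (Dl a)) (Theta a).
Proof.
have : supp_in (fun p => rooto p.2 = 0 /\ p \in msupp (Dl a)) (Dl a : TT).
  by move=> p pa; have [_ ?] := Dl_rooto pa.
rewrite Theta.unlock => H; apply: supp_in_lext H _ => -[b c] /= [o0 bc].
case: eqP => [rb|_]; last exact: supp_in0.
apply: supp_inU; split=> //=; exists (rootn c).
by rewrite {1}(root_decomp c) rb big_nil o0 Monoid.mulm1; exact: tmul1.
Qed.

Lemma contract_Theta n a : contract (chi n) (Theta a) = contract (chi n) (Dl a).
Proof.
rewrite Theta.unlock !contractE lext_lext; apply: eq_lext => -[b c] _ /=.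
case: eqP => [rb|/eqP/negbTE rb]; first by rewrite lextU.
by rewrite lext0 /chi rb andbF scale0r.
Qed.

Local Notation pd := (pd h).
Local Notation lftd := (lftd h).

Lemma pdE i a : pd i a = contract (chi (munit i)) (Theta a).
Proof. by rewrite pd.unlock. Qed.
Lemma lftdE i z : lftd i z = lext (fun p => tens (pd i p.1) <[p.2]>) z.
Proof. by rewrite lftd.unlock. Qed.
Lemma rgtdE i z : rgtd i z = lext (fun p => tens <[p.1]> (lowX R L i (rootn p.2))) z.
Proof. by rewrite rgtd.unlock. Qed.

Lemma contract_chi0_Theta a : contract (chi 0) (Theta a) = <[a]>.
Proof. by rewrite contract_Theta contract_chi0_Dl. Qed.

Lemma pdM i a b : pd i (a ** b) = prodT (pd i a) <[b]> + prodT <[a]> (pd i b).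
Proof.
rewrite !pdE ThetaM (@contract_prod2_deriv _ (chi 0)) ?contract_chi0_Theta //.
exact: chi1M.
Qed.

Lemma pdO i o : pd i (tO o) = 0.
Proof.
by rewrite pdE ThetaO contractU chi_munit0 scale0r.
Qed.

Lemma pdP i l k a : pd i (plant l k a) = lext (fun b => <[plant l k b]>) (pd i a).
Proof. by rewrite !pdE ThetaP contract_plantL. Qed.

Local Notation lowX := (lowX R L).

Lemma lowXE i n : lowX i n = (n i)%:R *: <[tX (msub n (munit i))]>.
Proof. by rewrite lowX.unlock. Qed.

Lemma munitE (i j : 'I_d) : munit i j = (j == i).
Proof. by rewrite ffunE. Qed.

(** One half of the Leibniz rule. The factor n_i makes the truncated subtraction harmless: for n_i >
    0 the exponents agree, and otherwise both sides vanish. *)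
Lemma lowX_half i n k : (n i)%:R *: <[tX (msub (n + k) (munit i))]> =
  prodT (lowX i n) <[tX k]> :> T.
Proof.
rewrite lowXE mulTE convolZl convolU -tX_add.
have [->|ni] := eqVneq (n i) 0%N; first by rewrite !scale0r.
congr (_ *: <[tX _]>); apply/ffunP => j; rewrite !ffunE.
by case: (eqVneq j i) ni => [->|_] /=; lia.
Qed.

Lemma lowXD i n k : lowX i (n + k) = prodT (lowX i n) <[tX k]> + prodT <[tX n]> (lowX i k).
Proof.
have h1 := lowX_half i n k; have h2 := lowX_half i k n.
by rewrite lowXE ffunE natrD scalerDl (mulTC _ (lowX i k)) -h1 -h2 [k + n]addrC.
Qed.

Lemma lowX0 (i : 'I_d) : lowX i (0 : mindex d) = 0. Proof. by rewrite lowXE ffunE scale0r. Qed.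

Lemma lowX_munit i (j : 'I_d) : lowX i (munit j) = (i == j)%:R *: <[tX 0]>.
Proof.
rewrite lowXE munitE; case: eqP => [->|_]; last by rewrite !scale0r.
congr (_ *: <[tX _]>); apply/ffunP => x; rewrite !ffunE; exact: subnn.
Qed.

Lemma munit_eq (i j : 'I_d) : (munit j == munit i :> mindex d) = (j == i).
Proof.
apply/eqP/eqP => [e|->//].
by have := congr1 (fun n : mindex d => n i) e; rewrite !munitE eqxx; case: eqP.
Qed.

Lemma pdX i n : pd i (tX n) = lowX i n.
Proof.
elim/mindex_ind: n => [|j|n k IHn IHk].
- by rewrite -[tX 0]/(tO 0) pdO lowX0.
- rewrite pdE ThetaX contract_DeltaX1 chi_munit0 chi_tX lowX_munit.
  by rewrite munit_eq [j == i]eq_sym scale0r add0r.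
by rewrite tX_add pdM IHn IHk lowXD.
Qed.

Lemma lftdU i a b : lftd i <[(a, b)]> = tens (pd i a) <[b]>.
Proof. by rewrite lftdE lextU. Qed.
Lemma rgtdU i a b : rgtd i <[(a, b)]> = tens <[a]> (lowX i (rootn b)).
Proof. by rewrite rgtdE lextU. Qed.
Lemma lftdD i z w : lftd i (z + w) = lftd i z + lftd i w.
Proof. by rewrite !lftdE linearD. Qed.
Lemma rgtdD i z w : rgtd i (z + w) = rgtd i z + rgtd i w.
Proof. by rewrite !rgtdE linearD. Qed.

Definition polyr z := supp_in (fun p : dtree * dtree => exists j, p.2 = tX j) z.

Lemma prod2_tensU u v a b :
  prod2 (tens u v) <[(a, b)]> = tens (prodT u <[a]>) (prodT v <[b]>).
Proof.
rewrite mul2C mul2Ul tensE lext_lext2 !(mulTC _ <[_]>) !mulTUl tensE lext2_lext.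
by apply: eq_lext2 => x y _ _; rewrite lextU lext2U.
Qed.

Lemma prod2_tensU_r u v a b :
  prod2 <[(a, b)]> (tens u v) = tens (prodT u <[a]>) (prodT v <[b]>).
Proof. by rewrite mul2C prod2_tensU. Qed.

Lemma lext_prod2_deriv (f : dtree * dtree -> TT) z w :
  (forall p q, p \in msupp z -> q \in msupp w ->
     f (tmul2 p q) = prod2 (f p) <[q]> + prod2 <[p]> (f q)) ->
  lext f (prod2 z w) = prod2 (lext f z) w + prod2 z (lext f w).
Proof.
move=> fM; have E1 : prod2 (lext f z) w = lext2 (fun p q => prod2 (f p) <[q]>) z w.
  rewrite mul2E /convol lext2_lextl; apply: eq_lext2 => p q _ _.
  by rewrite mul2E /convol lext2Ur.
have E2 : prod2 z (lext f w) = lext2 (fun p q => prod2 <[p]> (f q)) z w.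
  rewrite mul2E /convol lext2_lextr; apply: eq_lext2 => p q _ _.
  exact/esym/mul2Ul.
rewrite E1 E2 -lext2Df mul2E /convol lext_lext2; apply: eq_lext2 => p q pz qw.
by rewrite lextU; exact: fM.
Qed.

Lemma lftd_prod2 i z w : lftd i (prod2 z w) = prod2 (lftd i z) w + prod2 z (lftd i w).
Proof.
rewrite !lftdE; apply: lext_prod2_deriv => -[p1 p2] [q1 q2] _ _.
rewrite /= pdM tensDl prod2_tensU_r; apply: f_equal2.
  by rewrite prod2_tensU mulTU.
by rewrite (mulTC <[p1]>) mulTU (tmulC q2).
Qed.

Lemma rgtd_prod2 i z w : polyr z -> polyr w ->
  rgtd i (prod2 z w) = prod2 (rgtd i z) w + prod2 z (rgtd i w).
Proof.
move=> pz pw; rewrite !rgtdE; apply: lext_prod2_deriv => -[p1 p2] [q1 q2] /pz[/= j ->] /pw[/= k ->].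
rewrite /= -tX_add !rootn_tX lowXD tensDr prod2_tensU_r; apply: f_equal2.
  by rewrite prod2_tensU mulTU.
by rewrite (mulTC <[tX j]>) mulTU (tmulC q1).
Qed.

Lemma polyr_Theta a : polyr (Theta a).
Proof. by apply: supp_in_sub (@Theta_supp a) _ => p []. Qed.

Lemma lftd_ThetaO i o : lftd i (Theta (tO o)) = rgtd i (Theta (tO o)).
Proof. by rewrite ThetaO lftdU rgtdU pdO rootn_tX lowX0 tens0l tens0r. Qed.

Lemma lftd_ThetaM i a b : lftd i (Theta a) = rgtd i (Theta a) ->
  lftd i (Theta b) = rgtd i (Theta b) -> lftd i (Theta (a ** b)) = rgtd i (Theta (a ** b)).
Proof.
by move=> IHa IHb; rewrite ThetaM lftd_prod2 rgtd_prod2 ?IHa ?IHb //; exact: polyr_Theta.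
Qed.

(* Coassociativity of [Theta], at first order in the middle factor. *)
Lemma lftd_Theta i a : lftd i (Theta a) = rgtd i (Theta a).
Proof.
elim/dtree_ind: a => [n|o|a b IHa IHb|l k a IH].
- elim/mindex_ind: n => [|j|n k IHn IHk].
  + exact: (lftd_ThetaO i 0).
  + rewrite ThetaX DeltaX1 lftdD rgtdD !lftdU !rgtdU !pdX !rootn_tX !lowX_munit lowX0.
    by rewrite tens0l tens0r addr0 add0r tensZl tensZr.
  + by rewrite tX_add; exact: lftd_ThetaM.
- exact: lftd_ThetaO.
- exact: lftd_ThetaM.
rewrite ThetaP.
have el z : lftd i (plantL l k z) = plantL l k (lftd i z).
  rewrite !lftdE plantL.unlock !lext_lext; apply: eq_lext => -[b c] _ /=.
  by rewrite lextU /= pdP !tensE lext2_lextl lext_lext2; apply: eq_lext2 => *; rewrite !lextU.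
have er z : rgtd i (plantL l k z) = plantL l k (rgtd i z).
  rewrite !rgtdE plantL.unlock !lext_lext; apply: eq_lext => -[b c] _ /=.
  by rewrite lextU /= !tensE !lext2Ul lext_lext; apply: eq_lext => *; rewrite lextU.
by rewrite el er IH.
Qed.

Lemma recSE z : recS z = lext (fun p => (-1) ^+ mlen (rootn p.2) *: <[tX (rootn p.2) ** p.1]>) z.
Proof. by rewrite recS.unlock. Qed.

Lemma recS_tensUr u c : recS (tens u <[c]>) =
  (-1) ^+ mlen (rootn c) *: prodT <[tX (rootn c)]> u.
Proof.
rewrite recSE tensE lext2Ur lext_lext mulTUl -lextZf.
by apply: eq_lext => b _; rewrite lextU.
Qed.

Lemma recS_tensU b n : recS (tens <[b]> <[tX n]> : TT) = (-1) ^+ mlen n *: <[tX n ** b]>.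
Proof. by rewrite recS_tensUr rootn_tX mulTU. Qed.

Lemma recSZ (c : R) z : recS (c *: z) = c *: recS z.
Proof. by rewrite !recSE linearZ. Qed.

(** Lowering the exponent by one unit flips the sign (-1)^|n|; this is where the minus sign of
    [pd_recS] comes from. *)
Lemma recS_lowX i b n :
  recS (tens <[b]> (lowX i n)) = - ((-1) ^+ mlen n *: prodT (lowX i n) <[b]>).
Proof.
rewrite lowXE tensZr recSZ recS_tensU (mulTC _ <[b]>).
rewrite [prodT _ _](_ : _ = (n i)%:R *: <[tX (msub n (munit i)) ** b]>); last first.
  by rewrite mulTC mulTE convolZl convolU.
have [->|ni] := eqVneq (n i) 0%N; first by rewrite !scale0r scaler0 oppr0.
have nE : munit i + msub n (munit i) = n.
  apply/ffunP => j; rewrite !ffunE.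
  by case: (eqVneq j i) ni => [->|_] /=; lia.
have mE : mlen n = (mlen (msub n (munit i))).+1 by rewrite -{1}nE mlenD mlen_munit.
by rewrite mE exprS mulN1r scaleNr opprK !scalerA mulrC.
Qed.

Lemma recS_linear : linear (@recS R d L).
Proof. by move=> c z w; rewrite !recSE; exact: lext_linear. Qed.
Lemma lftd_linear i : linear (lftd i).
Proof. by move=> c z w; rewrite !lftdE; exact: lext_linear. Qed.
Lemma rgtd_linear i : linear (@rgtd R d L i).
Proof. by move=> c z w; rewrite !rgtdE; exact: lext_linear. Qed.

HB.instance Definition _ := GRing.isLinear.Build R TT T *:%R (@recS R d L) recS_linear.
HB.instance Definition _ i := GRing.isLinear.Build R TT TT *:%R (lftd i) (lftd_linear i).
HB.instance Definition _ i := GRing.isLinear.Build R TT TT *:%R (@rgtd R d L i) (rgtd_linear i).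
Let recS_lin : {linear TT -> T} := @recS R d L.
Let lftd_lin i : {linear TT -> TT} := lftd i.
Let rgtd_lin i : {linear TT -> TT} := @rgtd R d L i.

Lemma recSU b c : recS <[(b, c)]> = (-1) ^+ mlen (rootn c) *: <[tX (rootn c) ** b]> :> T.
Proof. by rewrite recSE lextU. Qed.
Lemma lextZU (f : dtree -> T) (r : R) a : lext f (r *: <[a]>) = r *: f a.
Proof. by rewrite linearZ /= lextU. Qed.

(** The Leibniz rule for (-X)^n b. For z = Theta a the two terms cancel by [lftd_Theta], which is
    the invariance of [recenter a]. *)
Lemma pd_recS i z : lext (pd i) (recS z) = recS (lftd i z) - recS (rgtd i z).
Proof.
move: z; apply: (@eq_linear _ _ _ (lext (pd i) \o recS_lin)
  ((recS_lin \o lftd_lin i) \- (recS_lin \o rgtd_lin i))) => -[b c].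
rewrite /= recSU lextZU pdM pdX scalerDr addrC; apply: f_equal2.
  by rewrite lftdU recS_tensUr.
by rewrite rgtdU recS_lowX opprK.
Qed.

Definition recenter a : T := recS (Theta a).

Lemma pd_recenter i a : lext (pd i) (recenter a) = 0.
Proof. by rewrite pd_recS lftd_Theta subrr. Qed.

Let contract_lin (f : dtree -> R) : {linear TT -> T} := contract f.
Let pd_lin i : {linear T -> T} := lext (pd i).

Lemma contract_tensU (f : dtree -> R) u b : contract f (tens u <[b]>) = f b *: u.
Proof. by rewrite contractE tensE lext2Ur lext_lext -[in RHS](lext_id u) -lextZf; apply: eq_lext => a _; rewrite lextU. Qed.

Lemma contract_lftd (f : dtree -> R) i z : contract f (lftd i z) = lext (pd i) (contract f z).
Proof.
move: z; apply: (@eq_linear _ _ _ (contract_lin f \o lftd_lin i) (pd_lin i \o contract_lin f)) => -[b c].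
by rewrite /= lftdU contract_tensU contractU lextZU.
Qed.

(** X^k arises only as the derivative of X^(k + e_i), with factor k_i + 1. *)
Lemma contract_rgtd k i z : polyr z ->
  contract (chi k) (rgtd i z) = (k i).+1%:R *: contract (chi (k + munit i)) z.
Proof.
move=> pz; apply: (@eq_linear_supp _ _ _ (contract_lin (chi k) \o rgtd_lin i)
  ((k i).+1%:R \*: contract_lin (chi (k + munit i)))) => -[b c] /pz[/= n ->].
rewrite rgtdU contractU chi_tX rootn_tX lowXE tensZr linearZ /= contract_tensU chi_tX.
rewrite !scalerA -!natrM; apply: (congr1 (fun x : nat => x%:R *: <[b]>)).
have [->|ni] := eqVneq n (k + munit i).
  have -> : (k + munit i) i = (k i).+1 by rewrite !ffunE eqxx; exact: addn1.
  suff -> : msub (k + munit i) (munit i) = k by rewrite !eqxx.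
  by apply/ffunP => j; rewrite !ffunE; exact: addnK.
rewrite muln0; have [->//|n0] := eqVneq (n i) 0%N; apply/eqP; rewrite muln_eq0 (negbTE n0) /= eqb0.
apply: contra ni => /eqP <-; apply/eqP/ffunP => j; rewrite !ffunE.
by case: (eqVneq j i) n0 => [->|_] /=; lia.
Qed.

Lemma pd_Theta_coef k i a : lext (pd i) (contract (chi k) (Theta a)) =
  (k i).+1%:R *: contract (chi (k + munit i)) (Theta a).
Proof. by rewrite -contract_lftd lftd_Theta contract_rgtd //; exact: polyr_Theta. Qed.

(* [Thc k u] is the coefficient of [X^k] in [Theta u]; by [pd_Thc] all of them vanish for k != 0
   as soon as the first order ones do. *)
Definition Thc k u : T := lext (fun a => contract (chi k) (Theta a)) u.

Lemma pd_Thc k i u : lext (pd i) (Thc k u) = (k i).+1%:R *: Thc (k + munit i) u.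
Proof.
rewrite /Thc lext_lext -lextZf; apply: eq_lext => a _; exact: pd_Theta_coef.
Qed.

Lemma Thc0 u : Thc 0 u = u.
Proof. by rewrite /Thc -[RHS]lext_id; apply: eq_lext => a _; exact: contract_chi0_Theta. Qed.

(** Induction on |k|: the derivative of the coefficient at k - e_i is a nonzero multiple of the one
    at k. The induction starts at k = e_i, where the coefficient at 0 is u itself. *)
Lemma Thc_eq0 u : (forall i, lext (pd i) u = 0) -> forall k, k != 0 -> Thc k u = 0.
Proof.
move=> u0 k; have [N] := ubnP (mlen k); elim: N k => // N IH k kN k0.
have [i ki] : exists i, k i != 0%N.
  apply/existsP; apply: contraNT k0 => /existsPn nk; apply/eqP/ffunP => i.
  by rewrite ffunE; apply/eqP; move: (nk i); rewrite negbK.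
pose k' := msub k (munit i).
have kE : k = k' + munit i.
  apply/ffunP => j; rewrite !ffunE.
  by case: (eqVneq j i) ki => [->|_] /=; lia.
have : lext (pd i) (Thc k' u) = 0.
  have [->|k'0] := eqVneq k' 0; first by rewrite Thc0.
  rewrite IH ?linear0 //; move: kN; rewrite {1}kE mlenD mlen_munit addn1 ltnS.
  by [].
rewrite pd_Thc -kE => /eqP; rewrite scaler_eq0 pnatr_eq0 /= => /eqP.
by [].
Qed.

Lemma recenter_coef a k : k != 0 -> contract (chi k) (lext Dl (recenter a)) = 0.
Proof.
move=> k0; have <- : Thc k (recenter a) = contract (chi k) (lext Dl (recenter a)).
  rewrite /Thc contractE lext_lext; apply: eq_lext => b _.
  by rewrite -contractE contract_Theta.
apply: Thc_eq0 k0 => i; exact: pd_recenter.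
Qed.

(** The terms of [recenter a] with j = 0 add up to a, by the counit property. *)
Lemma recenter_tri a : supp_in (fun b => exists j c,
    [/\ j != 0, b = tX j ** c & (c, tX j) \in msupp (Theta a)])
  (recenter a - <[a]>).
Proof.
rewrite -(contract_chi0_Theta a) /recenter recSE contractE -scaleN1r -lextZf -lextDf.
have : supp_in (fun p => p \in msupp (Theta a)) (Theta a) by [].
move=> H; apply: supp_in_lext H _ => -[c b] cb.
have [/= j bE] := polyr_Theta cb; subst b.
rewrite /= rootn_tX chi_tX; have [->|j0] := eqVneq j 0.
  by rewrite mlen0 expr0 !scale1r tmul1 scaleN1r subrr; exact: supp_in0.
rewrite scale0r scaler0 addr0; apply: supp_inZ; apply: supp_inU.
by exists j, c.
Qed.

Lemma recenter_tX0 : recenter (tX 0) = <[tX 0]>.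
Proof.
by rewrite /recenter -[tX 0]/(tO 0) ThetaO recSE lextU /= rootn_tX mlen0 expr0 scale1r tmul1.
Qed.

Definition ntot a : int := weight 1 (fun=> 0) (fun=> 0) a.

Lemma ntot_tmul a b : ntot (a ** b) = ntot a + ntot b.
Proof. by rewrite /ntot weight_tmul // => *; rewrite addr0. Qed.
Lemma ntot_tX n : ntot (tX n) = (mlen n)%:Z.
Proof. by rewrite /ntot weight_tX ?addr0 // -natz. Qed.
Lemma ntot_tO o : ntot (tO o) = 0.
Proof. by rewrite /ntot weight_tO. Qed.
Lemma ntot_plant l k a : ntot (plant l k a) = ntot a.
Proof. by rewrite /ntot weight_plant ?add0r. Qed.

Lemma ntot_ge0 a : 0 <= ntot a.
Proof.
elim/dtree_ind: a => [n|o|a b IHa IHb|l k a IH].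
- by rewrite ntot_tX.
- by rewrite ntot_tO.
- by rewrite ntot_tmul addr_ge0.
- by rewrite ntot_plant.
Qed.

Lemma ntot_rootn a : (mlen (rootn a))%:Z <= ntot a.
Proof.
rewrite {2}(root_decomp a) !ntot_tmul ntot_tO ntot_tX add0r.
by rewrite lerDl ntot_ge0.
Qed.

(** Delta does not conserve n-decorations, since its Taylor terms create X^j; Theta has no such
    terms. *)
Lemma Theta_ntot a : supp_in (fun p => ntot p.1 + ntot p.2 = ntot a) (Theta a).
Proof.
elim/dtree_ind: a => [n|o|a b IHa IHb|l k a IH].
- rewrite ThetaX; apply: supp_in_sub (@supp_in_DeltaX _ _ _ n) _ => _ [i [j [-> <-]]].
  by rewrite /= !ntot_tX mlenD PoszD.
- by rewrite ThetaO; apply: supp_inU; rewrite /= ntot_tO ntot_tX mlen0.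
- rewrite ThetaM; apply: (supp_in_mul2 IHa IHb) => p q /= pa qb.
  by rewrite !ntot_tmul -pa -qb addrACA.
by rewrite ThetaP; apply: supp_in_plantL IH _ => a1 b1 /= e; rewrite !ntot_plant.
Qed.

End TranslationInvariance.

(** * Finiteness below a homogeneity *)

Section ContractionWeights.
Variables (R : realType) (d : nat) (L : finType) (h : L -> R).
Local Notation label := (L * mindex d)%type.
Local Notation odeco := ({ffun 'I_d -> int} * {ffun L -> int})%type.
Local Notation mtree := (mtree d L).
Local Notation mbranch := (label * option (mindex d) * mtree)%type.
Implicit Types (m : mtree) (n k : mindex d).

Lemma rweight_underlying (V : zmodType) al (g : odeco -> V) ed n nS (s : seq mbranch) :
  g 0 = 0 ->
  rweight al g ed (underlying (MNode n nS s)) =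
  al *+ mlen n + \sum_(x <- s) (ed x.1.1 + rweight al g ed (underlying x.2)).
Proof. by move=> g0; rewrite [underlying _]/= rweight_Node big_map g0 addr0. Qed.

(** The o-decoration of a contracted node records the n_S, the e_S and the edges of S, so a weight
    that values o-decorations like what they stand for does not change under contraction. *)
Lemma weight_contr (V : zmodType) al (g : odeco -> V) ed :
  (forall o o', g (o + o') = g o + g o') ->
  (forall l k j, ed (l, k + j) = ed (l, k) - al *+ mlen j) ->
  (forall k, g (oX L k) = al *+ mlen k) -> (forall x, g (oedge x) = ed x) ->
  forall m top, admissible_at h top m -> weight al g ed (cls_contr m) = rweight al g ed (underlying m).
Proof.
move=> gD edD gX gE; have g0 : g 0 = 0 by apply: (addIr (g 0)); rewrite -gD !add0r.
elim/mtree_ind' => n nS s IH top; rewrite admissible_MNode => /and3P[nn _ adm].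
rewrite cls_contr_MNode rweight_underlying // !weight_tmul // weight_tO // weight_tX // gX.
rewrite addrC; apply: f_equal2.
  rewrite -mulrnDr; congr (_ *+ _).
  rewrite -(mlenD nS); congr mlen; apply/ffunP => i; rewrite !ffunE.
  by apply: subnKC; move/forallP: nn.
elim: s IH adm => [|x s IHs] H.
  by move=> _; rewrite !big_nil weight_tX // mlen0 mulr0n.
move=> /= /andP[ax /(IHs _) {}IHs]; inversion H as [|? ? Hx Hs]; subst.
rewrite !big_cons weight_tmul // IHs //; congr (_ + _).
rewrite -(Hx _ ax) /contr_branch; case: x.1.2 => [eS|]; rewrite weight_tmul // weight_tO //.
  rewrite weight_plant // edD gX addrA; congr (_ + _).
  by rewrite addrC subrK; case: (x.1.1).
by rewrite gE.
Qed.

Lemma ohom_oX k : ohom h (oX L k) = (mlen k)%:R.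
Proof.
rewrite /ohom /= [X in _ + X]big1 ?addr0; last first.
  by move=> t _; rewrite ffunE mul0r.
by rewrite rmorph_sum natr_sum; apply: eq_bigr => i _; rewrite ffunE.
Qed.

Lemma ohom_oedge (x : label) : ohom h (oedge x) = h x.1 - (mlen x.2)%:R.
Proof.
rewrite /ohom /= (bigD1 x.1) //= [X in _ + (_ + X)]big1; last first.
  by move=> t tx; rewrite ffunE (negbTE tx) mul0r.
rewrite ffunE eqxx mul1r addr0 addrC; congr (_ + _).
by rewrite rmorph_sum natr_sum -sumrN; apply: eq_bigr => i _; rewrite ffunE rmorphN.
Qed.

Lemma thom_contr m top : admissible_at h top m -> thom h (cls_contr m) = rhom h (underlying m).
Proof.
move=> am; rewrite thom_weight (weight_contr (@ohomD R d L h) _ _ _ am) //.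
- by move=> l k j /=; rewrite mlenD natrD opprD addrA.
- exact: ohom_oX.
exact: ohom_oedge.
Qed.

End ContractionWeights.

Section Finiteness.
Variables (R : realType) (d : nat) (L : finType) (h : L -> R).
Local Notation label := (L * mindex d)%type.
Local Notation mtree := (mtree d L).
Local Notation mbranch := (label * option (mindex d) * mtree)%type.
Variable rule : L -> set {mset label}%mset.
Implicit Types (m : mtree) (n k : mindex d).

Lemma finite_mlen_le (N : nat) : finite_set [set n : mindex d | (mlen n <= N)%N].
Proof.
apply: sub_finite_set (@finite_mlen_lt R d (N.+1%:R)) => n /= nN.
by rewrite ltr_nat ltnS.
Qed.

Lemma finite_bounded_seq (T : Type) (A : set T) (N : nat) : finite_set A ->
  finite_set [set s : seq T | (size s <= N)%N /\ List.Forall A s].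
Proof.
move=> finA; elim: N => [|N IH].
  by apply: (sub_finite_set _ (finite_set1 ([::] : seq T))) => -[|x s] [].
apply: sub_finite_set (_ : finite_set ([set [::]] `|` [set x :: s | x in A & s in
    [set s : seq T | (size s <= N)%N /\ List.Forall A s]])).
  move=> [|x s] [/= sN H]; first by left.
  by right; inversion H; subst; exists x => //; exists s.
by rewrite finite_setU; split; [exact: finite_set1|exact: finite_image2].
Qed.

Definition olen (e : option (mindex d)) : nat := if e is Some k then mlen k else 0%N.

(** A size with finite sublevel sets: it counts the nodes, the edges and all the decorations of the
    marked tree. *)
Fixpoint msize m : nat :=
  let: MNode n nS s := m in
  (1 + mlen n + mlen nS + foldr (fun x a => 1 + mlen x.1.1.2 + olen x.1.2 + msize x.2 + a) 0 s)%N.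

Lemma msize_MNode n nS (s : seq mbranch) : msize (MNode n nS s) =
  (1 + mlen n + mlen nS + \sum_(x <- s) (1 + mlen x.1.1.2 + olen x.1.2 + msize x.2))%N.
Proof. by rewrite /=; congr addn; elim: s => [|x s IH]; rewrite ?big_nil ?big_cons //= IH. Qed.

(** Each branch has size at least 1, and the root itself counts 1; hence a tree of size at most N +
    1 has at most N branches, whose data are all bounded by N. *)
Lemma finite_msize (N : nat) : finite_set [set m | (msize m <= N)%N].
Proof.
elim: N => [|N IH]; first by apply: sub_finite_set (@finite_set0 _) => -[].
pose K := [set n : mindex d | (mlen n <= N)%N].
have finK : finite_set K by exact: finite_mlen_le.
have finO : finite_set [set e : option (mindex d) | (olen e <= N)%N].
  apply: sub_finite_set (_ : finite_set ([set None] `|` [set Some k | k in K])).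
    by move=> [k|] kN; [right; exists k|left].
  by rewrite finite_setU; split; [exact: finite_set1|exact: finite_image].
pose A : set mbranch := [set (x, m) | x in [set (y, e) | y in [set (l, k) | l in [set: L] & k in K]
  & e in [set e : option (mindex d) | (olen e <= N)%N]] & m in [set m | (msize m <= N)%N]].
have finA : finite_set A.
  by apply: finite_image2 => //; apply: finite_image2 => //; apply: finite_image2.
apply: sub_finite_set (_ : finite_set [set MNode p.1 p.2 s | p in K `*` K
    & s in [set s : seq mbranch | (size s <= N)%N /\ List.Forall A s]]).
  move=> [n nS s]; rewrite /= -/(msize (MNode n nS s)) msize_MNode => mN.
  exists (n, nS); first by split=> /=; rewrite /K /=; lia.
  exists s => //; have {mN} : (\sum_(x <- s) (1 + mlen x.1.1.2 + olen x.1.2 + msize x.2) <= N)%N by lia.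
  have szs (r : seq mbranch) :
      (size r <= \sum_(x <- r) (1 + mlen x.1.1.2 + olen x.1.2 + msize x.2))%N.
    by elim: r => //= x r IHr; rewrite big_cons; lia.
  elim: s => [|x s IHs]; first by split=> //; constructor.
  rewrite big_cons => sN; have [] := IHs _; first by lia.
  move=> ss As; split; first by rewrite /=; move: (szs s); lia.
  constructor => //; case: x sN => [[[l k] e] m] /= sN.
  exists (l, k, e); last by exists m => //=; lia.
  exists (l, k); last by exists e => //=; lia.
  by exists l => //; exists k => //; rewrite /K /=; lia.
apply: finite_image2; first exact: finite_setX.
exact: finite_bounded_seq.
Qed.

Local Notation uw al ed m := (rweight al (fun=> 0) ed (underlying m)).

Lemma uwE (al : R) (ed : label -> R) n nS (s : seq mbranch) : uw al ed (MNode n nS s) =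
  al *+ mlen n + \sum_(x <- s) (ed x.1.1 + uw al ed x.2).
Proof. exact: rweight_underlying. Qed.

Lemma rhom_underlying m : rhom h (underlying m) = uw 1 (fun x : label => h x.1 - (mlen x.2)%:R) m.
Proof.
elim/mtree_ind': m => n nS s IH; rewrite uwE.
rewrite -[LHS]/(rweight 1 (ohom h) (fun x : label => h x.1 - (mlen x.2)%:R) (underlying (MNode n nS s))).
rewrite rweight_underlying; last first.
  by rewrite /ohom !big1 ?add0r // => i _; rewrite ffunE ?mul0r.
congr (_ + _); elim: s IH => [|x s IHs] H; first by rewrite !big_nil.
by inversion H as [|? ? Hx Hs]; subst; rewrite !big_cons -Hx IHs.
Qed.

(** Weights are sums over units of n-decoration and over edges, so a linear inequality between them
    is checked on one unit and on one edge. *)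
Lemma uw_le (a a' b b' : R) (e e' f f' : label -> R) m (r t : R) :
  a + r * a' <= b + t * b' -> (forall x, e x + r * e' x <= f x + t * f' x) ->
  uw a e m + r * uw a' e' m <= uw b f m + t * uw b' f' m.
Proof.
move=> ab ef; elim/mtree_ind': m => n nS s IH; rewrite !uwE.
rewrite !mulrDr !mulrnAr addrACA [leRHS]addrACA; apply: lerD.
  by rewrite -!mulrnDl; apply: ler_wMn2r.
elim: s IH => [|x s IHs] H; first by rewrite !big_nil !mulr0.
inversion H as [|? ? Hx Hs]; subst; rewrite !big_cons; move: (ef x.1.1) Hx (IHs Hs).
by rewrite !mulrDr; lra.
Qed.

Lemma uwZ (r a : R) (e : label -> R) m : uw (r * a) (fun x => r * e x) m = r * uw a e m.
Proof.
elim/mtree_ind': m => n nS s IH; rewrite !uwE mulrDr mulrnAr; congr (_ + _).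
elim: s IH => [|x s IHs] Hs; first by rewrite !big_nil mulr0.
by inversion Hs as [|? ? Hx Hs']; subst; rewrite !big_cons !mulrDr Hx IHs.
Qed.

Lemma uw_ge0 (a : R) (e : label -> R) m : 0 <= a -> (forall x, 0 <= e x) -> 0 <= uw a e m.
Proof.
move=> a0 e0; elim/mtree_ind': m => n nS s IH; rewrite uwE; apply: addr_ge0.
  exact: mulrn_wge0.
elim: s IH => [|x s IHs] Hs; first by rewrite big_nil.
by inversion Hs; subst; rewrite big_cons; apply: addr_ge0; [exact: addr_ge0|exact: IHs].
Qed.

Fixpoint msum_eS m : nat :=
  let: MNode n nS s := m in foldr (fun x a => olen x.1.2 + msum_eS x.2 + a)%N 0%N s.

Lemma msum_eSE n nS (s : seq mbranch) : msum_eS (MNode n nS s) =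
  (\sum_(x <- s) (olen x.1.2 + msum_eS x.2))%N.
Proof. by rewrite /=; elim: s => [|x s IH]; rewrite ?big_nil ?big_cons //= -IH. Qed.

Local Notation oh m := (ohom h (rooto (cls_contr m))).

Definition oh_branch (x : mbranch) : R :=
  if x.1.2 is Some eS then (mlen eS)%:R else h x.1.1.1 - (mlen x.1.1.2)%:R + oh x.2.

Lemma ohE n nS (s : seq mbranch) :
  oh (MNode n nS s) = (mlen nS)%:R + \sum_(x <- s) oh_branch x.
Proof.
rewrite cls_contr_MNode !rooto_tmul rooto_tO rooto_tX addr0 ohomD ohom_oX addrC; congr (_ + _).
elim: s => [|x s IH].
  by rewrite !big_nil rooto_tX /ohom !big1 ?add0r // => i _; rewrite ffunE ?mul0r.
rewrite !big_cons rooto_tmul ohomD IH; congr (_ + _).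
rewrite /contr_branch /oh_branch; case: x.1.2 => [eS|]; rewrite rooto_tmul rooto_tO.
  by rewrite rooto_plant addr0 ohom_oX.
by rewrite ohomD ohom_oedge.
Qed.

Variable (H : R).
Hypothesis hH : forall l, `|h l| <= H.
Local Notation SE m := (uw 0 (fun x : label => (mlen x.2)%:R + H) m).

Lemma sum_le_seq (T : Type) (s : seq T) (F G : T -> R) :
  List.Forall (fun x => F x <= G x) s -> \sum_(x <- s) F x <= \sum_(x <- s) G x.
Proof.
elim: s => [|x s IH] Hs; first by rewrite !big_nil.
by inversion Hs; subst; rewrite !big_cons lerD // IH.
Qed.

Lemma Forall_all_imp (T : Type) (s : seq T) (P Q : T -> Prop) (p : pred T) :
  (forall x, p x -> P x -> Q x) -> List.Forall P s -> all p s -> List.Forall Q s.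
Proof.
move=> PQ; elim: s => [|x s IH] Hs /=; first by constructor.
by move=> /andP[px ps]; inversion Hs; subst; constructor; [exact: PQ|exact: IH].
Qed.

(* The decorations [eS] of a contracted subtree are bounded since its homogeneity is negative. *)
Lemma msum_eS_le m : (admissible_at h false m -> (msum_eS m)%:R <= oh m + SE m) /\
  (admissible_at h true m -> (msum_eS m)%:R <= SE m).
Proof.
elim/mtree_ind': m => n nS s IH.
(* Inside some S the eS enter the o-homogeneity with positive sign, and each edge of S lowers it by
   at most |k| + H. *)
have F : admissible_at h false (MNode n nS s) ->
    (msum_eS (MNode n nS s))%:R <= oh (MNode n nS s) + SE (MNode n nS s).
  rewrite admissible_MNode => /and3P[_ _ adm].
  rewrite msum_eSE ohE uwE mul0rn add0r natr_sum -addrA -big_split /=.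
  rewrite -[leLHS]add0r; apply: lerD => //; apply: sum_le_seq.
  apply: Forall_all_imp IH adm => x ax [IH0 IH1]; rewrite natrD /oh_branch.
  case: x.1.2 ax => [eS|] /= ax; last first.
    by move: (IH0 ax) (hH x.1.1.1); rewrite ler_norml => ? /andP[? _]; lra.
  move: (IH1 ax) (hH x.1.1.1) => ? ?.
  have : 0 <= H by apply: le_trans (hH x.1.1.1).
  have : 0 <= (mlen x.1.1.2)%:R :> R by [].
  by lra.
split=> // am; have := am; rewrite admissible_MNode component_okE => /and3P[nn cok adm].
move: cok; rewrite implyTb; case: ifP => [_ o0|_ /andP[_ all0]].
  have ad : admissible_at h false (MNode n nS s) by rewrite admissible_MNode nn.
  by move: (F ad) o0; set u := ohom _ _; lra.
rewrite msum_eSE uwE mul0rn add0r natr_sum; apply: sum_le_seq.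
have := all0; move: adm => /[dup] adm _ alls.
have adm2 : all (fun x : mbranch => admissible_at h (x.1.2 != None) x.2 && (x.1.2 == Some 0)) s.
  by rewrite all_predI; apply/andP.
apply: Forall_all_imp IH adm2 => x /andP[ax /eqP x0] [IH0 IH1]; move: ax.
rewrite natrD x0 /= mlen0 add0r => /IH1 ?.
have : 0 <= H by apply: le_trans (hH x.1.1.1).
have : 0 <= (mlen x.1.1.2)%:R :> R by [].
by lra.
Qed.

(** The 2 on n-decorations absorbs n_S <= n; the 2 on an edge counts the edge and the node above
    it. *)
Lemma msize_le m top : admissible_at h top m ->
  (msize m)%:R <= 1 + uw (2 : R) (fun x : label => 2 + (mlen x.2)%:R) m + (msum_eS m)%:R :> R.
Proof.
elim/mtree_ind': m top => n nS s IH top; rewrite admissible_MNode => /and3P[/forallP nn _ adm].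
have nSn : (mlen nS)%:R <= (mlen n)%:R :> R.
  by rewrite ler_nat; apply: leq_sum => i _; exact: nn.
rewrite msize_MNode msum_eSE uwE !natrD.
have sumle : (\sum_(x <- s) (1 + mlen x.1.1.2 + olen x.1.2 + msize x.2))%:R <=
   \sum_(x <- s) (2 + (mlen x.1.1.2)%:R + uw 2 (fun x : label => 2 + (mlen x.2)%:R) x.2) +
   (\sum_(x <- s) (olen x.1.2 + msum_eS x.2))%:R :> R.
  rewrite [leLHS]natr_sum [X in _ + X]natr_sum -big_split /=; apply: sum_le_seq.
  apply: Forall_all_imp IH adm => x ax /(_ _ ax); rewrite !natrD; lra.
by move: sumle nSn; rewrite -[2 *+ _]mulr_natr; lra.
Qed.

Lemma msize_arith (A K W E r c a b kap M S : R) : 4 <= A -> 0 < kap ->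
  W + 1 * E <= -2 * r + A * K -> b + kap + K <= a + r ->
  M <= 1 + W + S -> S <= E -> 0 <= K -> r <= c ->
  M <= 1 + A * (c + a - b) + 2 * (a - b).
Proof.
move=> A4 kap0 key lo sz es K0 mc.
have : A * K <= A * (c + a - b) by apply: ler_wpM2l; lra.
by lra.
Qed.

Section Subcritical.
Variables (reg : L -> R) (kap : R).
Hypothesis kap0 : 0 < kap.
Hypothesis regP : forall l (N : {mset label}%mset), rule l N ->
  reg l + kap <= h l + \sum_(p <- (N : seq label)) (reg p.1 - (mlen p.2)%:R).

(** Subcriticality accumulated over the tree: at each node the rule turns the bounds for the
    branches into one for the node, with a gain of [kap]. *)
Lemma rhom_lower m l : conforming rule (underlying m) -> rule l (rootset (underlying m)) ->
  reg l + kap + uw 1 (fun=> kap) m <= h l + rhom h (underlying m).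
Proof.
elim/mtree_ind': m l => n nS s IH l /conforming_underlying cs.
rewrite rootset_underlying => /regP; rewrite rhom_underlying !uwE.
rewrite (perm_big _ (perm_eq_seq_mset _)) /= big_map => rl.
suff : \sum_(x <- s) (kap + uw 1 (fun=> kap) x.2) + \sum_(x <- s) (reg x.1.1.1 - (mlen x.1.1.2)%:R)
   <= \sum_(x <- s) (h x.1.1.1 - (mlen x.1.1.2)%:R +
        uw 1 (fun x : label => h x.1 - (mlen x.2)%:R) x.2) by lra.
rewrite -big_split /=; apply: sum_le_seq.
elim: s IH cs {rl} => [|x s IHs] Hs Hc; first by constructor.
inversion Hs; subst; inversion Hc as [|? ? [rx cx] ?]; subst.
constructor; last exact: IHs.
by have := H2 _ cx rx; rewrite rhom_underlying; lra.
Qed.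

Lemma msize_bound m l (c : R) : admissible h m -> conforming rule (underlying m) ->
  rule l (rootset (underlying m)) -> rhom h (underlying m) <= c ->
  (msize m)%:R <= 1 + (4 + (2 + 3 * H) / kap) * (c + h l - reg l) + 2 * (h l - reg l).
Proof.
move=> am cm rl mc; have lo := rhom_lower cm rl.
have [_ /(_ am) es] := msum_eS_le m; have sz := msize_le am.
(* In [key] below, -2 times the homogeneity pays for the two occurrences of |k| on each edge, one
   from the size and one from [SE]. A multiple A of the quantity in [rhom_lower] pays the rest: a
   unit of n-decoration asks for 2 + 2 <= A, and an edge for 2 + H + 2 |h| <= 2 + 3 H <= A * kap. *)
set A := 4 + _.
have H0 : 0 <= H by apply: le_trans (hH l).
have A4 : 4 <= A by rewrite /A lerDl divr_ge0 ?(ltW kap0) //; lra.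
have Ak : 2 + 3 * H <= A * kap.
  by rewrite /A [leRHS]mulrDl divfK ?gt_eqF // lerDr mulr_ge0 // ltW.
clearbody A.
have K0 : 0 <= uw 1 (fun=> kap) m by apply: uw_ge0 => // _; exact: ltW.
have := @uw_le 2 0 (-2 * 1) 1 (fun x : label => 2 + (mlen x.2)%:R)
  (fun x : label => (mlen x.2)%:R + H) (fun x : label => -2 * (h x.1 - (mlen x.2)%:R))
  (fun=> kap) m 1 A.
rewrite uwZ -rhom_underlying => /(_ _ _) key.
have {}key : uw 2 (fun x : label => 2 + (mlen x.2)%:R) m + 1 * SE m <=
   -2 * rhom h (underlying m) + A * uw 1 (fun=> kap) m.
  apply: key; first by lra.
  by move=> x; have := hH x.1; rewrite ler_norml => /andP[? ?]; lra.
exact: msize_arith A4 kap0 key lo sz es K0 mc.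
Qed.

End Subcritical.
End Finiteness.

Section FiniteHomogeneity.
Variables (R : realType) (d : nat) (L : finType) (h : L -> R).
Local Notation label := (L * mindex d)%type.
Variable rule : L -> set {mset label}%mset.

(** Strictness of the inequality gives a gap for each type, and finiteness of L a common one. *)
Lemma subcritical_gap : rule_subcritical h rule -> exists (reg : L -> R) (kap : R), 0 < kap /\
  forall l (N : {mset label}%mset), rule l N ->
  reg l + kap <= h l + \sum_(p <- (N : seq label)) (reg p.1 - (mlen p.2)%:R).
Proof.
move=> [reg regP]; exists reg.
have gap l : exists kap : R, 0 < kap /\ forall N : {mset label}%mset, rule l N ->
    reg l + kap <= h l + \sum_(p <- (N : seq label)) (reg p.1 - (mlen p.2)%:R).
  have := regP l; set I := ereal_inf _ => lt.
  have lb N : rule l N -> (I <= (\sum_(p <- (N : seq label)) (reg p.1 - (mlen p.2)%:R))%:E)%E.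
    by move=> lN; apply: ereal_inf_lbound; exists N.
  (* An infimum +oo means that [rule l] is empty, and any gap will do; -oo contradicts
     subcriticality. *)
  case: I lt lb => [r| |].
  - rewrite -EFinD lte_fin => lt lb; exists (h l + r - reg l); split; first by lra.
    by move=> N /lb; rewrite lee_fin; lra.
  - move=> _ lb; exists 1; split=> // N /lb; by rewrite leNgt ltry.
  - by rewrite addeNy // ltNge leNye.
have [f fP] := choice gap.
have S0 : 0 < 1 + \sum_l (f l)^-1.
  apply: ltr_pwDl => //; apply: sumr_ge0 => l _; rewrite invr_ge0 ltW //.
  by have [] := fP l.
(* A positive lower bound of all the [f l] that also makes sense when L is empty. *)
exists (1 + \sum_l (f l)^-1)^-1; split; first by rewrite invr_gt0.
move=> l N lN; have [f0 /(_ N lN)] := fP l; apply: le_trans; rewrite lerD2l.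
rewrite -[leRHS]invrK lef_pV2 ?posrE ?invr_gt0 //.
rewrite (bigD1 l) //= addrCA lerDl addr_ge0 // sumr_ge0 // => j _.
by rewrite invr_ge0 ltW //; have [] := fP j.
Qed.

Lemma finite_BB (c : R) : rule_subcritical h rule ->
  finite_set [set a | B_BHZ h rule a /\ thom h a <= c].
Proof.
move=> /subcritical_gap[reg [kap [kap0 regP]]].
pose H : R := \sum_l `|h l|.
have hH l : `|h l| <= H.
  by rewrite /H (bigD1 l) //= lerDl sumr_ge0.
pose C : R := \sum_l `|h l - reg l|.
have hC l : h l - reg l <= C.
  by apply: le_trans (ler_norm _) _; rewrite /C (bigD1 l) //= lerDl sumr_ge0.
pose B : R := 1 + (4 + (2 + 3 * H) / kap) * (c + C) + 2 * C.
have [M BM] : exists M : nat, B <= M%:R.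
  exists (Num.bound `|B|); apply: le_trans (ler_norm _) _.
  by apply: ltW; apply: archi_boundP.
apply: sub_finite_set (finite_image (@cls_contr d L) (@finite_msize R d L M)).
move=> a [[m [am [cm [l rl]] ->]]]; rewrite -/(cls_contr m) (thom_contr am) => mc.
exists m => //=; rewrite -(ler_nat R); apply: le_trans BM.
apply: le_trans (msize_bound hH kap0 regP am cm rl mc) _.
have H0 : 0 <= H by apply: le_trans (hH l).
rewrite /B; apply: lerD; last by rewrite ler_pM2l // hC.
apply: lerD => //; apply: ler_wpM2l; last by rewrite -addrA lerD2l.
apply: addr_ge0 => //; apply: divr_ge0; last exact: ltW.
by apply: addr_ge0 => //; apply: mulr_ge0.
Qed.

End FiniteHomogeneity.

(** * Trees of integer homogeneity *)

Section Integrality.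
Variables (R : realType) (d : nat) (L : finType) (h : L -> R).
Local Notation label := (L * mindex d)%type.
Local Notation odeco := ({ffun 'I_d -> int} * {ffun L -> int})%type.
Local Notation dtree := (dtree d L).
Local Notation TT := {malg R[dtree * dtree]}.
Local Notation "a ** b" := (tmul a b) (at level 40, left associativity).
Local Notation tX := (tX L).
Variable rule : L -> set {mset label}%mset.
Hypothesis rule_compl : rule_complete h rule.
Implicit Types (n k : mindex d) (o : odeco) (a b : dtree) (z w : TT) (t : L).
Local Notation BB := (B_BHZ h rule).
Local Notation BP := (Bp_BHZ h rule).
Local Notation tprod s := (\big[@tmul d L/tX 0]_(x <- s) bplant x).

(* The number of edges of type [t], those of the contracted subtrees included. *)
Definition cnt t a : int := weight 0 (fun o : odeco => o.2 t) (fun x : label => (t == x.1)%:Z) a.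
Definition iwt a : int :=
  weight 1 (fun o : odeco => \sum_i o.1 i) (fun x : label => - (mlen x.2)%:Z) a.

Let cntD t (o o' : odeco) : (o + o').2 t = o.2 t + o'.2 t.
Proof. by rewrite ffunE. Qed.
Let iwtD (o o' : odeco) : \sum_i (o + o').1 i = \sum_i o.1 i + \sum_i o'.1 i.
Proof. by rewrite -big_split; apply: eq_bigr => i _; rewrite ffunE. Qed.

Lemma cnt_tmul t a b : cnt t (a ** b) = cnt t a + cnt t b.
Proof. by apply: (weight_tmul _ _ (g := fun o : odeco => o.2 t)) => o o'; exact: cntD. Qed.
Lemma cnt_tX t n : cnt t (tX n) = 0.
Proof. by rewrite /cnt weight_tX ?mul0rn // => o o'; exact: cntD. Qed.
Lemma cnt_plant t l k a : cnt t (plant l k a) = (t == l)%:Z + cnt t a.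
Proof. by rewrite /cnt weight_plant // => o o'; exact: cntD. Qed.

Lemma iwt_tX n : iwt (tX n) = (mlen n)%:Z.
Proof. by rewrite /iwt weight_tX ?natz //; exact: iwtD. Qed.
Lemma iwt_tmul a b : iwt (a ** b) = iwt a + iwt b.
Proof. by rewrite /iwt weight_tmul //; exact: iwtD. Qed.
Lemma iwt_plant l k a : iwt (plant l k a) = - (mlen k)%:Z + iwt a.
Proof. by rewrite /iwt weight_plant //; exact: iwtD. Qed.

(** The shape to which rational independence applies. *)
Lemma thom_cnt a : thom h a = (iwt a)%:~R + \sum_t (cnt t a)%:~R * h t.
Proof.
elim/dtree_ind: a => [n|o|a b IHa IHb|l k a IH].
- rewrite thom_tX iwt_tX big1 ?addr0 // => t _.
  by rewrite cnt_tX mul0r.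
- by rewrite thom_tO /iwt /cnt weight_tO /ohom; congr (_ + _); apply: eq_bigr => t _; rewrite weight_tO.
- rewrite thom_tmul IHa IHb iwt_tmul addrACA -intrD; congr (_ + _).
  by rewrite -big_split; apply: eq_bigr => t _; rewrite cnt_tmul intrD mulrDl.
rewrite thom_plant IH iwt_plant.
have -> : \sum_t (cnt t (plant l k a))%:~R * h t = h l + \sum_t (cnt t a)%:~R * h t.
  under eq_bigr do rewrite cnt_plant intrD mulrDl.
  rewrite big_split /=; congr (_ + _).
  rewrite (bigD1 l) //= eqxx mul1r big1 ?addr0 // => t /negbTE ->.
  by rewrite mul0r.
by rewrite intrD rmorphN /=; ring.
Qed.

Lemma rweight_cnt_ge0 t m :
  0 <= rweight 0 (fun o : odeco => o.2 t) (fun x : label => (t == x.1)%:Z) (underlying m).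
Proof.
elim/mtree_ind': m => n nS s IH; rewrite rweight_underlying ?ffunE // mul0rn add0r.
elim: s IH => [|x s IHs] H; first by rewrite big_nil.
by inversion H; subst; rewrite big_cons; apply: addr_ge0; [exact: addr_ge0|exact: IHs].
Qed.

Lemma cnt_contr t m : admissible h m -> cnt t (cls_contr m) =
  rweight 0 (fun o : odeco => o.2 t) (fun x : label => (t == x.1)%:Z) (underlying m).
Proof.
move=> am; apply: (weight_contr (fun o o' => cntD t o o') _ _ _ am).
- by move=> l k j; rewrite mul0rn subr0.
- by move=> k; rewrite /= ffunE mul0rn.
- by move=> x; rewrite /= ffunE.
Qed.

(** An arbitrary o-decoration could make the count negative; on a contraction it is the number of
    edges of type t of the underlying tree. *)
Lemma BB_cnt_ge0 t a : BB a -> 0 <= cnt t a.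
Proof. by move=> [m [am _ ->]]; rewrite -/(cls_contr m) cnt_contr // rweight_cnt_ge0. Qed.

(** The marked tree has no edge, so admissibility forces n_S = 0 and the contraction is a bare
    node. *)
Lemma BB_cnt0 a : BB a -> (forall t, cnt t a = 0) -> a = tX (rootn a).
Proof.
move=> [[n nS s] [am _ aE]] c0.
have {c0} s0 : s = [::].
  case: s am aE => // x s am aE; move: (c0 x.1.1.1); rewrite aE -/(cls_contr _) cnt_contr //.
  rewrite rweight_underlying ?ffunE // mul0rn add0r big_cons eqxx.
  have : 0 <= \sum_(y <- s) ((x.1.1.1 == y.1.1.1)%:Z + rweight 0 (fun o : odeco => o.2 x.1.1.1)
     (fun z : label => (x.1.1.1 == z.1)%:Z) (underlying y.2)).
    by apply: sumr_ge0 => y _; apply: addr_ge0 => //; exact: rweight_cnt_ge0.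
  move: (rweight_cnt_ge0 x.1.1.1 x.2) => /=; set u := rweight _ _ _ _; set v := \sum_(_ <- _) _.
  by move: u v => u v; lia.
move: am aE; rewrite s0 /admissible admissible_MNode component_okE /= => /and3P[_ /andP[/eqP-> _] _].
rewrite /oX => ->; rewrite rootn_tcls /=.
have -> : msub n 0 = n by apply/ffunP => i; rewrite !ffunE subn0.
by congr tcls; congr Node; congr pair; apply/ffunP => i; rewrite !ffunE.
Qed.

Lemma BP_cnt_ge0 t a : BP a -> 0 <= cnt t a.
Proof.
move=> /(BP_E rule_compl)[k [s [sB ->]]]; rewrite cnt_tmul cnt_tX addr0.
elim: s sB => [|x s IH] sB; first by rewrite big_nil cnt_tX.
rewrite big_cons cnt_tmul addr_ge0 //.
  rewrite cnt_plant addr_ge0 //; apply: BB_cnt_ge0.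
  by have [] := sB x (mem_head _ _).
by apply: IH => y ys; apply: sB; rewrite inE ys orbT.
Qed.

Lemma BP_cnt0 a : BP a -> (forall t, cnt t a = 0) -> a = tX (rootn a).
Proof.
move=> Ba; move: (Ba) => /(BP_E rule_compl)[k [s [sB aE]]] c0.
case: s sB aE => [|x s] sB aE.
  by move: aE; rewrite big_nil tmul1 => ->; rewrite rootn_tX.
have Bs : BP (tprod s).
  apply/(BP_E rule_compl); exists 0, s; rewrite Monoid.mulm1; split=> // y ys.
  by apply: sB; rewrite inE ys orbT.
have [Bx _ _] := sB x (mem_head _ _).
move: (c0 x.1.1); rewrite aE cnt_tmul cnt_tX addr0 big_cons cnt_tmul cnt_plant eqxx.
move: (BB_cnt_ge0 x.1.1 Bx) (BP_cnt_ge0 x.1.1 Bs); lia.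
Qed.

Hypothesis indep : rationally_independent h.

Lemma int_thom_cnt0 a (z : int) : thom h a = z%:~R -> forall t, cnt t a = 0.
Proof.
move=> az; have [] := indep (k := cnt^~ a) (k1 := iwt a - z) => //.
by rewrite intrB addrA [_ + (iwt a)%:~R]addrC -thom_cnt az subrr.
Qed.

Lemma BB_int a (z : int) : BB a -> thom h a = z%:~R -> a = tX (rootn a).
Proof. by move=> Ba /int_thom_cnt0; exact: BB_cnt0. Qed.

Lemma BP_int a (z : int) : BP a -> thom h a = z%:~R -> a = tX (rootn a).
Proof. by move=> Ba /int_thom_cnt0; exact: BP_cnt0. Qed.

End Integrality.

(** * The coproduct of T+ and the recentered basis of T *)

HB.lock Definition Dp (R : realType) (d : nat) (L : finType) (h : L -> R) (a : dtree d L) :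
  {malg R[dtree d L * dtree d L]} := rDeltap h (repr a).

HB.lock Definition plantLp (R : realType) (d : nat) (L : finType) (h : L -> R) (l : L) (k : mindex d)
    (z : {malg R[dtree d L * dtree d L]}) : {malg R[dtree d L * dtree d L]} :=
  lext (fun p => if 0 < thom h (plant l k p.1) then <[(plant l k p.1, p.2)]> else 0) z.

Section PositivePart.
Variables (R : realType) (d : nat) (L : finType) (h : L -> R).
Local Notation label := (L * mindex d)%type.
Local Notation odeco := ({ffun 'I_d -> int} * {ffun L -> int})%type.
Local Notation rtree := (rtree d L).
Local Notation dtree := (dtree d L).
Local Notation T := {malg R[dtree]}.
Local Notation TT := {malg R[dtree * dtree]}.
Local Notation "a ** b" := (tmul a b) (at level 40, left associativity).
Local Notation tX := (tX L).
Local Notation one2 := (<[(tX 0, tX 0)]> : TT).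
Variable rule : L -> set {mset label}%mset.
Hypothesis rule_norm : rule_normal rule.
Hypothesis rule_compl : rule_complete h rule.
Implicit Types (n k : mindex d) (o : odeco) (a b : dtree) (z w : TT).
Local Notation BB := (B_BHZ h rule).
Local Notation BP := (Bp_BHZ h rule).
Local Notation Dl := (Dl h).
Local Notation Dp := (Dp h).
Local Notation plantLp := (plantLp h).
Local Notation tprod s := (\big[@tmul d L/tX 0]_(x <- s) bplant x).

Definition branchDp (x : label) z a : TT := plantLp x.1 x.2 z + Taylor h x.1 x.2 a.

Lemma rDeltap_Node n o s : rDeltap h (Node n o s) =
  prod2 (\big[@prod2 R d L/one2]_(x <- s) branchDp x.1 (rDelta h x.2) (tcls x.2)) (DeltaX R L n).
Proof. by rewrite -foldr_big /= /branchDp plantLp.unlock prod2.unlock bvec.unlock. Qed.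

Lemma rDeltap_tiso (t u : rtree) : tiso t u -> rDeltap h t = rDeltap h u.
Proof.
case: t u => n o s [n' o' s'] tu; have /tiso_perm[nn _ ss] := tu; subst n'.
have E (r : seq (label * rtree)) :
    \big[@prod2 R d L/one2]_(x <- r) branchDp x.1 (rDelta h x.2) (tcls x.2) =
    \big[@prod2 R d L/one2]_(x <- map (@bcls d L) r) branchDp x.1 (Dl x.2) x.2.
  by rewrite big_map; apply: eq_bigr => x _; rewrite -rDelta_tcls.
by rewrite !rDeltap_Node !E (perm_big _ ss).
Qed.

Lemma rDeltap_tcls (t : rtree) : rDeltap h t = Dp (tcls t).
Proof. by rewrite Dp.unlock; exact/rDeltap_tiso/tiso_repr. Qed.

Lemma Dp_prod (s : seq (label * dtree)) k : Dp (tprod s ** tX k) =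
  prod2 (\big[@prod2 R d L/one2]_(x <- s) branchDp x.1 (Dl x.2) x.2) (DeltaX R L k).
Proof.
pose r := [seq (x.1, repr x.2) | x <- s].
have rs : map (@bcls d L) r = s.
  by rewrite /r -map_comp -[RHS]map_id; apply: eq_map => -[x a]; rewrite /= /bcls /= tclsK.
have -> : tprod s ** tX k = tcls (Node k 0 r).
  rewrite tcls_Node -(big_map (@bcls d L) xpredT (@bplant d L)) rs.
  by rewrite [tO 0 ** _]tmul1 tmulC.
rewrite -rDeltap_tcls rDeltap_Node; congr (prod2 _ _).
rewrite -[in RHS]rs big_map; apply: eq_bigr => x _.
by rewrite -rDelta_tcls.
Qed.

Lemma DpX n : Dp (tX n) = DeltaX R L n.
Proof. by have := Dp_prod [::] n; rewrite !big_nil tmul1 mul21. Qed.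

Lemma DpP l k a : Dp (plant l k a) = plantLp l k (Dl a) + Taylor h l k a.
Proof.
have := Dp_prod [:: (l, k, a)] 0; rewrite !big_seq1 DeltaX0 mul2_one.
by rewrite Monoid.mulm1.
Qed.

Lemma supp_in_plantLp (P Q : dtree * dtree -> Prop) l k z : supp_in P z ->
  (forall a b, P (a, b) -> 0 < thom h (plant l k a) -> Q (plant l k a, b)) ->
  supp_in Q (plantLp l k z).
Proof.
move=> Pz PQ; rewrite plantLp.unlock; apply: supp_in_lext Pz _ => -[a b] Pab /=.
by case: ifP => [pos|_]; [apply: supp_inU; exact: PQ|exact: supp_in0].
Qed.

(** On the left [plantLp] drops the planted trees of nonpositive homogeneity; on the right the
    cutoff of the Taylor sum is exactly positivity of the planted tree. *)
Lemma Dp_supp a : BP a ->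
  supp_in (fun p => [/\ BP p.1, BP p.2 & thom h p.1 + thom h p.2 = thom h a]) (Dp a).
Proof.
move=> /(BP_E rule_compl)[k [s [sB ->]]]; rewrite Dp_prod.
rewrite thom_tmul thom_tX.
apply: (supp_in_mul2 (P := fun p => [/\ BP p.1, BP p.2 & thom h p.1 + thom h p.2 = thom h (tprod s)])
  (Q := fun p => [/\ BP p.1, BP p.2 & thom h p.1 + thom h p.2 = (mlen k)%:R])); last first.
- move=> [p1 p2] [q1 q2] [/= ? ? <-] [? ? <-]; split; [exact: BP_tmul|exact: BP_tmul|].
  by rewrite !thom_tmul addrACA.
- apply: supp_in_sub (@supp_in_DeltaX R d L k) _ => _ [i [j [-> <-]]] /=.
  by split; [exact: BP_tX|exact: BP_tX|rewrite !thom_tX mlenD natrD].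
elim: s sB => [|x s IH] sB.
  rewrite !big_nil; apply: supp_inU; split; [exact: BP_tX|exact: BP_tX|].
  by rewrite /= !thom_tX mlen0 addr0.
have {IH} IH := IH (fun y ys => sB y (mem_behead (s := x :: s) ys)).
have [Bx px rx] := sB x (mem_head _ _).
rewrite !big_cons thom_tmul.
apply: (supp_in_mul2 (P := fun p => [/\ BP p.1, BP p.2 & thom h p.1 + thom h p.2 = thom h (bplant x)])
  _ IH); last first.
  move=> [p1 p2] [q1 q2] [/= ? ? <-] [? ? <-]; split; [exact: BP_tmul|exact: BP_tmul|].
  by rewrite !thom_tmul addrACA.
rewrite /branchDp /bplant; case: x Bx px rx {sB} => [[l k'] u] /= Ba pa ra.
apply: supp_inD.
  have H : supp_in (fun p => [/\ BB p.1, BP p.2, thom h p.1 + thom h p.2 = thom h u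
      & rule l (rset p.1)]) (Dl u).
    move=> p pa'; have [? ?] := BB_Dl rule_norm rule_compl Ba pa'.
    have [_ sub] := Dl_conf rule_norm (BB_conf rule_compl Ba) pa'.
    split=> //; [exact: (Dl_thom pa')|exact: rule_norm ra sub].
  apply: supp_in_plantLp H _ => a1 b1 [/= ? ? e ?] pos; split=> //; first exact: BP_plant.
  by rewrite !thom_plant -addrA e.
apply: supp_in_Taylor => j hj /=; split; first exact: BP_tX.
  apply: BP_plant => //; rewrite thom_plant_gt0; apply: le_lt_trans hj.
  by rewrite mlenD addnC.
by rewrite thom_tX !thom_plant mlenD natrD; ring.
Qed.

Lemma contract_chi0_Dp l k a : 0 < thom h (plant l k a) ->
  contract (chi R 0) (Dp (plant l k a)) = <[plant l k a]>.
Proof.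
move=> pos; rewrite DpP linearD /= contract_Taylor ?addr0; last first.
  by move=> *; exact: chi_plant.
have -> : contract (chi R 0) (plantLp l k (Dl a)) =
    lext (fun b => if 0 < thom h (plant l k b) then <[plant l k b]> else 0)
      (contract (chi R 0) (Dl a)).
  rewrite plantLp.unlock !contractE !lext_lext; apply: eq_lext => -[b c] _ /=.
  by rewrite lextZU; case: ifP => _; rewrite ?lextU ?lext0 ?scaler0.
by rewrite contract_chi0_Dl lextU pos.
Qed.

Lemma mfact_neq0 n : (mfact n)%:R != 0 :> R.
Proof. by rewrite pnatr_eq0 -lt0n /mfact prodn_gt0 // => i; exact: fact_gt0. Qed.

Lemma mcoeff_tX_term (c : R) j n a b :
  mcoeff (tX n, b) (c *: <[(tX j, a)]> : TT) = c * ((j == n) && (a == b))%:R.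
Proof.
rewrite mcoeffZ mcoeffU1 xpair_eqE.
by rewrite (inj_eq (@tX_inj d L)).
Qed.

(** Powers of X on the left come from the Taylor part only; [Dk_plant] reads D^n off from this
    coefficient. *)
Lemma Dp_coef_tX l k a n b : mcoeff (tX n, b) (Dp (plant l k a)) =
  if 0 < thom h (plant l (k + n) a) then (mfact n)%:R^-1 * (plant l (k + n) a == b)%:R else 0.
Proof.
rewrite DpP mcoeffD [X in X + _](_ : _ = 0) ?add0r; last first.
  apply/eqP; rewrite mcoeff_eq0; apply/negP.
  have H : supp_in (fun p : dtree * dtree => exists c, p.1 = plant l k c) (plantLp l k (Dl a)).
    apply: (@supp_in_plantLp (fun=> True)) => [p //|c e _ _]; by exists c.
  by move=> /H[c]; exact: tX_neq_plant.
have [s [us sE ->]] := TaylorE h l k a; rewrite raddf_sum /=.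
have ns : (n \in s) = (0 < thom h (plant l (k + n) a)).
  by rewrite sE thom_plant_gt0 mlenD addnC.
rewrite -ns.
transitivity (\sum_(j <- s) (mfact j)%:R^-1 * ((j == n) && (plant l (k + j) a == b))%:R : R).
  by apply: eq_bigr => j _; exact: mcoeff_tX_term.
case: ifP => nsE.
  rewrite (bigD1_seq n nsE us) /= [n == n]eqxx big1 ?addr0 // => j /negbTE ->.
  exact: mulr0.
rewrite big_seq big1 // => j js; case: eqP => [e|_]; last exact: mulr0.
by rewrite -e js in nsE.
Qed.

Definition strip a : dtree := tO (rooto a) ** tprod (rootb a).

Lemma tmulr1 a : a ** tX 0 = a.
Proof. by rewrite tmulC tmul1. Qed.

Lemma stripE a : a = tX (rootn a) ** strip a.
Proof. by rewrite {1}(root_decomp a) /strip ((@tmul d L).[AC (1*2) (2*(1*3))]). Qed.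

Lemma rootn_strip a : rootn (strip a) = 0.
Proof. by rewrite rootn_tmul rootn_tO rootn_prod addr0. Qed.

Lemma strip_id a : rootn a = 0 -> strip a = a.
Proof. by move=> a0; rewrite {2}(stripE a) a0 tmul1. Qed.

Lemma tmul_tX_inj n a b : tX n ** a = tX n ** b -> rootn a = rootn b -> a = b.
Proof.
move=> e ab; apply: rootE => //.
  by have := congr1 (@rooto d L) e; rewrite !rooto_tmul !rooto_tX !add0r.
have := rootb_tmul (tX n) a; rewrite rootb_tX e perm_sym => /perm_trans h1.
by have := h1 _ (rootb_tmul _ _); rewrite rootb_tX.
Qed.

Lemma strip_tX n a : rootn a = 0 -> strip (tX n ** a) = a.
Proof.
move=> a0; apply: (@tmul_tX_inj n); last by rewrite rootn_strip.
by have := stripE (tX n ** a); rewrite rootn_tmul rootn_tX a0 addr0.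
Qed.

Lemma BB_strip a : BB a -> BB (strip a).
Proof.
by rewrite {1}(stripE a) => /(BB_clear (rule := rule) (rootn_strip a)).
Qed.

(** The power of X at the root is taken out before recentering, so that X^k acts freely on the
    basis, as (A3) demands. *)
Definition fB a : T := prodT <[tX (rootn a)]> (recenter h (strip a)).

(** The number of n-decorations off the root; the absolute value only turns [ntot], which is
    nonnegative, into a natural number. *)
Definition rk a : nat := (`|ntot a| - mlen (rootn a))%N.

Lemma rk_lt a b : ntot b = ntot a -> (mlen (rootn a) < mlen (rootn b))%N -> (rk b < rk a)%N.
Proof.
move=> e lt; have := ntot_rootn b; have := ntot_ge0 b; rewrite /rk e.
by case: (ntot a) => // x _; rewrite /=; lia.
Qed.

Lemma prodTBr (u v w : T) : prodT u (v - w) = prodT u v - prodT u w.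
Proof. by rewrite !mulTE -scaleN1r convolDr convolZr scaleN1r. Qed.

(** The correction terms X^j c of [recenter] keep the total n-decoration but have at least |j| > 0
    more of it at the root. *)
Lemma fB_tri a : BB a -> supp_in (fun b => [/\ BB b, thom h b = thom h a & (rk b < rk a)%N])
  (fB a - <[a]>).
Proof.
move=> Ba; have -> : fB a - <[a]> = prodT <[tX (rootn a)]> (recenter h (strip a) - <[strip a]>).
  by rewrite /fB prodTBr mulTU -stripE.
rewrite mulTUl; have Bs := BB_strip Ba.
have hE : thom h a = (mlen (rootn a))%:R + thom h (strip a).
  by rewrite {1}(stripE a) thom_tmul thom_tX.
have nE : ntot a = (mlen (rootn a))%:Z + ntot (strip a).
  by rewrite {1}(stripE a) ntot_tmul ntot_tX.
apply: supp_in_lext (@recenter_tri R d L h (strip a)) _ => _ [j [c [j0 -> ca]]].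
have [_ cD] := Theta_supp ca; have cn := Theta_ntot ca.
have [Bc _] := BB_Dl rule_norm rule_compl Bs cD.
have hc := Dl_thom cD; rewrite /= thom_tX in hc.
rewrite /= ntot_tX in cn.
apply: supp_inU; split.
- apply: BB_tX_mul; exact: BB_tX_mul.
- by rewrite hE -hc !thom_tmul !thom_tX [thom h c + _]addrC.
apply: rk_lt.
  by rewrite nE -cn !ntot_tmul !ntot_tX [ntot c + _]addrC.
rewrite !rootn_tmul !rootn_tX !mlenD -[X in (X < _)%N]addn0 ltn_add2l.
by rewrite addn_gt0 lt0n mlen_eq0 j0.
Qed.

Lemma fB_hom a : BB a -> supp_in (fun b => BB b /\ thom h b = thom h a) (fB a).
Proof.
move=> Ba; rewrite -[fB a](subrK <[a]>); apply: supp_inD; last exact: supp_inU.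
by apply: supp_in_sub (fB_tri Ba) _ => b [].
Qed.

Lemma fB_tX n : fB (tX n) = <[tX n]>.
Proof.
have sE : strip (tX n) = tX 0.
  by rewrite -{1}[tX n](tmulr1) strip_tX // rootn_tX.
by rewrite /fB sE rootn_tX recenter_tX0 mulTU tmulr1.
Qed.

Lemma fB_tX_mul k a : rootn a = 0 -> fB (tX k ** a) = prodT <[tX k]> (fB a).
Proof.
move=> a0; rewrite /fB strip_tX // strip_id // rootn_tmul rootn_tX a0 addr0.
by rewrite mulT1.
Qed.

Lemma fB_rootn0 a : rootn a = 0 -> fB a = recenter h a.
Proof. by move=> a0; rewrite /fB a0 mulT1 strip_id. Qed.

End PositivePart.

(** * The assumptions *)

Section BasesAndA.
Variables (R : realType) (d : nat) (L : finType) (h : L -> R).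
Local Notation label := (L * mindex d)%type.
Local Notation dtree := (dtree d L).
Local Notation T := {malg R[dtree]}.
Local Notation TT := {malg R[dtree * dtree]}.
Local Notation "a ** b" := (tmul a b) (at level 40, left associativity).
Local Notation tX := (tX L).
Variable rule : L -> set {mset label}%mset.
Hypothesis rule_norm : rule_normal rule.
Hypothesis rule_compl : rule_complete h rule.
Implicit Types (n k : mindex d) (a b c : dtree) (z w : TT) (u v : T).
Local Notation BB := (B_BHZ h rule).
Local Notation BP := (Bp_BHZ h rule).
Local Notation Dl := (Dl h).
Local Notation Dp := (Dp h).
Local Notation fB := (fB h).
Local Notation S := (BHZ h rule).
Local Notation tprod s := (\big[@tmul d L/tX 0]_(x <- s) bplant x).

Lemma mulpE u v : @mulp R d S u v = prodT u v.
Proof. by rewrite prodT.unlock. Qed.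
Lemma unitpE : @unitp R d S = <[tX 0]>.
Proof. by rewrite bvec.unlock. Qed.
Lemma XpE i : @Xp R d S i = <[tX (munit i)]>.
Proof. by rewrite bvec.unlock. Qed.
Lemma DeltaE u : @Defs.Delta R d S u = lext Dl u.
Proof. exact: Delta_BHZE. Qed.
Lemma DeltapE u : @Defs.Deltap R d S u = lext Dp u.
Proof. by rewrite Dp.unlock. Qed.
Lemma spacepE : @spacep R d S = lspan (basis_vecs BP).
Proof. by rewrite /basis_vecs bvec.unlock. Qed.
Lemma spaceE : @Defs.space R d S = lspan (basis_vecs BB).
Proof. by rewrite /basis_vecs bvec.unlock. Qed.

Lemma prodpE (s : seq T) : prodp (S := S) s = \big[@prodT R d L/<[tX 0]>]_(a <- s) a.
Proof. by rewrite /prodp unitpE prodT.unlock. Qed.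

Lemma prodTU_big (s : seq (label * dtree)) :
  \big[@prodT R d L/<[tX 0]>]_(x <- s) <[bplant x]> = <[tprod s]>.
Proof.
elim: s => [|x s IH]; first by rewrite !big_nil.
by rewrite !big_cons IH mulTU.
Qed.

Lemma XpowE k : Xpow S k = <[tX k]>.
Proof.
have E n : Xpow S n = \big[@prodT R d L/<[tX 0]>]_(i < d)
    iter (n i) (prodT <[tX (munit i)]>) <[tX 0]>.
  rewrite /Xpow unitpE; under eq_bigr do rewrite XpE.
  by rewrite prodT.unlock.
rewrite E; elim/mindex_ind: k => [|i|n k IHn IHk].
- by rewrite big1 // => i _; rewrite ffunE.
- rewrite (bigD1 i) //= big1 => [|j ji]; last by rewrite ffunE (negbTE ji).
  by rewrite ffunE eqxx /= !mulTU !tmulr1.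
rewrite tX_add -mulTU -IHn -IHk -big_split /=; apply: eq_bigr => i _.
rewrite ffunE iterD; elim: (n i) => [|m IH] /=; first by rewrite mulT1.
by rewrite IH; exact: mulTA.
Qed.

Lemma bvec_neq0 a : <[a]> != 0 :> T.
Proof.
apply/eqP => /(congr1 (mcoeff a)); rewrite mcoeffU11 mcoeff0 => /eqP.
by rewrite oner_eq0.
Qed.

Lemma hmgE (wt : dtree -> R) u (c : R) : u != 0 -> supp_in (fun a => wt a = c) u -> hmg wt u = c.
Proof.
move=> u0 uc; apply: xget_unique; first by split=> // a /uc.
move=> c' [_ uc']; have [a ua] : exists a, a \in msupp u.
  apply: contrapT => nu; move/eqP: u0; apply.
  by apply: (@supp_in_eq0 _ _ (fun=> False)) => // a ua; apply: nu; exists a.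
by rewrite -(uc' a ua) (uc a ua).
Qed.

Lemma hmgU (wt : dtree -> R) a : hmg wt (<[a]> : T) = wt a.
Proof. by apply: hmgE; [exact: bvec_neq0|exact: supp_inU]. Qed.

Lemma bvec_inj a b : <[a]> = <[b]> :> T -> a = b.
Proof. exact: mkmalgU1_inj. Qed.

Definition genBP : set T := [set <[plant y.1.1 y.1.2 y.2]> | y in
  [set y : label * dtree | [/\ BB y.2, 0 < thom h (bplant y) & rule y.1.1 (rset y.2)]]].
Definition basB : set T := [set fB a | a in BB].
Definition basBdot : set T := [set fB a | a in [set a | BB a /\ rootn a = 0]].
Local Notation Xact := (fun k u => prodT <[tX k]> u).

Variables (qp : T -> T -> T) (q : T -> T -> T).
Hypothesis qpP : forall t, basis_vecs BP t -> @expansion R d S _ (basis_vecs BP) (@Defs.Deltap R d S t) (qp t).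
Hypothesis qP : forall t, basB t -> @expansion R d S _ basB (@Defs.Delta R d S t) (q t).

Definition BHZ_frame : frame S :=
  @Frame R d S (basis_vecs BP) genBP basB basBdot Xact qp q.
Local Notation F := BHZ_frame.

Lemma fB_triBB a : BB a -> supp_in (fun b => BB b /\ (rk b < rk a)%N) (fB a - <[a]>).
Proof. by move=> Ba; apply: supp_in_sub (fB_tri rule_norm rule_compl Ba) _ => b []. Qed.

Lemma fB_inj a b : BB a -> BB b -> fB a = fB b -> a = b.
Proof. exact: tri_inj fB_triBB a b. Qed.

Lemma basB_basis : is_basis basB (lspan (basis_vecs BB)).
Proof. exact: tri_basis fB_triBB. Qed.

Lemma fB_neq0 a : BB a -> fB a != 0.
Proof.
move=> Ba; apply/eqP => /(congr1 (mcoeff a)); rewrite mcoeff0.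
rewrite (mcoeff_tri_diag fB_triBB Ba) => /eqP.
by rewrite oner_eq0.
Qed.

Lemma hmg_fB a : BB a -> hmg (thom h) (fB a) = thom h a.
Proof.
move=> Ba; apply: hmgE; first exact: fB_neq0.
by apply: supp_in_sub (fB_hom rule_norm rule_compl Ba) _ => b [].
Qed.

Lemma BHZ_bases : bases F.
Proof.
split.
- split; first by rewrite spacepE; exact: basis_vecs_basis.
  by move=> _ [a _ <-]; exists (thom h a); exact: supp_inU.
- split; first by rewrite spaceE; exact: basB_basis.
  move=> _ [a Ba <-]; exists (thom h a) => b bs.
  by have [] := fB_hom rule_norm rule_compl Ba bs.
- exact: qpP.
- exact: qP.
Qed.

Lemma BP_monoid : commutative_monoid_on (basis_vecs BP : set {malg R[symbp S]}).
Proof.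
split.
- by rewrite unitpE; exists (tX 0) => //; exact: BP_tX.
- move=> _ _ [a Ba <-] [b Bb <-]; rewrite !mulpE; split; last exact: mulTC.
  by rewrite mulTU; exists (a ** b) => //; exact: BP_tmul.
- by move=> u v w _ _ _; rewrite !mulpE mulTA.
- by move=> u _; rewrite mulpE unitpE mulT1.
Qed.

Lemma genBP_seq (s : seq T) : (forall u, u \in s -> genBP u) -> exists r : seq (label * dtree),
  s = [seq <[bplant x]> | x <- r] /\
  forall x, x \in r -> [/\ BB x.2, 0 < thom h (bplant x) & rule x.1.1 (rset x.2)].
Proof.
elim: s => [|u s IH] sG; first by exists [::].
have [x xG xu] := sG u (mem_head _ _).
have [|r [-> rG]] := IH; first by move=> v vs; apply: sG; rewrite inE vs orbT.
exists (x :: r); split; first by rewrite /= -xu.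
by move=> y; rewrite inE => /orP[/eqP->|/rG].
Qed.

Lemma rootb_mul_tprod k (s : seq (label * dtree)) : perm_eq (rootb (tX k ** tprod s)) s.
Proof.
by apply: perm_trans (rootb_tmul _ _) _; rewrite rootb_tX rootb_prod.
Qed.

(** X^k and the planted factors are recovered from a product as the n-decoration and the branches of
    its root. *)
Lemma BP_free : set_bij
  [set p : mindex d * {mset {malg R[symbp S]}}%mset | forall u : {malg R[symbp S]}, u \in p.2 -> genBP u]
  (basis_vecs BP) (fun p => mulp (Xpow S p.1) (prodp (S := S) p.2)).
Proof.
have E (k : mindex d) (r : seq (label * dtree)) (s : {mset {malg R[symbp S]}}%mset) :
    perm_eq s [seq <[bplant x]> | x <- r] ->
    mulp (Xpow S k) (prodp (S := S) s) = <[tX k ** tprod r]>.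
  by move=> sr; rewrite mulpE XpowE prodpE (perm_big _ sr) /= big_map prodTU_big mulTU.
split.
- move=> [k M] /= MG; have [r [Mr rG]] := genBP_seq MG.
  have EM : perm_eq M [seq <[bplant x]> | x <- r] by rewrite Mr.
  apply: (eq_ind_r (basis_vecs BP) _ (E k r M EM)).
  exists (tX k ** tprod r) => //; apply/(BP_E rule_compl); exists k, r; split=> //.
  exact: tmulC.
- move=> [k M] [k' M'] /set_mem /= MG /set_mem /= MG'.
  have [r [Mr rG]] := genBP_seq MG; have [r' [Mr' rG']] := genBP_seq MG'.
  have EM : perm_eq M [seq <[bplant x]> | x <- r] by rewrite Mr.
  have EM' : perm_eq M' [seq <[bplant x]> | x <- r'] by rewrite Mr'.
  move=> e0; have e := bvec_inj (etrans (esym (E k r M EM)) (etrans e0 (E k' r' M' EM'))).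
  have kk : k = k'.
    by have := congr1 (@rootn d L) e; rewrite !rootn_tmul !rootn_prod !rootn_tX !addr0.
  subst k'; congr pair.
  have rr' : perm_eq r r'.
    have := rootb_mul_tprod k r; rewrite e perm_sym => /perm_trans; apply.
    exact: rootb_mul_tprod.
  rewrite -(seq_mset_id M) -(seq_mset_id M'); apply/eq_seq_msetP.
  by rewrite Mr Mr'; exact: perm_map.
move=> _ [a /(BP_E rule_compl)[k [s [sB ->]]] <-].
exists (k, seq_mset [seq <[bplant x]> | x <- s]).
  by move=> u; rewrite /= (perm_mem (perm_eq_seq_mset _)) => /mapP[x xs ->]; exists x => //; exact: sB.
apply: (etrans (E k s (seq_mset _) (perm_eq_seq_mset _))).
by rewrite tmulC.
Qed.

Lemma BHZ_A1 : assumptionA1 F.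
Proof.
split.
- exact: BP_monoid.
- exact: BP_free.
- by move=> _ [y [_ ypos _] <-]; rewrite /= hmgU.
- by move=> i; rewrite XpE /= hmgU thom_tX mlen_munit.
- move=> _ _ [a _ <-] [b _ <-]; rewrite mulpE mulTU /= !hmgU.
  exact: thom_tmul.
Qed.

Lemma BHZ_A2 : assumptionA2 S.
Proof.
move=> i; rewrite DeltapE XpE unitpE lextU DpX DeltaX1.
by rewrite !tensU.
Qed.

Lemma BHZ_A3 : assumptionA3 F.
Proof.
split.
- by move=> _ [a [Ba _] <-]; exists a.
- split.
  + move=> [k s] /= [a [Ba a0] <-]; exists (tX k ** a); first exact: BB_tX_mul.
    exact: fB_tX_mul.
  + move=> [k s] [k' s'] /set_mem /= [a [Ba a0] <-] /set_mem /= [b [Bb b0] <-].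
    rewrite -!fB_tX_mul // => /fB_inj e.
    have {}e : tX k ** a = tX k' ** b by apply: e; exact: BB_tX_mul.
    have kk : k = k' by have := congr1 (@rootn d L) e; rewrite !rootn_tmul a0 b0 !rootn_tX !addr0.
    subst k'; congr pair; apply: (f_equal fB); apply: (tmul_tX_inj e).
    by rewrite a0 b0.
  + move=> _ [a Ba <-]; exists (rootn a, fB (strip a)).
      exists (strip a) => //; split; last exact: rootn_strip.
      exact: BB_strip.
    by rewrite /= -fB_tX_mul ?rootn_strip // -stripE.
- by move=> s _; rewrite /= mulT1.
move=> k _ [a [Ba a0] <-]; rewrite /= -fB_tX_mul // !hmg_fB //; last exact: BB_tX_mul.
by rewrite thom_tmul thom_tX.
Qed.

End BasesAndA.

(** * Quotients, and assumptions (B) and (D) *)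

Section QuotientsBD.
Variables (R : realType) (d : nat) (L : finType) (h : L -> R).
Local Notation label := (L * mindex d)%type.
Local Notation dtree := (dtree d L).
Local Notation T := {malg R[dtree]}.
Local Notation TT := {malg R[dtree * dtree]}.
Local Notation tX := (tX L).
Variable rule : L -> set {mset label}%mset.
Hypothesis rule_norm : rule_normal rule.
Hypothesis rule_compl : rule_complete h rule.
Hypothesis indep : rationally_independent h.
Implicit Types (n k : mindex d) (a b c : dtree) (z w : TT) (u v : T).
Local Notation BB := (B_BHZ h rule).
Local Notation BP := (Bp_BHZ h rule).
Local Notation Dl := (Dl h).
Local Notation Dp := (Dp h).
Local Notation fB := (fB h).
Local Notation S := (BHZ h rule).
Local Notation basB := (basB h rule).

Lemma spacep_closed : subspace_closed (@spacep R d S).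
Proof. rewrite spacepE; exact: lspan_subspace. Qed.

Lemma spacep_bvec b : BP b -> @spacep R d S <[b]>.
Proof. by move=> Bb; rewrite spacepE; apply: lspan_mem; exists b. Qed.

Lemma quop_exists u : basis_vecs BP u ->
  exists g, @expansion R d S _ (basis_vecs BP) (@Defs.Deltap R d S u) g.
Proof.
move=> [a Ba <-]; apply: expansion_exists; first exact: spacep_closed.
rewrite DeltapE lextU; apply: supp_in_sub (Dp_supp rule_norm rule_compl Ba) _.
move=> [b c] [/= Bb Bc _]; split; first by apply: lspan_mem; exists b.
exact: spacep_bvec.
Qed.

Lemma quo_exists u : basB u -> exists g, @expansion R d S _ basB (@Defs.Delta R d S u) g.
Proof.
move=> [a Ba <-]; apply: expansion_exists; first exact: spacep_closed.
rewrite DeltaE; apply: supp_in_lext (fB_hom rule_norm rule_compl Ba) _ => b [Bb _].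
apply: supp_in_sub (BB_Dl rule_norm rule_compl Bb) _ => -[x y] [/= Bx By]; split.
  exact: tri_mem_lspan (fB_triBB rule_norm rule_compl) _ Bx.
exact: spacep_bvec.
Qed.

Variables (qp : T -> T -> T) (q : T -> T -> T).
Hypothesis qpP : forall t, basis_vecs BP t -> @expansion R d S _ (basis_vecs BP) (@Defs.Deltap R d S t) (qp t).
Hypothesis qP : forall t, basB t -> @expansion R d S _ basB (@Defs.Delta R d S t) (q t).
Local Notation F := (BHZ_frame h rule qp q).

(** The basis elements are homogeneous, so a condition that sees the left factor only through its
    homogeneity passes from the coproduct to the quotients by [expansion_supp]. *)
Lemma quo_supp (W : R -> dtree -> Prop) a : BB a ->
  supp_in (fun p => W (thom h p.1) p.2) (lext Dl (fB a)) ->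
  forall c, BB c -> supp_in (fun b => BP b /\ W (thom h c) b) (q (fB a) (fB c)).
Proof.
move=> Ba aW c Bc b bq; have ea := qP (ex_intro2 _ _ a Ba erefl); split.
  have : @spacep R d S (q (fB a) (fB c)) by case: ea.
  rewrite (spacepE h rule) lspan_basis_vecs; exact.
(* [expansion_supp] takes predicates on basis vectors; since [fB] is injective, the quantifier
   ranges over one tree. *)
pose Q (s : T) b := forall c, BB c -> s = fB c -> W (thom h c) b.
pose D (b x : dtree) := W (thom h x) b.
suff H : supp_in (Q (fB c)) (q (fB a) (fB c)) by exact: (H b bq c Bc erefl).
have Ai : lin_indep basB by have [] := basB_basis rule_norm rule_compl.
apply: (@expansion_supp R d S dtree Q D basB _ _ Ai ea).
- move=> _ y [x Bx <-] /(_ x Bx erefl) Wx.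
  by apply: supp_in_sub (fB_hom rule_norm rule_compl Bx) _ => x' [_ hx]; rewrite /D hx.
- move=> _ y [x Bx <-] nW; apply: supp_in_sub (fB_hom rule_norm rule_compl Bx) _ => x' [_ hx].
  by rewrite /D hx => Wx; apply: nW => c' Bc' /(fB_inj rule_norm rule_compl Bx Bc') <-.
- by rewrite DeltaE.
Qed.

Lemma quo_hom a c : BB a -> BB c ->
  supp_in (fun b => BP b /\ thom h c + thom h b = thom h a) (q (fB a) (fB c)).
Proof.
move=> Ba; apply: (@quo_supp (fun r b => r + thom h b = thom h a)) => //.
apply: supp_in_lext (fB_hom rule_norm rule_compl Ba) _ => b [Bb <-].
exact: Dl_thom.
Qed.

Lemma quop_mcoeff a b c : BP a -> BP c -> mcoeff b (qp <[a]> <[c]>) = mcoeff (c, b) (Dp a).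
Proof.
move=> Ba Bc; have e := qpP (ex_intro2 _ _ a Ba erefl).
by rewrite (expansion_mcoeff _ e Bc) DeltapE lextU.
Qed.

Lemma quop_hom a c : BP a -> BP c ->
  supp_in (fun b => BP b /\ thom h c + thom h b = thom h a) (qp <[a]> <[c]>).
Proof.
move=> Ba Bc b; rewrite -mcoeff_neq0 quop_mcoeff // mcoeff_neq0 => /(Dp_supp rule_norm rule_compl Ba).
by case.
Qed.

Lemma BpXE : @BpX R d S = basis_vecs (range tX).
Proof.
rewrite eqEsubset; split=> [_ [k _ <-]|_ [_ [k _ <-] <-]].
  by exists (tX k); [exists k|rewrite XpowE].
by exists k => //; rewrite XpowE.
Qed.

Lemma basis_vecsD (P Q : set dtree) :
  basis_vecs P `\` basis_vecs Q = basis_vecs (P `\` Q) :> set T.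
Proof.
rewrite eqEsubset; split=> [_ [[a Pa <-] nQ]|_ [a [Pa nQa] <-]].
  by exists a => //; split=> // Qa; apply: nQ; exists a.
by split; [exists a|move=> [b Qb /bvec_inj ba]; apply: nQa; rewrite -ba].
Qed.

Lemma lspan_BpD (Q : set dtree) u : supp_in (fun b => BP b /\ ~ Q b) u ->
  lspan (basis_vecs BP `\` basis_vecs Q) u.
Proof. by rewrite basis_vecsD lspan_basis_vecs. Qed.

Lemma is_one_tX e : is_one F e -> e = <[tX 0]> /\ BB (tX 0).
Proof.
move=> [[a [Ba a0] <-]]; rewrite /= (hmg_fB rule_norm rule_compl) // => ha.
have aX : a = tX 0 by rewrite (BB_int indep (z := 0) Ba) // a0.
by move: Ba; rewrite aX fB_tX.
Qed.

Lemma BX_tX u : BX F u -> exists k, [/\ u = <[tX k]>, BB (tX k) & BB (tX 0)].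
Proof.
move=> [k [e [/is_one_tX[-> B0] ->]]]; exists k; rewrite /= mulTU tmulr1; split=> //.
by rewrite -[tX k]tmulr1; exact: BB_tX_mul.
Qed.

Lemma one_is_one : BB (tX 0) -> is_one F <[tX 0]>.
Proof.
move=> B0; split; last by rewrite /= hmgU thom_tX mlen0.
by exists (tX 0); [rewrite /= rootn_tX|rewrite fB_tX].
Qed.

Lemma BHZ_B : assumptionB F.
Proof.
split.
- move=> _ _ [[[c Bc <-] [a Ba <-] _] _]; rewrite BpXE.
  have H := quo_hom Ba Bc.
  (* All right factors have homogeneity |a| - |c|: if this is an integer, they are all powers of X;
     if not, none of them is. *)
  have [[z zE]|nz] := pselect (exists z : int, thom h a - thom h c = z%:~R).
    left; rewrite lspan_basis_vecs; apply: supp_in_sub H _ => b [Bb hb].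
    exists (rootn b) => //; apply/esym.
    by apply: (BP_int rule_compl indep (z := z)) => //; rewrite -zE -hb addrC addKr.
  right; apply: lspan_BpD; apply: supp_in_sub H _ => b [Bb hb]; split=> // -[k _ bk].
  apply: nz; exists (mlen k); rewrite -hb addrC addKr -bk.
  exact: thom_tX.
- rewrite BpXE => _ _ [[a Ba <-] na] [_ [k _ <-] <-].
  apply: lspan_BpD; apply: supp_in_sub (quop_hom Ba (BP_tX rule_compl k)) _ => b [Bb hb].
  split=> // -[j _ bj]; apply: na; exists a => //; exists (rootn a) => //; apply/esym.
  apply: (BP_int rule_compl indep (z := (mlen k + mlen j)%N)) => //.
  by rewrite -hb -bj !thom_tX -natrD.
move=> _ s [[a Ba <-] na] /BX_tX[k [-> Bk B0]]; rewrite BpXE -(fB_tX h k).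
apply: lspan_BpD; apply: supp_in_sub (quo_hom Ba Bk) _ => b [Bb hb].
split=> // -[j _ bj]; apply: na; exists (rootn a), <[tX 0]>; split; first exact: one_is_one.
rewrite /= mulTU tmulr1 -(fB_tX h); congr fB.
apply: (BB_int indep (z := (mlen k + mlen j)%N) Ba).
by rewrite -hb -bj !thom_tX -natrD.
Qed.

Lemma chi_BP k b : BP b -> chi R k b = (b == tX k)%:R.
Proof.
move=> Bb; rewrite /chi; have [->|bk] := eqVneq b (tX k); first by rewrite rootn_tX rootb_tX !eqxx.
case: eqP => [nk|//]; case: eqP => [b0|//]; case/eqP: bk.
by apply: rootE; rewrite ?rootn_tX ?rooto_tX ?rootb_tX ?b0 //; exact: BP_rooto Bb.
Qed.

(** Contraction with [chi k] kills the coproduct of a recentered tree, hence each of its quotients;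
    on T+ this form is the coefficient of X^k by [chi_BP]. *)
Lemma BHZ_D : assumptionD F.
Proof.
move=> _ _ [a [Ba a0] <-] [c Bc <-].
have -> : [set Xpow S k | k in [set k | k != 0]] = basis_vecs [set tX k | k in [set k | k != 0]].
  rewrite eqEsubset; split=> [_ [k k0 <-]|_ [_ [k k0 <-] <-]].
    by exists (tX k); [exists k|rewrite XpowE].
  by exists k => //; rewrite XpowE.
have H := quo_hom Ba Bc.
apply: lspan_BpD => b bq; have [Bb _] := H b bq; split=> // -[k /= k0 bk].
have e := qP (ex_intro2 _ _ a Ba erefl).
have Z : contract (chi R k) (@Defs.Delta R d S (fB a)) = 0.
  by rewrite DeltaE fB_rootn0 // recenter_coef.
have Ai : lin_indep basB by have [] := basB_basis rule_norm rule_compl.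
have := expansion_contract0 Ai e Z (fB c).
rewrite (bigD1_seq b bq (fset_uniq _)) /=.
rewrite big_seq_cond big1 => [|x /andP[xq xb]].
  rewrite -bk chiXX mulr1 addr0 bk => /eqP; apply/negP; by rewrite mcoeff_neq0.
have [Bx _] := H x xq; rewrite chi_BP //; move: xb; rewrite -bk => /negbTE->.
exact: mulr0.
Qed.

End QuotientsBD.

(** * Multiplication by powers of X *)

Section MultiplicativityA4.
Variables (R : realType) (d : nat) (L : finType) (h : L -> R).
Local Notation label := (L * mindex d)%type.
Local Notation dtree := (dtree d L).
Local Notation T := {malg R[dtree]}.
Local Notation TT := {malg R[dtree * dtree]}.
Local Notation "a ** b" := (tmul a b) (at level 40, left associativity).
Local Notation tX := (tX L).
Variable rule : L -> set {mset label}%mset.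
Hypothesis rule_norm : rule_normal rule.
Hypothesis rule_compl : rule_complete h rule.
Hypothesis indep : rationally_independent h.
Implicit Types (n k : mindex d) (a b c : dtree) (z w : TT) (u v : T).
Local Notation BB := (B_BHZ h rule).
Local Notation BP := (Bp_BHZ h rule).
Local Notation Dl := (Dl h).
Local Notation fB := (fB h).
Local Notation S := (BHZ h rule).
Local Notation basB := (basB h rule).
Local Notation basBdot := (basBdot h rule).

Variables (qp : T -> T -> T) (q : T -> T -> T).
Hypothesis qP : forall t, basB t -> @expansion R d S _ basB (@Defs.Delta R d S t) (q t).
Local Notation F := (BHZ_frame h rule qp q).

Lemma prod2_tens u v u' v' :
  prod2 (tens u v) (tens u' v') = tens (prodT u u') (prodT v v').
Proof.
rewrite [u']malgEU tens_suml [prodT u _]mulTE /convol linear_sum /= tens_suml.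
rewrite mul2E /convol linear_sum /=; apply: eq_bigr => a _.
rewrite tensZl !linearZ /= tensZl; congr (_ *: _).
rewrite [v']malgEU tens_sumr [prodT v _]mulTE /convol !linear_sum /= tens_sumr.
apply: eq_bigr => b _; rewrite tensZr !linearZ /= tensZr; congr (_ *: _).
by rewrite tensU; have := prod2_tensU u v a b; rewrite mul2E !mulTE.
Qed.

Lemma prodT0l u : prodT 0 u = 0.
Proof. by rewrite mulTE convol0l. Qed.

Lemma prodT0r u : prodT u 0 = 0.
Proof. by rewrite mulTE convol0r. Qed.

Lemma prod2_suml (I : Type) (r : seq I) (G : I -> TT) w :
  prod2 (\sum_(i <- r) G i) w = \sum_(i <- r) prod2 (G i) w.
Proof.
elim: r => [|i r IH]; first by rewrite !big_nil mul2E convol0l.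
by rewrite !big_cons -IH !mul2E convolDl.
Qed.

Lemma prod2_sumr (I : Type) (r : seq I) (G : I -> TT) z :
  prod2 z (\sum_(i <- r) G i) = \sum_(i <- r) prod2 z (G i).
Proof. by rewrite mul2C prod2_suml; apply: eq_bigr => i _; rewrite mul2C. Qed.

Lemma map_lift (A B : eqType) (P : A -> Prop) (f : A -> B) (s : seq B) :
  (forall y, y \in s -> exists2 x, P x & f x = y) ->
  exists2 r, s = map f r & forall x, x \in r -> P x.
Proof.
elim: s => [|y s IH] sP; first by exists [::].
have [x Px xy] := sP y (mem_head _ _).
have [|r -> rP] := IH; first by move=> z zs; apply: sP; rewrite inE zs orbT.
exists (x :: r); first by rewrite /= xy.
by move=> z; rewrite inE => /orP[/eqP->|/rP].
Qed.

Lemma Xact_inj k k' u u' : basBdot u -> basBdot u' ->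
  prodT <[tX k]> u = prodT <[tX k']> u' -> k = k' /\ u = u'.
Proof.
move=> [a [Ba a0] <-] [b [Bb b0] <-]; rewrite -!fB_tX_mul // => e.
have {}e := fB_inj rule_norm rule_compl (BB_tX_mul k Ba)
  (BB_tX_mul k' Bb) e.
have kk : k = k' by have := congr1 (@rootn d L) e; rewrite !rootn_tmul a0 b0 !rootn_tX !addr0.
subst k'; split=> //; apply: (f_equal fB); apply: (tmul_tX_inj e).
by rewrite a0 b0.
Qed.

(** [Xprod] sums over pairs (m, s), so the expansion is spread over a rectangle N x E, possibly
    larger than its support. *)
Lemma Delta_double_sum t : basB t -> exists (N : seq (mindex d)) (E : seq T),
  [/\ uniq N, uniq E, forall s, s \in E -> basBdot s,
      forall m s, basBdot s -> ~~ ((m \in N) && (s \in E)) -> q t (prodT <[tX m]> s) = 0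
    & lext Dl t = \sum_(m <- N) \sum_(s <- E)
        tens (prodT <[tX m]> s) (q t (prodT <[tX m]> s))].
Proof.
move=> Bt; have [r [ur rA gr zE]] := expansion_seq (qP Bt).
have [A rE AB] := map_lift rA.
pose N := undup (map (@rootn d L) A); pose E := undup (map (fun a => fB (strip a)) A).
have Edot s : s \in E -> basBdot s.
  rewrite mem_undup => /mapP[a /AB Ba ->]; exists (strip a) => //; split.
    exact: BB_strip Ba.
  exact: rootn_strip.
pose P := [seq prodT <[tX m]> s | m <- N, s <- E].
have rP u : u \in r -> u \in P.
  rewrite rE => /mapP[a aA ->]; apply/allpairsP; exists (rootn a, fB (strip a)).
  split; [by rewrite mem_undup; exact: (map_f (@rootn d L))|by rewrite mem_undup; exact: (map_f (fun a => fB (strip a)))|].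
  by rewrite /= -fB_tX_mul ?rootn_strip // -stripE.
have PB u : u \in P -> basB u.
  move=> /allpairsP[[m s] /= [_ /Edot[a [Ba a0] <-] ->]].
  by exists (tX m ** a); [exact: BB_tX_mul|rewrite fB_tX_mul].
exists N, E; split; [exact: undup_uniq|exact: undup_uniq|exact: Edot| |].
- move=> m s ds mE; apply: gr; apply: contra mE => /rP/allpairsP[[m' s'] /= [mN sE e]].
  by have [-> ->] := Xact_inj ds (Edot _ sE) e; rewrite mN.
have Pz u : u \notin P -> q t u = 0 by move=> uP; apply: gr; apply: contra uP => /rP.
have uP : uniq P.
  apply: allpairs_uniq; [exact: undup_uniq|exact: undup_uniq|].
  move=> [m s] [m' s'] /allpairsP[[x y] /= [_ /Edot ds [-> ->]]].
  move=> /allpairsP[[x' y'] /= [_ /Edot ds' [-> ->]]] e.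
  by have [-> ->] := Xact_inj ds ds' e.
have -> : lext Dl t = \sum_(u <- P) tens u (q t u).
  transitivity (@Defs.Delta R d S t); first by rewrite DeltaE.
  have [_ _ _ et] := qP Bt; exact: (etrans et (expansion_widen (S := S) uP PB Pz)).
by rewrite /P big_allpairs_dep.
Qed.

(** The left factors of Delta X^k have integer homogeneity, and in T only the powers of X have
    one. *)
Lemma quo_tX k c : BB (tX k) -> BB c -> ~ range tX c -> q <[tX k]> (fB c) = 0.
Proof.
move=> Bk Bc nc; rewrite -(fB_tX h k).
apply: (@supp_in_eq0 _ _ (fun b => BP b /\ exists m : nat, thom h c = m%:R)) => [|b [_ [m hm]]].
  apply: (quo_supp rule_norm rule_compl (q := q) qP (W := fun x _ => exists m : nat, x = m%:R) Bk _ Bc).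
  rewrite fB_tX lextU DlX; apply: supp_in_sub (@supp_in_DeltaX R d L k) _ => _ [i [j [-> _]]].
  by exists (mlen i); rewrite /= thom_tX.
by apply: nc; exists (rootn c) => //; apply/esym/(BB_int indep (z := m) Bc).
Qed.

Lemma Delta_tX_sum k : BB (tX k) -> exists N : seq (mindex d),
  [/\ uniq N, forall m, m \notin N -> q <[tX k]> <[tX m]> = 0
    & Dl (tX k) = \sum_(m <- N) tens <[tX m]> (q <[tX k]> <[tX m]>)].
Proof.
move=> Bk; have Bt : basB <[tX k]> by exists (tX k); rewrite ?fB_tX.
have [N [E [uN uE Ed NE e]]] := Delta_double_sum Bt.
have B0 : BB (tX 0) by apply: (BB_clear (rule := rule) (n := k)); rewrite ?rootn_tX ?tmulr1.
have d0 : basBdot <[tX 0]> by exists (tX 0); rewrite ?fB_tX //=; rewrite rootn_tX.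
have mE m : prodT <[tX m]> <[tX 0]> = <[tX m]> :> T by rewrite mulTU tmulr1.
exists N; split=> // [m mN|]; first by rewrite -(mE m) NE // negb_and mN.
rewrite lextU in e; rewrite e; apply: eq_bigr => m _.
(* For s other than 1 the tree behind X^m s is not a power of X, so [quo_tX] applies; the rectangle
   reduces to the column of 1. *)
have Z s : s \in E -> s != <[tX 0]> -> q <[tX k]> (prodT <[tX m]> s) = 0.
  move=> /Ed ds s0; case: (ds) => a [Ba a0] as_; rewrite -as_ -fB_tX_mul //.
  apply: quo_tX => //; first exact: BB_tX_mul.
  move=> [j _ ja]; move: s0; rewrite -as_.
  have -> : a = tX 0.
    apply: (@tmul_tX_inj _ _ m); last by rewrite a0 rootn_tX.
    have := congr1 (@rootn d L) ja; rewrite rootn_tmul a0 !rootn_tX addr0 => jm.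
    by rewrite tmulr1 -ja jm.
  by rewrite fB_tX => /eqP; apply.
have [sE|sE] := boolP (<[tX 0]> \in E).
  rewrite (bigD1_seq <[tX 0]> sE uE) /= mE big_seq_cond big1 ?addr0 //.
  by move=> s /andP[sE' s0]; rewrite Z // tens0r.
rewrite -[in RHS](mE m) NE //; last by rewrite negb_and sE orbT.
rewrite tens0r big_seq big1 // => s sE'; rewrite Z ?tens0r //.
by apply: contraNneq sE => <-.
Qed.

Lemma fsum_triple (T1 T2 T3 : choiceType) (V : nmodType) (A1 : set T1) (A2 : set T2) (A3 : set T3)
    (r1 : seq T1) (r2 : seq T2) (r3 : seq T3) (G : T1 -> T2 -> T3 -> V) :
  uniq r1 -> uniq r2 -> uniq r3 -> (forall i, i \in r1 -> A1 i) ->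
  (forall i, i \in r2 -> A2 i) -> (forall i, i \in r3 -> A3 i) ->
  (forall i j l, A1 i -> A2 j -> A3 l -> ~~ [&& i \in r1, j \in r2 & l \in r3] -> G i j l = 0) ->
  \sum_(i \in A1) \sum_(j \in A2) \sum_(l \in A3) G i j l =
  \sum_(i <- r1) \sum_(j <- r2) \sum_(l <- r3) G i j l.
Proof.
move=> u1 u2 u3 rA1 rA2 rA3 G0; rewrite (fsum_seqE u1 rA1) => [|i Ai ni]; last first.
  rewrite fsbig1 // => j Aj; rewrite fsbig1 // => l Al.
  by apply: G0 => //; rewrite (negbTE ni).
rewrite [LHS]big_seq [RHS]big_seq; apply: eq_bigr => i ir.
rewrite (fsum_seqE u2 rA2) => [|j Aj nj]; last first.
  rewrite fsbig1 // => l Al; apply: G0 => //; first exact: rA1.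
  by rewrite (negbTE nj) andbF.
rewrite [LHS]big_seq [RHS]big_seq; apply: eq_bigr => j jr.
apply: fsum_seqE => // l Al nl; apply: G0 => //; [exact: rA1|exact: rA2|].
by rewrite (negbTE nl) !andbF.
Qed.

(** By multiplicativity of Delta, the product of the expansions of X^k and of t; grouped by its
    indices it is [Xprod] term by term. *)
Lemma Delta_Xprod k t : BB (tX k) -> basB t ->
  lext Dl (prodT <[tX k]> t) = Xprod F (fun m => q <[tX k]> (prodT <[tX m]> <[tX 0]>)) (q t).
Proof.
move=> Bk Bt; have [M [uM zM eM]] := Delta_tX_sum Bk.
have [N [E [uN uE Ed NE eN]]] := Delta_double_sum Bt.
have mE m : prodT <[tX m]> <[tX 0]> = <[tX m]> :> T by rewrite mulTU tmulr1.
pose G l m s : TT := tens (prodT <[tX (l + m)]> s)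
  (prodT (q <[tX k]> (prodT <[tX l]> <[tX 0]>)) (q t (prodT <[tX m]> s))).
transitivity (\sum_(l \in [set: mindex d]) \sum_(m \in [set: mindex d]) \sum_(s \in basBdot) G l m s).
  rewrite (@fsum_triple _ _ _ _ setT setT basBdot M N E) //; last first.
    move=> l m s _ _ ds nE; rewrite /G; have [lM|lM] := boolP (l \in M); last first.
      by rewrite mE zM // prodT0l tens0r.
    by rewrite NE //; [rewrite prodT0r tens0r|move: nE; rewrite lM].
  rewrite (lext_mulT _ _ (DlM h)) lextU eM eN prod2_suml; apply: eq_bigr => l _.
  rewrite prod2_sumr; apply: eq_bigr => m _; rewrite prod2_sumr; apply: eq_bigr => s _.
  by rewrite /G mE prod2_tens mulTA mulTU -tX_add.
apply: eq_fsbigr => l _; apply: eq_fsbigr => m _; apply: eq_fsbigr => s _.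
apply: (f_equal2 (@tens R dtree dtree)); first by [].
exact: (esym (mulpE h rule _ _)).
Qed.

Lemma BHZ_A4 : assumptionA4 F.
Proof.
move=> e /(is_one_tX rule_norm rule_compl indep)[-> B0].
have Bk k : BB (tX k) by rewrite -[tX k]tmulr1; exact: BB_tX_mul.
have mE m : prodT <[tX m]> <[tX 0]> = <[tX m]> :> T by rewrite mulTU tmulr1.
split.
- by move=> e' /(is_one_tX rule_norm rule_compl indep)[].
- by rewrite DeltaE unitpE lextU DlX DeltaX0 tensU.
- by move=> i; rewrite DeltaE XpE unitpE /= mE lextU DlX DeltaX1 !tensU.
- move=> k l; rewrite DeltaE /= !mE tX_add -mulTU; apply: Delta_Xprod => //.
  by exists (tX l); rewrite ?fB_tX.
move=> k s [a [Ba a0] <-]; rewrite DeltaE /= mE; apply: Delta_Xprod => //.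
by exists a.
Qed.

End MultiplicativityA4.

(** * Generators of T+ and their preorder *)

Section GeneratorsC.
Variables (R : realType) (d : nat) (L : finType) (h : L -> R).
Local Notation label := (L * mindex d)%type.
Local Notation odeco := ({ffun 'I_d -> int} * {ffun L -> int})%type.
Local Notation dtree := (dtree d L).
Local Notation T := {malg R[dtree]}.
Local Notation TT := {malg R[dtree * dtree]}.
Local Notation "a ** b" := (tmul a b) (at level 40, left associativity).
Local Notation tX := (tX L).
Variable rule : L -> set {mset label}%mset.
Hypothesis rule_norm : rule_normal rule.
Hypothesis rule_sub : rule_subcritical h rule.
Hypothesis rule_compl : rule_complete h rule.
Hypothesis indep : rationally_independent h.
Implicit Types (n k : mindex d) (a b c : dtree) (z w : TT) (u v : T).
Local Notation BB := (B_BHZ h rule).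
Local Notation BP := (Bp_BHZ h rule).
Local Notation Dl := (Dl h).
Local Notation Dp := (Dp h).
Local Notation S := (BHZ h rule).
Local Notation tprod s := (\big[@tmul d L/tX 0]_(x <- s) bplant x).

Definition ecnt a : int := \sum_t cnt t a.

Lemma ecnt_tmul a b : ecnt (a ** b) = ecnt a + ecnt b.
Proof. by rewrite /ecnt -big_split; apply: eq_bigr => t _; exact: cnt_tmul. Qed.

Lemma ecnt_tX n : ecnt (tX n) = 0.
Proof. by rewrite /ecnt big1 // => t _; exact: cnt_tX. Qed.

Lemma ecnt_plant l k a : ecnt (plant l k a) = 1 + ecnt a.
Proof.
rewrite /ecnt (eq_bigr _ (fun t _ => cnt_plant t l k a)) big_split /=; congr (_ + _).
by rewrite (bigD1 l) //= eqxx big1 ?addr0 // => t /negbTE ->.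
Qed.

Lemma Dl_ecnt a : supp_in (fun p => ecnt p.1 + ecnt p.2 = ecnt a) (Dl a).
Proof.
move=> p pa; rewrite /ecnt -big_split; apply: eq_bigr => t _.
have cD (o o' : odeco) : (o + o').2 t = o.2 t + o'.2 t by rewrite ffunE.
apply: (@Dl_weight R d L h int 0 (fun o : odeco => o.2 t) (fun x : label => (t == x.1)%:Z) cD _ a p pa).
by move=> l k j; rewrite mul0rn subr0.
Qed.

Lemma BB_ecnt_ge0 a : BB a -> 0 <= ecnt a.
Proof. by move=> Ba; apply: sumr_ge0 => t _; exact: (BB_cnt_ge0 t Ba). Qed.

Lemma BP_ecnt_ge0 a : BP a -> 0 <= ecnt a.
Proof. by move=> Ba; apply: sumr_ge0 => t _; exact: (BP_cnt_ge0 rule_compl t Ba). Qed.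

(** Excludes, in the coproducts of T+, every factor of homogeneity 0 other than 1. *)
Lemma BP_thom_gt0 a : BP a -> a = tX 0 \/ 0 < thom h a.
Proof.
move=> /(BP_E rule_compl)[k [s [sB ->]]]; rewrite thom_tmul thom_tX.
have s_ge0 (r : seq (label * dtree)) : (forall x, x \in r -> 0 < thom h (bplant x)) -> 0 <= thom h (tprod r).
  elim: r => [|x r IH] rB; first by rewrite big_nil thom_tX.
  rewrite big_cons thom_tmul addr_ge0 //; first by apply/ltW/rB/mem_head.
  by apply: IH => y yr; apply: rB; rewrite inE yr orbT.
case: s sB => [|x s] sB.
  rewrite big_nil tmul1 thom_tX mlen0 add0r ltr0n lt0n mlen_eq0.
  by case: eqP => [->|_]; [left|right].
right; rewrite ltr_wpDr // big_cons thom_tmul ltr_pwDl //.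
  by have [] := sB x (mem_head _ _).
by apply: s_ge0 => y ys; have [] := sB y; rewrite // inE ys orbT.
Qed.

(** On T+ the coefficient of 1 is the form [chi 0], so the counit property applies. *)
Lemma Dp_coef_one l k a b : BP (plant l k a) ->
  mcoeff (b, tX 0) (Dp (plant l k a)) = (plant l k a == b)%:R.
Proof.
move=> Bp; have [_ pos _] := BP_plantE rule_compl Bp.
rewrite -mcoeff_contract1.
have -> : contract (fun x => (x == tX 0)%:R) (Dp (plant l k a)) = contract (chi R 0) (Dp (plant l k a)).
  rewrite !contractE; apply: eq_lext => -[x y] /(Dp_supp rule_norm rule_compl Bp)[_ By _] /=.
  by rewrite -(chi_BP (h := h) (rule := rule)).
by rewrite contract_chi0_Dp // mcoeffU1.
Qed.

Variables (qp : T -> T -> T) (q : T -> T -> T).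
Hypothesis qpP : forall t, basis_vecs BP t -> @expansion R d S _ (basis_vecs BP) (@Defs.Deltap R d S t) (qp t).
Local Notation F := (BHZ_frame h rule qp q).
Local Notation qp_mcoeff := (quop_mcoeff (h := h) (rule := rule) (qp := qp) qpP).

Lemma Dk_plant l k a : BP (plant l 0 a) ->
  Dk F k <[plant l 0 a]> = if 0 < thom h (plant l k a) then <[plant l k a]> else 0.
Proof.
move=> Ba; rewrite /Dk /= XpowE; apply/malgP => b.
rewrite mcoeffZ qp_mcoeff //; last exact: BP_tX.
rewrite Dp_coef_tX add0r; case: ifP => _; last by rewrite mulr0 mcoeff0.
by rewrite mulrA divff ?mfact_neq0 // mul1r mcoeffU1.
Qed.

Definition gensG : set T := [set <[plant x.1 0 x.2]> | x in
  [set x : L * dtree | BP (plant x.1 0 x.2)]].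

Lemma thom_plant0 l k a : thom h (plant l k a) = thom h (plant l 0 a) - (mlen k)%:R.
Proof. by rewrite !thom_plant mlen0 subr0 addrAC. Qed.

Lemma BP_plant_iff l k a : BP (plant l k a) <-> BP (plant l 0 a) /\ 0 < thom h (plant l k a).
Proof.
split=> [/(BP_plantE rule_compl)[Ba pos ra]|[/(BP_plantE rule_compl)[Ba _ ra] pos]].
  split=> //; apply: BP_plant => //; apply: lt_le_trans pos _.
  by rewrite thom_plant0 lerBlDr lerDl.
exact: BP_plant.
Qed.

Lemma DorbitE l a u : BP (plant l 0 a) ->
  Dorbit F <[plant l 0 a]> u <-> exists2 k, BP (plant l k a) & u = <[plant l k a]>.
Proof.
move=> Ba; split.
  move=> [k /= hk <-]; rewrite Dk_plant //.
  have pos : 0 < thom h (plant l k a) by rewrite thom_plant0 -[thom h _](hmgU (thom h)).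
  by rewrite pos; exists k => //; apply/BP_plant_iff.
move=> [k /BP_plant_iff[_ pos] ->]; exists k; last by rewrite Dk_plant // pos.
by rewrite /= hmgU -thom_plant0.
Qed.

Lemma gensG_fin : finite_graded (gensG : set {malg R[symbp S]}).
Proof.
move=> c; have : finite_set (\bigcup_(l in [set: L])
    ((fun a => <[plant l 0 a]> : T) @` [set a | BB a /\ thom h a <= c - h l])).
  by apply: bigcup_finite => // l _; apply: finite_image; exact: finite_BB.
apply: sub_finite_set => _ [[[l a] /= Ba <-] hc]; exists l => //; exists a => //.
have [B0 _ _] := BP_plantE rule_compl Ba; split=> //.
by move: hc; rewrite hmgU thom_plant mlen0 subr0 lerBrDl.
Qed.

Lemma genBPE : genBP h rule = \bigcup_(t in gensG) Dorbit F t.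
Proof.
rewrite eqEsubset; split.
  move=> _ [[[l k] a] [/= Ba pos ra] <-].
  have /BP_plant_iff[B0 _] : BP (plant l k a) by exact: BP_plant.
  exists <[plant l 0 a]>; first by exists (l, a).
  by apply/DorbitE => //; exists k => //; exact: BP_plant.
move=> u [_ [[l a] /= Ba <-]] /(DorbitE _ Ba)[k /(BP_plantE rule_compl)[? ? ?] ->].
by exists (l, k, a).
Qed.

Lemma gensG_triv : trivIset gensG (Dorbit F).
Proof.
move=> _ _ [[l a] /= Ba <-] [[l' a'] /= Ba' <-] [u [/(DorbitE _ Ba)[k _ ->] /(DorbitE _ Ba')[k' _]]].
by move=> /bvec_inj/plant_inj[-> _ ->].
Qed.

Local Notation hE := (hmg (fun a => (ecnt a)%:~R : R)).
(** On the vector of a tree [hE] is its number of edges. The homogeneity breaks ties: a term c (x)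
    X^j of Delta a has as many edges in c as in a. *)
Definition preo (u v : T) : Prop :=
  hE u < hE v \/ hE u = hE v /\ hmg (thom h) u <= hmg (thom h) v.

Lemma preo_refl u : preo u u. Proof. by right. Qed.

Lemma preo_trans u v (w : T) : preo u v -> preo v w -> preo u w.
Proof.
move=> [uv|[uv huv]] [vw|[vw hvw]].
- by left; exact: lt_trans vw.
- by left; rewrite -vw.
- by left; rewrite uv.
- by right; rewrite uv; split=> //; exact: le_trans hvw.
Qed.

Lemma preo_strict a b : (ecnt a <= ecnt b) -> (ecnt a < ecnt b) || (thom h a < thom h b) ->
  preo <[a]> <[b]> /\ ~ preo <[b]> <[a]>.
Proof.
move=> ab; rewrite /preo !hmgU !ltr_int; have [lt _|le] /= := ltP (ecnt a) (ecnt b).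
  split; first by left.
  by move=> [|[/intr_inj e _]]; [rewrite ltNge ltW|rewrite e ltxx in lt].
move=> lt; have e : ecnt a = ecnt b by apply/le_anti; rewrite ab.
rewrite e; split; first by right; split=> //; exact: ltW.
by move=> [|[_]]; [rewrite ltxx|rewrite leNgt lt].
Qed.

Lemma submonoid_mul (A : set T) (u v : {malg R[symbp S]}) : submonoid (S := S) A u -> submonoid (S := S) A v ->
  submonoid (S := S) A (prodT u v).
Proof.
move=> [s [sA ->]] [r [rA ->]]; exists (s ++ r); split.
  by move=> a; rewrite mem_cat => /orP[/sA|/rA].
by rewrite !prodpE big_cat.
Qed.

Lemma submonoid_gen (A : set T) (u : {malg R[symbp S]}) : A u -> submonoid (S := S) A u.
Proof.
move=> Au; exists [:: u]; split; first by move=> a; rewrite inE => /eqP->.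
by rewrite prodpE big_seq1.
Qed.

Lemma submonoid_one (A : set T) : submonoid (S := S) A (<[tX 0]> : T).
Proof. by exists [::]; split=> //; rewrite prodpE big_nil. Qed.

(** b is a product of some X_i and of planted trees I_j(a) = D^j I_0(a), so only the I_0(a) have to
    be compared with t. *)
Lemma Bminus_bvec t b : BP b ->
  (forall l k a, (l, k, a) \in rootb b -> preo <[plant l 0 a]> t /\ ~ preo t <[plant l 0 a]>) ->
  Bminus F gensG preo t <[b]>.
Proof.
move=> /(BP_E rule_compl)[k [s [sB ->]]] sT.
have {}sT l j a : (l, j, a) \in s -> preo <[plant l 0 a]> t /\ ~ preo t <[plant l 0 a]>.
  move=> ls; apply: (sT l j a); rewrite (perm_mem (rootb_tmul _ _)) rootb_tX cats0.
  by rewrite (perm_mem (rootb_prod _)).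
rewrite -mulTU /Bminus; apply: submonoid_mul.
  elim: s sB sT => [|[[l j] a] s IH] sB sT; first by rewrite big_nil; exact: submonoid_one.
  rewrite big_cons -mulTU; apply: submonoid_mul; last first.
    apply: IH => [x xs|l' j' a' xs]; first by apply: sB; rewrite inE xs orbT.
    by apply: (sT l' j'); rewrite inE xs orbT.
  apply: submonoid_gen; right.
  have [/= Ba pos ra] := sB _ (mem_head _ _).
  have Bp : BP (plant l j a) by exact: BP_plant.
  have [B0 _] := (BP_plant_iff l j a).1 Bp.
  exists <[plant l 0 a]>.
    by have [? ?] := sT _ _ _ (mem_head _ _); split=> //; exists (l, a).
  by apply/DorbitE => //; exists j.
elim/mindex_ind: k => [|i|n k IHn IHk]; first exact: submonoid_one.
  by apply: submonoid_gen; left; exists i => //; rewrite XpE.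
by rewrite tX_add -mulTU; exact: submonoid_mul.
Qed.

Lemma Dp_plant_supp l k a : supp_in (fun p => range tX p.1 \/
  exists2 c, p.1 = plant l k c & (c, p.2) \in msupp (Dl a)) (Dp (plant l k a)).
Proof.
rewrite DpP; apply: supp_inD.
  apply: (@supp_in_plantLp R d L h (fun p => p \in msupp (Dl a))) => [p //|c b cb _].
  by right; exists c.
by apply: supp_in_Taylor => j _; left; exists j.
Qed.

Lemma ecnt_rootb b x : BP b -> x \in rootb b -> ecnt (bplant x) <= ecnt b.
Proof.
move=> Bb; have /(BP_E rule_compl)[k [s [sB bE]]] := Bb.
have bs : perm_eq (rootb b) s.
  by rewrite bE; apply: perm_trans (rootb_tmul _ _) _; rewrite rootb_tX cats0 rootb_prod.
rewrite (perm_mem bs) bE ecnt_tmul ecnt_tX addr0 {b Bb bE bs}.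
have ge0 y : y \in s -> 0 <= ecnt (bplant y).
  by move=> /sB[? ? ?]; apply: BP_ecnt_ge0; exact: BP_plant.
elim: s ge0 {sB} => [//|y s IH] ge0; rewrite inE big_cons ecnt_tmul.
have {}IH := IH (fun y' ys => ge0 y' (mem_behead (s := y :: s) ys)).
have s0 : 0 <= ecnt (tprod s).
  elim: s {IH} ge0 => [|y' s IHs] ge0; first by rewrite big_nil ecnt_tX.
  rewrite big_cons ecnt_tmul addr_ge0 //; first by apply: ge0; rewrite !inE eqxx orbT.
  by apply: IHs => x'; rewrite inE => /orP[|] xs; apply: ge0; rewrite !inE xs ?orbT.
move=> /orP[/eqP->|/IH xs]; first by rewrite lerDl.
by rewrite (le_trans xs) // lerDr ge0 // mem_head.
Qed.

Lemma quop_branch l a s b : BP (plant l 0 a) -> BP s -> ~ range tX s -> s <> plant l 0 a ->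
  b \in msupp (qp <[plant l 0 a]> <[s]>) ->
  exists c, [/\ s = plant l 0 c, BB c, BP b, ecnt c + ecnt b = ecnt a
               & thom h s < thom h (plant l 0 a)].
Proof.
move=> Bp Bs nX sp; rewrite -mcoeff_neq0 qp_mcoeff // => m0.
have := m0; rewrite mcoeff_neq0 => bs.
have [//|[c /= sc cb]] := Dp_plant_supp bs; exists c.
have [_ Bb hb] := Dp_supp rule_norm rule_compl Bp bs; rewrite /= in Bb hb.
have [Bc _ _] : [/\ BB c, 0 < thom h (plant l 0 c) & rule l (rset c)].
  by apply: (BP_plantE rule_compl); rewrite -sc.
split=> //; first exact: (Dl_ecnt cb).
rewrite -hb ltrDl; have [b1|//] := BP_thom_gt0 Bb.
move: m0; rewrite b1 Dp_coef_one //; have [e|_] := eqVneq (plant l 0 a) s; last by rewrite eqxx.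
by case: sp.
Qed.

(** s has at most as many edges as the generator and precedes it by its homogeneity. The branches of
    the quotient precede it by their edges alone: each has at most [ecnt a] of them, and the
    generator has one more. *)
Lemma below_quop l a s : BP (plant l 0 a) -> BP s -> ~ range tX s -> s <> plant l 0 a ->
  qp <[plant l 0 a]> <[s]> != 0 ->
  Bminus F gensG preo <[plant l 0 a]> <[s]> /\
  lspan (Bminus F gensG preo <[plant l 0 a]>) (qp <[plant l 0 a]> <[s]>).
Proof.
move=> Bp Bs nX sp q0; split.
  have [b bq] : exists b, b \in msupp (qp <[plant l 0 a]> <[s]>).
    apply: contrapT => nb; case/eqP: q0.
    by apply: (@supp_in_eq0 _ _ (fun=> False)) => // b bq; apply: nb; exists b.
  have [c [sc Bc Bb ecb lt]] := quop_branch Bp Bs nX sp bq.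
  apply: Bminus_bvec => // l' k' c'; rewrite sc rootb_plant inE => /eqP[-> _ ->].
  apply: preo_strict; last by rewrite -sc lt orbT.
  by rewrite !ecnt_plant lerD2l -ecb lerDl; exact: BP_ecnt_ge0.
rewrite [qp _ _]malgEU; apply: (subspace_sum (lspan_subspace _)) => b bq.
have [c [sc Bc Bb ecb _]] := quop_branch Bp Bs nX sp bq.
have [_ _ WZ] := lspan_subspace (Bminus F gensG preo <[plant l 0 a]>).
apply: WZ; apply: lspan_mem; apply: Bminus_bvec => // l' k' c' xb.
have lt : ecnt (plant l' 0 c') < ecnt (plant l 0 a).
  have := ecnt_rootb Bb xb; rewrite /bplant /= !ecnt_plant => le.
  by rewrite ltrD2l; have := BB_ecnt_ge0 Bc; move: le ecb; lia.
by apply: preo_strict; rewrite ?lt // ltW.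
Qed.

Lemma quop_self l a : BP (plant l 0 a) -> qp <[plant l 0 a]> <[plant l 0 a]> = <[tX 0]>.
Proof.
move=> Bp; apply/malgP => b; rewrite qp_mcoeff // mcoeffU1.
have [<-|b0] := eqVneq (tX 0) b; first by rewrite Dp_coef_one // eqxx.
apply/eqP; rewrite mcoeff_eq0; apply/negP => /(Dp_supp rule_norm rule_compl Bp)[/= _ Bb].
rewrite -[RHS]addr0 => /addrI hb; have [e|] := BP_thom_gt0 Bb; first by rewrite e eqxx in b0.
by rewrite hb ltxx.
Qed.

(** The expansion is split according to whether s is t, a power of X, or neither; the factorial in
    [Dk] cancels the one in front of [Xpow S k]. *)
Lemma Deltap_formula l a (t := <[plant l 0 a]> : {malg R[symbp S]}) : BP (plant l 0 a) ->
  @Defs.Deltap R d S t = tens t (@unitp R d S)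
    + \sum_(s \in [set s | ltBp F s t /\ ~ @BpX R d S s]) tens s (quop F t s)
    + \sum_(k \in [set: mindex d]) tens ((mfact k)%:R^-1 *: Xpow S k) (Dk F k t).
Proof.
move=> Bp; have Bt : basis_vecs BP t by exists (plant l 0 a).
have [r [ur rA rE ->]] := expansion_support (qpP Bt).
have gr s : s \notin r -> qp t s = 0 by rewrite rE negbK => /eqP.
have tr : t \in r.
  by apply: contraT => /gr; rewrite /t quop_self // => /eqP; rewrite (negbTE (bvec_neq0 _ _)).
have tX0 : ~ @BpX R d S t.
  by rewrite BpXE => -[_ [k _ <-] /bvec_inj]; exact: tX_neq_plant.
have qt : qp t t = @unitp R d S by rewrite unitpE; exact: quop_self.
rewrite (bigD1_seq t tr ur) qt -addrA; congr (_ + _).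
rewrite (bigID (fun s => `[< @BpX R d S s >])) addrC; congr (_ + _).
  rewrite -big_filter; symmetry; set r' := [seq _ <- _ | _].
  have r'P s : s \in r' -> s \in r /\ @BpX R d S s.
    by rewrite mem_filter => /andP[/andP[_ /asboolP ?] ?].
  have [M rM _] : exists2 M, r' = map (fun k => <[tX k]>) M & forall k, k \in M -> True.
    apply: (map_lift (P := fun=> True)) => s /r'P[_].
    by rewrite BpXE => -[_ [k _ <-] <-]; exists k.
  have uM : uniq M.
    by rewrite -(map_inj_uniq (f := fun k => <[tX k]> : T)) -?rM ?filter_uniq // => k k' /bvec_inj/tX_inj.
  transitivity (\sum_(k \in [set: mindex d]) tens (<[tX k]> : T) (qp t <[tX k]>)).
    apply: eq_fsbigr => k _; rewrite /Dk /= XpowE tensZl tensZr scalerA mulVf ?scale1r //.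
    exact: mfact_neq0.
  rewrite rM big_map; apply: fsum_seqE => // k _ kM.
  rewrite gr ?tens0r //; apply: contra kM => kr.
  have : <[tX k]> \in r'.
    rewrite mem_filter kr andbT; apply/andP; split.
      by apply/eqP => /bvec_inj; exact: tX_neq_plant.
    by apply/asboolP; exists k => //; rewrite XpowE.
  by rewrite rM => /mapP[k' k'M /bvec_inj/tX_inj ->].
rewrite -big_filter; symmetry; apply: fsum_seqE; first exact: filter_uniq.
  move=> s; rewrite mem_filter => /andP[/andP[st /asboolPn nX] sr].
  split=> //; split; last exact/eqP.
  split=> //; first exact: rA.
  by rewrite -rE.
move=> s [[[Bs _ qs] /eqP st] nX]; rewrite mem_filter st rE qs.
by have /asboolPn-> : ~ @BpX R d S s by [].
Qed.

Lemma BHZ_C : assumptionC F.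
Proof.
exists gensG; split.
- by move=> u [[l a] /= Ba <-]; rewrite genBPE; exists <[plant l 0 a]>;
    [exists (l, a)|apply/DorbitE => //; exists 0].
- exact: gensG_fin.
- by split; [exact: genBPE|exact: gensG_triv].
- exists preo; split.
  + by move=> u _; exact: preo_refl.
  + by move=> u v w _ _ _; exact: preo_trans.
  move=> _ [[l a] /= Ba <-]; split; first exact: Deltap_formula.
  move=> s [[[c Bc <-] _ q0] st] nX.
  have {}nX : ~ range tX c by move=> [k _ ck]; apply: nX; exists k => //; rewrite XpowE ck.
  have {}st : c <> plant l 0 a by move=> e; apply: st; rewrite e.
  exact: below_quop.
move=> _ _ [[a Ba <-] na] _ _; apply/negP => /intrP[z]; rewrite /= hmgU => /(BP_int rule_compl indep Ba) e.
by apply: na; exists (rootn a) => //; rewrite XpowE -e.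
Qed.

End GeneratorsC.

Lemma choice_on (A B : Type) (P : A -> Prop) (Q : A -> B -> Prop) : B ->
  (forall x, P x -> exists y, Q x y) -> exists f, forall x, P x -> Q x (f x).
Proof.
move=> y0 PQ; suff /choice[f fP] : forall x, exists y, P x -> Q x y by exists f.
move=> x; by have [/PQ[y Qxy]|nP] := pselect (P x); [exists y|exists y0].
Qed.

Theorem theorem7 (R : realType) (d : nat) (L : finType) (h : L -> R)
    (rule : L -> set {mset (L * mindex d)}%mset) :
  (forall t, h t != 0) ->
  (forall t, rule t !=set0) ->
  rule_normal rule ->
  rule_subcritical h rule ->
  rule_complete h rule ->
  rationally_independent h ->
  exists F : frame (BHZ h rule),
    [/\ bases F, assumptionA F, assumptionB F, assumptionC F & assumptionD F].
Proof.
move=> _ _ norm sub compl indep.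
have [qp qpP] := choice_on (fun=> 0 : {malg R[dtree d L]}) (quop_exists norm compl).
have [q qP] := choice_on (fun=> 0 : {malg R[dtree d L]}) (quo_exists norm compl).
exists (BHZ_frame h rule qp q); split.
- exact: BHZ_bases.
- split; [exact: BHZ_A1|exact: BHZ_A2|exact: BHZ_A3|exact: BHZ_A4].
- exact: BHZ_B.
- exact: BHZ_C.
- exact: BHZ_D.
Qed.
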